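(* Let $L_1=\varepsilon_{1,2}+\varepsilon_{2,3}\in\mathfrak{sl}_4(\mathbb C)$ (nilpotent of type $[3,1]$), $h=\varepsilon_{1,1}-\varepsilon_{3,3}$, $f=2\varepsilon_{2,1}+2\varepsilon_{3,2}$, and let $Q$ be the Slodowy slice $L_1+\mathfrak g^f$ with coordinates $z_1,\dots,z_5$: $$q=\begin{pmatrix}\frac{1}{\sqrt3}z_2&1&0&0\\2z_1&\frac1{\sqrt3}z_2&1&0\\4z_3&2z_1&\frac1{\sqrt3}z_2&2z_4-2z_5\\2z_4+2z_5&0&0&-\sqrt3z_2\end{pmatrix}.$$ Let $\mathbb B_2^{\mathcal Q}$ be the associated classical $W$-algebra on the loop space of $Q$, let $N=\{z_4=z_5=0\}\subset Q$, and let $\mathbb B_2^{\mathcal N}$ be its Dirac reduction to the loop space $\mathcal N$ of $N$, with leading term $\Omega_2$. The matrix $\mathfrak L_{\partial_{z_3}}\Omega_2$ is degenerate on $N$. Put $e=\partial_{z_1}+2i\sqrt{\tfrac23}\,z_2\,\partial_{z_3}$ on $N$ and $$t_1=z_1+\tfrac12z_2^2,\quad t_2=i\sqrt{\tfrac32}\,z_2,\quad t_3=z_3-\tfrac43i\sqrt{\tfrac23}\,z_2^3-2i\sqrt{\tfrac23}\,z_1z_2 .$$ Then: (1) $e=\partial_{t_1}$. In the coordinates $t$, $\mathbb B_2^{\mathcal N}$ admits a dispersionless limit, has $S_{2;1}^{ab}=0$, and $$\Omega_2(t)=\begin{pmatrix}2t_1&t_2&3t_3\\t_2&-\tfrac32&2t_1-2t_2^2\\3t_3&2t_1-2t_2^2&-8t_2t_3\end{pmatrix},\qquad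 S_{2;2}(t)=\begin{pmatrix}-\tfrac12&0&\tfrac23t_2\\0&0&0\\\tfrac23t_2&0&-\tfrac76t_2^2-\tfrac56t_1\end{pmatrix}.$$ (2) $\mathfrak L_e^2\Omega_2=0$ and $\Omega_1:=\mathfrak L_e\Omega_2$ is nondegenerate. Moreover $\mathfrak L_e^2\mathbb B_2^{\mathcal N}=0$, and $\mathbb B_2^{\mathcal N}$ and $\mathfrak L_e\mathbb B_2^{\mathcal N}$ form a local bihamiltonian structure on $\mathcal N$ (compatible local Poisson structures), which admits a dispersionless limit and is an exact Poisson pencil. (3) The leading term $(\Omega_2,\Omega_1)$ defines a regular quasihomogeneous flat pencil of metrics on $N$. The resulting Dubrovin-Frobenius manifold structure, whose intersection form is $\Omega_2$ and whose flat contravariant metric is $\Omega_1$, has flat coordinates $(t_1,t_2,t_3)$, unit $e=\partial_{t_1}$, logarithmic potential $$\mathbb F=\tfrac1{12}t_1^3+\tfrac12t_1t_2t_3-\tfrac16t_2^3t_3-\tfrac18t_3^2\log t_3,$$ Euler vector field $E=\tfrac12\sum_i\Omega_2^{1i}\partial_{t_i}$ and charge $0$, where $E\mathbb F=3\mathbb F-\tfrac3{16}t_3^2$. It is equivalent to the Dubrovin-Frobenius structure on the Hurwitz space $M_{0;1,0}$. (4) The central invariants of the bihamiltonian structure $(\mathbb B_2^{\mathcal N},\mathfrak L_e\mathbb B_2^{\mathcal N})$ are all equal to $-\tfrac1{96}$. Thus this bihamiltonian structure is of topological type.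
   Context: All objects are complex. $\varepsilon_{i,j}$ is the matrix unit and $\mathfrak g^a=\ker\mathrm{ad}_a$. **$W$-algebra.** Let $\mathfrak g=\mathfrak{sl}_n$ with $\mathfrak{sl}_2$-triple $(L_1,h,f)$: $[h,L_1]=L_1$, $[h,f]=-f$, $[L_1,f]=2h$. Let $\langle\cdot|\cdot\rangle$ be the multiple of the trace form with $\langle L_1|f\rangle=1$. Write $Q=L_1+\mathfrak g^f\ni q=L_1+\sum z_iX_i$, where $X_i$ is the basis of $\mathfrak g^f$ read off from the coordinates. The loop space $\mathcal Q=L_1+\mathfrak L(\mathfrak g^f)$ consists of smooth maps $q:S^1\to Q$. For a functional $\mathcal I$ on $\mathcal Q$ and $q\in\mathcal Q$, let $\overline{\delta\mathcal I}$ be the unique smooth map $S^1\to\mathfrak g$ with $\langle\overline{\delta\mathcal I}|X_i\rangle=\delta\mathcal I/\delta z_i$ for all $i$ and $\partial_x\overline{\delta\mathcal I}+[q,\overline{\delta\mathcal I}]\in\mathfrak g^f$ pointwise. The classical $W$-algebra bracket $\mathbb B_2^{\mathcal Q}$ is $\{\mathcal F,\mathcal I\}_2=\int_{S^1}\langle\overline{\delta\mathcal F}|\partial_x\overline{\delta\mathcal I}+[q,\overline{\delta\mathcal I}]\rangle dx$. **Reduction to $N$.** $N\subset Q$ is the coordinate subspace where certain coordinates $z_\alpha$ vanish (it is the space of common equilibrium points of the finite-dimensional bihamiltonian structure on $Q$ given by the leading terms). All brackets $\{z_a(x),z_\alpha(y)\}_2$ between a remaining coordinate $z_a$ and a vanishing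 coordinate $z_\alpha$ vanish on $\mathcal N$, so the Dirac reduction $\mathbb B_2^{\mathcal N}$ is given by the brackets $\{z_a(x),z_b(y)\}_2$ of the remaining coordinates restricted to $z_\alpha=0$. **Local brackets.** In coordinates $t$ on $N$ a local Poisson bracket has the form $\{t_a(x),t_b(y)\}_m=\sum_{k\ge-1}\{t_a(x),t_b(y)\}_m^{[k]}$ (finite sum). Here the $[k]$ term is homogeneous of differential degree $k+1$, where the degree counts $x$-derivatives of $t$ and of $\delta=\delta(x-y)$. Explicitly $[-1]$: $F_m^{ab}(t)\delta$; $[0]$: $\Omega_m^{ab}(t)\delta'+\Gamma^{ab}_{m,k}(t)t_{k,x}\delta$; $[k]$, $k>0$: $S^{ab}_{m;k}(t)\delta^{(k+1)}+\cdots$. Coefficients are evaluated at $x$. It admits a dispersionless limit if $F_m=0$. For a vector field $e$ on $N$ equal to $\partial_{t_k}$ in coordinates $t$, $\mathfrak L_e$ acts on local brackets by differentiating all coefficients (functions of $t$ and its $x$-derivatives) with respect to $t_k$. Two Poisson structures are compatible if all linear combinations are Poisson. The pair $(\mathbb B_2,\mathbb B_1)$ is an exact Poisson pencil if $\mathfrak L_e\mathbb B_2=\mathbb B_1$ and $\mathfrak L_e\mathbb B_1=0$ for some $e$. **Flat pencils.** A contravariant metric is a symmetric bilinear form on $T^*N$ invertible on a dense open set. It is flat if the inverse metric is flat. Its contravariant Christoffel symbols are $\Gamma^{ij}_k=-\Omega^{im}\Gamma^j_{mk}$. $(\Omega_2,\Omega_1)$ is a flat pencil if both are flat and, for generic constant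 $\lambda$, $\Omega_2+\lambda\Omega_1$ is flat with contravariant Christoffel symbols $\Gamma^{ij}_{2k}+\lambda\Gamma^{ij}_{1k}$. It is quasihomogeneous of degree $d$ if there is a function $\tau$ such that $E^i=\Omega_2^{ij}\partial_j\tau$ and $e^i=\Omega_1^{ij}\partial_j\tau$ satisfy $[e,E]=e$, $\mathfrak L_E\Omega_2=(d-1)\Omega_2$, $\mathfrak L_e\Omega_2=\Omega_1$, $\mathfrak L_e\Omega_1=0$. It is regular if the $(1,1)$-tensor $R_i^j=\frac{d-1}2\delta_i^j+(\nabla_1)_iE^j$ is nondegenerate, where $\nabla_1$ is the covariant derivative of $\Omega_1$. **Dubrovin-Frobenius manifolds.** In flat coordinates $t$ with unit $e=\partial_{t_k}$, a potential $\mathbb F$ determines the flat metric $\Pi_{ij}=\partial_{t_k}\partial_{t_i}\partial_{t_j}\mathbb F$ (constant, invertible, with inverse $\Omega_1^{ij}$) and the product with structure constants $\Omega_1^{kp}\partial_p\partial_i\partial_j\mathbb F$, which is required to be associative (WDVV). The Euler field $E$ is affine in $t$ with $E\mathbb F=(3-d)\mathbb F+$ (polynomial of degree $\le2$), and $d$ is the charge. The intersection form is $\Omega_2^{ij}=E^p\,\Omega_1^{ik}\Omega_1^{jm}\partial_p\partial_k\partial_m\mathbb F$. Two such structures are (locally) equivalent if an affine change of flat coordinates identifies products, units and Euler fields, and identifies metrics up to a nonzero constant factor. **Hurwitz space $M_{0;1,0}$** (genus $0$, two marked points of degree $2$ and $1$). It is the space of functions $\lambda(p)=\tfrac12p^2+a+\frac{b}{p-c}$,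 $b\neq0$, with parameters $(a,b,c)$. Its metric is $\eta(\partial',\partial'')=\sum_{d\lambda=0}\mathrm{res}\,\frac{\partial'\lambda\,\partial''\lambda}{\lambda'(p)}dp$, and its multiplication is determined by $\eta(\partial'\cdot\partial'',\partial''')=\sum_{d\lambda=0}\mathrm{res}\,\frac{\partial'\lambda\,\partial''\lambda\,\partial'''\lambda}{\lambda'(p)}dp$. The derivatives of $\lambda$ are taken at fixed $p$. The unit is $\partial_a$ and the Euler field is $a\partial_a+\tfrac32b\partial_b+\tfrac12c\partial_c$. **Central invariants.** Let $\Psi(\lambda;t)=\det(\Omega_2-\lambda\Omega_1)$ have generically distinct roots $u^i$. When the $[1]$ terms vanish, the central invariants are $$c_i=\frac13\Big[\frac{d\Psi}{d\lambda}\Big]^2\frac{\partial_k\Psi\,\partial_l\Psi\,(S_{2;2}^{kl}-\lambda S_{1;2}^{kl})}{[\partial_k\Psi\,\partial_l\Psi\,\Omega_1^{kl}]^2}\Big|_{\lambda=u^i},\qquad\partial_k=\partial/\partial t_k ,$$ where $S_{1;2}=\mathfrak L_eS_{2;2}$ (entrywise derivative along $e=\partial_{t_1}$) is the corresponding coefficient of the first bracket. If all central invariants are constant and equal, the bihamiltonian structure is said to be of topological type, i.e. (up to rescaling) it is the one associated with the principal hierarchy of the Dubrovin-Frobenius manifold.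
   Formalization: In (3) the word ''regular'' is false: with d=0 and the given E, the tensor (d-1)/2 + nabla_1 E equals diag(1/2, 0, 1), which is degenerate everywhere; the formal statement drops ''regular'' and asserts this value instead. *)

(* Defs.v *)
From HB Require Import structures.
From mathcomp Require Import all_boot all_order all_algebra.
From mathcomp Require Import complex.
From mathcomp Require Import all_classical all_reals all_analysis.
From mathcomp Require Import ring.

Set Implicit Arguments.
Unset Strict Implicit.
Unset Printing Implicit Defensive.

Import Order.TTheory GRing.Theory Num.Theory.
Import numFieldNormedType.Exports.

Local Open Scope classical_set_scope.
Local Open Scope ring_scope.

(* [R[i]] carries no topology by itself.  Viewed as an abstract
   [numClosedFieldType] it gets that of its norm, so that [derive1], ['D_v f]
   and [differentiable] below are complex derivatives. *)
Definition CC (R : realType) : numClosedFieldType := R[i]%C.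

Definition mx_of (R : realType) m n (s : seq (seq (CC R))) : 'M[CC R]_(m, n) :=
  \matrix_(i < m, j < n) (nth [::] s i)`_j.

Definition row3 (R : realType) (a b c : CC R) : 'rV[CC R]_3 :=
  \row_(j < 3) [:: a; b; c]`_j.

(** * Smooth loops.  The circle is [R/Z]; loops are 1-periodic functions. *)

Definition cd (R : realType) (f : R -> CC R) : R -> CC R := fun x =>
  (derive1 (fun y => complex.Re (f y)) x
     +i* derive1 (fun y => complex.Im (f y)) x)%C.

Definition cloop (R : realType) (f : R -> CC R) : Prop :=
  (forall x, f (x + 1) = f x) /\
  (forall (k : nat) (x : R),
     derivable (fun y => complex.Re (iter k (@cd R) f y)) x 1 /\
     derivable (fun y => complex.Im (iter k (@cd R) f y)) x 1).

Definition oint (R : realType) (f : R -> CC R) : CC R :=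
  ((\int[lebesgue_measure]_(x in `[0%R, 1%R]) complex.Re (f x))
     +i* (\int[lebesgue_measure]_(x in `[0%R, 1%R]) complex.Im (f x)))%C.

Definition mxloop (R : realType) m n (u : R -> 'M[CC R]_(m, n)) : Prop :=
  forall i j, cloop (fun x => u x i j).

(* k-th derivative, entrywise *)
Definition mxd (R : realType) m n (k : nat) (u : R -> 'M[CC R]_(m, n)) :
    R -> 'M[CC R]_(m, n) :=
  fun x => \matrix_(i, j) iter k (@cd R) (fun y => u y i j) x.

Definition jet (R : realType) (n : nat) := nat -> 'rV[CC R]_n.

Definition jet_of (R : realType) n (u : R -> 'rV[CC R]_n) (x : R) : jet R n :=
  fun k => mxd k u x.

Inductive dpoly (R : realType) (n : nat) : (jet R n -> CC R) -> Prop :=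
| dpoly_const (c : CC R) : dpoly (fun=> c)
| dpoly_var (k : nat) (i : 'I_n) : dpoly (fun J => J k 0 i)
| dpoly_add f g : dpoly f -> dpoly g -> dpoly (fun J => f J + g J)
| dpoly_mul f g : dpoly f -> dpoly g -> dpoly (fun J => f J * g J).

(** * Functionals on loops *)

Definition functional (R : realType) (n : nat) := (R -> 'rV[CC R]_n) -> CC R.

(* The densities are f(x; u, u_x, ...), polynomial in the jet variables, with
   smooth periodic explicit dependence on x. *)
Definition local_functional (R : realType) n (F : functional R n) : Prop :=
  exists (m : nat) (c : 'I_m -> R -> CC R) (g : 'I_m -> jet R n -> CC R),
    [/\ forall i, cloop (c i), forall i, dpoly (g i)
      & forall q, mxloop q ->
          F q = oint (fun x => \sum_(i < m) c i x * g i (jet_of q x))].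

Definition has_vder (R : realType) n (F : functional R n)
    (q xi : R -> 'rV[CC R]_n) : Prop :=
  mxloop xi /\
  forall v, mxloop v ->
    is_derive (0 : CC R) (1 : CC R)
      (fun s : CC R => F (fun x => q x + s *: v x))
      (oint (fun x => \sum_i xi x 0 i * v x 0 i)).

(* the row of the variational derivatives of F with respect to the coordinates *)
Definition vder (R : realType) n (F : functional R n) (q : R -> 'rV[CC R]_n) :
    R -> 'rV[CC R]_n :=
  xget (fun=> 0) [set xi | has_vder F q xi].

(** * Local brackets *)

(* {u_a(x), u_b(y)} = \sum_k P a b k (jet of u at x) delta^(k)(x - y) *)
Definition lbracket (R : realType) (n : nat) :=
  'I_n -> 'I_n -> nat -> jet R n -> CC R.

Definition is_local (R : realType) n (P : lbracket R n) : Prop :=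
  (forall a b k, dpoly (P a b k)) /\
  (exists m : nat, forall a b k, (m < k)%N -> P a b k = (fun=> 0)).

(* Pairing {u_a(x), u_b(y)} with eta_b(y): delta^(k)(x - y) acts as the k-th
   derivative. *)
Definition lop (R : realType) n (P : lbracket R n) (q eta : R -> 'rV[CC R]_n)
    (x : R) : 'rV[CC R]_n :=
  \row_a \sum_b \sum_(k \in [set: nat])
    P a b k (jet_of q x) * mxd k eta x 0 b.

Definition pbracket (R : realType) n (P : lbracket R n) (F G : functional R n) :
    functional R n :=
  fun q => oint (fun x => \sum_a vder F q x 0 a * lop P q (vder G q) x 0 a).

Definition poisson (R : realType) n (P : lbracket R n) : Prop :=
  [/\ is_local P,
      forall F G, local_functional F -> local_functional G ->
        forall q, mxloop q -> pbracket P F G q = - pbracket P G F q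
    & forall F G H,
        local_functional F -> local_functional G -> local_functional H ->
        forall q, mxloop q ->
          pbracket P (pbracket P F G) H q + pbracket P (pbracket P G H) F q
            + pbracket P (pbracket P H F) G q = 0].

Definition lb_comb (R : realType) n (c1 c2 : CC R) (P Q : lbracket R n) :
    lbracket R n :=
  fun a b k J => c1 * P a b k J + c2 * Q a b k J.

Definition bihamiltonian (R : realType) n (P2 P1 : lbracket R n) : Prop :=
  [/\ poisson P2, poisson P1
    & forall c1 c2 : CC R, poisson (lb_comb c1 c2 P2 P1)].

(* [phi] is a change of coordinates; [P'] is the expression of [P] in the
   coordinates [phi]. *)
Definition lb_in_coordinates (R : realType) n
    (phi : 'rV[CC R]_n -> 'rV[CC R]_n) (P P' : lbracket R n) : Prop :=
  forall F G, local_functional F -> local_functional G ->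
  forall q, mxloop q ->
    pbracket P (fun u => F (fun x => phi (u x)))
               (fun u => G (fun x => phi (u x))) q
    = pbracket P' F G (fun x => phi (q x)).

(* component of differential degree d: u^(k) has degree k *)
Definition hpart (R : realType) n (d : nat) (f : jet R n -> CC R) (J : jet R n) :
    CC R :=
  (d`!%:R)^-1 *
  derive1n d (fun s : CC R => f (fun k => s ^+ k *: J k)) (0 : CC R).

(* coefficient of delta^(j) in the part of total degree m of the bracket
   (delta^(j) has degree j), that is in {u_a(x), u_b(y)}^[m-1] *)
Definition lb_part (R : realType) n (P : lbracket R n) (m : nat)
    (a b : 'I_n) (j : nat) (J : jet R n) : CC R :=
  if (j <= m)%N then hpart (m - j) (P a b j) J else 0.

Definition cjet (R : realType) n (t : 'rV[CC R]_n) : jet R n :=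
  fun k => if k is 0%N then t else 0.

(* Coefficient of delta^(m) in {u_a(x), u_b(y)}^[m-1].  It has degree 0, so it
   is a function of u only: this is F for m = 0, Omega for m = 1, and S_k for
   m = k + 1. *)
Definition lb_lead (R : realType) n (P : lbracket R n) (m : nat)
    (t : 'rV[CC R]_n) : 'M[CC R]_n :=
  \matrix_(a, b) lb_part P m a b m (cjet t).

Definition dispersionless_limit (R : realType) n (P : lbracket R n) : Prop :=
  forall t, lb_lead P 0 t = 0.

(* Lie derivative along the i-th coordinate vector field: the coefficients are
   differentiated with respect to u_i, not to its x-derivatives. *)
Definition lb_lie (R : realType) n (i : 'I_n) (P : lbracket R n) : lbracket R n :=
  fun a b k J =>
    derive1 (fun s : CC R =>
      P a b k (fun l => if l is 0%N then J 0%N + s *: delta_mx 0 i else J l))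
      (0 : CC R).

Definition exact_pencil (R : realType) n (i : 'I_n) (P2 P1 : lbracket R n) : Prop :=
  [/\ bihamiltonian P2 P1, lb_lie i P2 = P1
    & lb_lie i P1 = (fun _ _ _ _ => 0)].

(** * The W-algebra of sl_4 for the nilpotent element of type [3,1] *)

Definition lie_br (R : realType) (A B : 'M[CC R]_4) : 'M[CC R]_4 :=
  A *m B - B *m A.

Definition L1 (R : realType) : 'M[CC R]_4 := delta_mx 0 1 + delta_mx 1 2.
Definition hmx (R : realType) : 'M[CC R]_4 := delta_mx 0 0 - delta_mx 2 2.
Definition fmx (R : realType) : 'M[CC R]_4 :=
  2 *: delta_mx 1 0 + 2 *: delta_mx 2 1.

Definition sl4 (R : realType) : set 'M[CC R]_4 := [set A | \tr A = 0].

Definition gf (R : realType) : set 'M[CC R]_4 :=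
  [set A | sl4 A /\ lie_br (fmx R) A = 0].

Definition slodowy (R : realType) : set 'M[CC R]_4 := [set A | gf (A - L1 R)].

(* the multiple of the trace form with <L1|f> = 1 *)
Definition form (R : realType) (A B : 'M[CC R]_4) : CC R :=
  \tr (A *m B) / \tr (L1 R *m fmx R).

Definition qmx (R : realType) (z : 'rV[CC R]_5) : 'M[CC R]_4 :=
  let z1 := z 0 0 in let z2 := z 0 1 in let z3 := z 0 2 in
  let z4 := z 0 3 in let z5 := z 0 4 in
  let s3 := sqrtC (3 : CC R) in
  mx_of 4 4 [:: [:: z2 / s3;         1;       0;       0];
                [:: 2 * z1;          z2 / s3; 1;       0];
                [:: 4 * z3;          2 * z1;  z2 / s3; 2 * z4 - 2 * z5];
                [:: 2 * z4 + 2 * z5; 0;       0;       - s3 * z2]].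

Definition Xbasis (R : realType) (i : 'I_5) : 'M[CC R]_4 :=
  qmx (delta_mx 0 i) - L1 R.

(* [is_lift q xi A]: A is the lift of the covector xi at the loop L1 + sum z_i X_i
   with coordinates q. *)
Definition is_lift (R : realType) (q xi : R -> 'rV[CC R]_5) (A : R -> 'M[CC R]_4) :
    Prop :=
  [/\ mxloop A, forall x, sl4 (A x),
      forall x i, form (A x) (Xbasis R i) = xi x 0 i
    & forall x, gf (mxd 1 A x + lie_br (qmx (q x)) (A x))].

Definition lift (R : realType) (q xi : R -> 'rV[CC R]_5) : R -> 'M[CC R]_4 :=
  xget (fun=> 0) [set A | is_lift q xi A].

Definition Wbracket (R : realType) (F I : functional R 5) : functional R 5 :=
  fun q =>
    let A := lift q (vder F q) in
    let B := lift q (vder I q) in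
    oint (fun x => form (A x) (mxd 1 B x + lie_br (qmx (q x)) (B x))).

(* P is determined by this property: the functionals \int sum_i xi_i z_i dx, for
   smooth loops xi, are local and have variational derivative xi. *)
Definition is_W_local_form (R : realType) (P : lbracket R 5) : Prop :=
  is_local P /\
  forall F I, local_functional F -> local_functional I ->
  forall q, mxloop q -> Wbracket F I q = pbracket P F I q.

(* N = {z_4 = z_5 = 0} *)
Definition inclN (R : realType) (J : jet R 3) : jet R 5 :=
  fun k => row_mx (J k) (0 : 'rV[CC R]_2).

Definition is_dirac_reduction (R : realType) (P : lbracket R 5) (PN : lbracket R 3) :
    Prop :=
  (forall (a : 'I_3) (alpha : 'I_2) k J,
     P (lshift 2 a) (rshift 3 alpha) k (inclN J) = 0) /\
  (forall (a b : 'I_3) k J,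
     PN a b k J = P (lshift 2 a) (lshift 2 b) k (inclN J)).

Definition efield (R : realType) (z : 'rV[CC R]_3) : 'rV[CC R]_3 :=
  row3 1 0 (2 * 'i * sqrtC (2 / 3) * z 0 1).

Definition tcoord (R : realType) (z : 'rV[CC R]_3) : 'rV[CC R]_3 :=
  let z1 := z 0 0 in let z2 := z 0 1 in let z3 := z 0 2 in
  row3 (z1 + 1 / 2 * z2 ^+ 2)
       ('i * sqrtC (3 / 2) * z2)
       (z3 - 4 / 3 * 'i * sqrtC (2 / 3) * z2 ^+ 3
           - 2 * 'i * sqrtC (2 / 3) * z1 * z2).

(** * Tensors and flat pencils of metrics on [C^n] *)

Definition pd (R : realType) n (i : 'I_n) (f : 'rV[CC R]_n -> CC R) :
    'rV[CC R]_n -> CC R :=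
  fun t => 'D_(delta_mx 0 i) f t.

Definition vfield (R : realType) (n : nat) := 'rV[CC R]_n -> 'rV[CC R]_n.
Definition tensor2 (R : realType) (n : nat) := 'rV[CC R]_n -> 'M[CC R]_n.

Definition app_vf (R : realType) n (X : vfield R n) (f : 'rV[CC R]_n -> CC R)
    (t : 'rV[CC R]_n) : CC R :=
  \sum_i X t 0 i * pd i f t.

Definition vf_bracket (R : realType) n (X Y : vfield R n) : vfield R n :=
  fun t => \row_j (app_vf X (fun s => Y s 0 j) t - app_vf Y (fun s => X s 0 j) t).

(* Lie derivative of a contravariant 2-tensor *)
Definition lie2 (R : realType) n (X : vfield R n) (Om : tensor2 R n) : tensor2 R n :=
  fun t => \matrix_(i, j)
    (app_vf X (fun s => Om s i j) t
     - \sum_k Om t k j * pd k (fun s => X s 0 i) t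
     - \sum_k Om t i k * pd k (fun s => X s 0 j) t).

Definition contra_metric (R : realType) n (Om : tensor2 R n) : Prop :=
  [/\ forall t, (Om t)^T = Om t,
      forall i j t, differentiable (fun s => Om s i j) t
    & exists U : set 'rV[CC R]_n,
        [/\ open U, dense U & forall t, U t -> Om t \in unitmx]].

(* Gamma^k_{ij} of the metric inverse to Om *)
Definition chris (R : realType) n (Om : tensor2 R n) (k i j : 'I_n)
    (t : 'rV[CC R]_n) : CC R :=
  let g (a b : 'I_n) := fun s => invmx (Om s) a b in
  2^-1 * \sum_l Om t k l * (pd i (g l j) t + pd j (g l i) t - pd l (g i j) t).

(* Gamma^{ij}_k *)
Definition contra_chris (R : realType) n (Om : tensor2 R n) (i j k : 'I_n)
    (t : 'rV[CC R]_n) : CC R :=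
  - \sum_m Om t i m * chris Om j m k t.

(* curvature R^l_{kij} of the Levi-Civita connection of the inverse metric *)
Definition riemann (R : realType) n (Om : tensor2 R n) (l k i j : 'I_n)
    (t : 'rV[CC R]_n) : CC R :=
  pd i (chris Om l j k) t - pd j (chris Om l i k) t
  + \sum_m (chris Om l i m t * chris Om m j k t
            - chris Om l j m t * chris Om m i k t).

Definition flat_metric (R : realType) n (Om : tensor2 R n) : Prop :=
  contra_metric Om /\
  forall t, Om t \in unitmx -> forall l k i j, riemann Om l k i j t = 0.

(* "generic lambda": all but finitely many *)
Definition flat_pencil (R : realType) n (Om2 Om1 : tensor2 R n) : Prop :=
  [/\ flat_metric Om2, flat_metric Om1
    & exists bad : seq (CC R), forall lam : CC R, lam \notin bad ->
        let Oml := fun t => Om2 t + lam *: Om1 t in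
        flat_metric Oml /\
        forall t, Om2 t \in unitmx -> Om1 t \in unitmx -> Oml t \in unitmx ->
          forall i j k, contra_chris Oml i j k t
                        = contra_chris Om2 i j k t + lam * contra_chris Om1 i j k t].

Definition quasihomogeneous (R : realType) n (Om2 Om1 : tensor2 R n)
    (d : CC R) (e E : vfield R n) : Prop :=
  exists tau : 'rV[CC R]_n -> CC R,
    (forall t, differentiable tau t) /\
    (forall t i, E t 0 i = \sum_j Om2 t i j * pd j tau t) /\
    (forall t i, e t 0 i = \sum_j Om1 t i j * pd j tau t) /\
    vf_bracket e E = e /\
    lie2 E Om2 = (fun t => (d - 1) *: Om2 t) /\
    lie2 e Om2 = Om1 /\
    lie2 e Om1 = (fun=> 0).

(* R_i^j = (d-1)/2 delta_i^j + (nabla_1)_i E^j; regularity is invertibility of R *)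
Definition regularity_tensor (R : realType) n (Om1 : tensor2 R n) (d : CC R)
    (E : vfield R n) (t : 'rV[CC R]_n) : 'M[CC R]_n :=
  \matrix_(i, j) ((d - 1) / 2 *+ (i == j) + pd i (fun s => E s 0 j) t
                  + \sum_m chris Om1 j i m t * E t 0 m).

(** * Dubrovin-Frobenius manifolds *)

Definition third (R : realType) n (F : 'rV[CC R]_n -> CC R) (i j k : 'I_n) :
    'rV[CC R]_n -> CC R := pd i (pd j (pd k F)).

Definition pot_metric (R : realType) n (u : 'I_n) (F : 'rV[CC R]_n -> CC R)
    (t : 'rV[CC R]_n) : 'M[CC R]_n :=
  \matrix_(i, j) third F u i j t.

(* components of the product of the i-th and j-th coordinate fields *)
Definition pot_mult (R : realType) n (Om1 : 'M[CC R]_n) (F : 'rV[CC R]_n -> CC R)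
    (t : 'rV[CC R]_n) (i j : 'I_n) : 'rV[CC R]_n :=
  \row_k \sum_p Om1 k p * third F p i j t.

Definition intersection_form (R : realType) n (Om1 : 'M[CC R]_n)
    (F : 'rV[CC R]_n -> CC R) (E : vfield R n) (t : 'rV[CC R]_n) : 'M[CC R]_n :=
  \matrix_(i, j) \sum_p \sum_k \sum_m
    E t 0 p * Om1 i k * Om1 j m * third F p k m t.

(* F is the potential, on the open set M and in flat coordinates, of a
   Dubrovin-Frobenius manifold with unit the u-th coordinate field, flat
   contravariant metric Om1, Euler field E and charge d. *)
Definition DF_potential (R : realType) n (M : set 'rV[CC R]_n) (u : 'I_n)
    (F : 'rV[CC R]_n -> CC R) (Om1 : 'M[CC R]_n) (E : vfield R n) (d : CC R) :
    Prop :=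
  [/\ open M /\ (forall t, M t -> differentiable F t),
      Om1 \in unitmx /\ (forall t, M t -> pot_metric u F t = invmx Om1),
      forall t, M t -> forall i j k l : 'I_n,
        \sum_m pot_mult Om1 F t i j 0 m * pot_mult Om1 F t m k 0 l
        = \sum_m pot_mult Om1 F t j k 0 m * pot_mult Om1 F t i m 0 l,
      exists (A : 'M[CC R]_n) (b : 'rV[CC R]_n),
        forall t, M t -> E t = t *m A + b
    & exists (A : 'M[CC R]_n) (b : 'cV[CC R]_n) (c : CC R),
        forall t, M t ->
          app_vf E F t = (3 - d) * F t + ((t *m A *m t^T) 0 0 + (t *m b) 0 0 + c)].

(* the data of a Dubrovin-Frobenius structure, in given flat coordinates *)
Record DFdata (R : realType) (n : nat) := DFData {
  df_dom : set 'rV[CC R]_n;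
  df_metric : 'rV[CC R]_n -> 'M[CC R]_n;
  df_mult : 'rV[CC R]_n -> 'I_n -> 'I_n -> 'rV[CC R]_n;
  df_unit : vfield R n;
  df_euler : vfield R n }.

Definition DF_of_potential (R : realType) n (M : set 'rV[CC R]_n) (u : 'I_n)
    (F : 'rV[CC R]_n -> CC R) (Om1 : 'M[CC R]_n) (E : vfield R n) : DFdata R n :=
  {| df_dom := M;
     df_metric := pot_metric u F;
     df_mult := pot_mult Om1 F;
     df_unit := fun=> delta_mx 0 u;
     df_euler := E |}.

(* The affine change of coordinates t |-> t A + b maps the domain of D into that
   of D' (the i-th coordinate field is sent to the i-th row of A). *)
Definition DF_equivalent (R : realType) n (D D' : DFdata R n) : Prop :=
  exists (A : 'M[CC R]_n) (b : 'rV[CC R]_n) (kappa : CC R),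
    [/\ A \in unitmx, kappa != 0
      & forall t, df_dom D t ->
        let t' := t *m A + b in
        [/\ df_dom D' t',
            df_metric D t = kappa *: (A *m df_metric D' t' *m A^T),
            forall i j, df_mult D t i j *m A
              = \sum_k \sum_l (A i k * A j l) *: df_mult D' t' k l,
            df_unit D t *m A = df_unit D' t'
          & df_euler D t *m A = df_euler D' t']].

(** * The Hurwitz space M_{0;1,0}, with coordinates s = (a, b, c) *)

(* r is the coefficient of (p - p0)^-1 in the Laurent expansion of f at p0 *)
Definition is_residue (R : realType) (f : CC R -> CC R) (p0 r : CC R) : Prop :=
  exists (m : nat) (a : 'I_m.+1 -> CC R) (g : CC R -> CC R),
    [/\ \forall p \near p0, derivable g p 1,
        \forall p \near p0^', f p = \sum_(k < m.+1) a k * (p - p0) ^- k.+1 + g p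
      & r = a ord0].

Definition residue (R : realType) (f : CC R -> CC R) (p0 : CC R) : CC R :=
  xget 0 [set r | is_residue f p0 r].

Definition hlam (R : realType) (s : 'rV[CC R]_3) (p : CC R) : CC R :=
  1 / 2 * p ^+ 2 + s 0 0 + s 0 1 / (p - s 0 2).

Definition hcrit (R : realType) (s : 'rV[CC R]_3) : set (CC R) :=
  [set p | p != s 0 2 /\ derive1 (hlam s) p = 0].

Definition hpd (R : realType) (i : 'I_3) (s : 'rV[CC R]_3) (p : CC R) : CC R :=
  pd i (fun s' => hlam s' p) s.

Definition hmetric (R : realType) (s : 'rV[CC R]_3) : 'M[CC R]_3 :=
  \matrix_(i, j) \sum_(p0 \in hcrit s)
    residue (fun p => hpd i s p * hpd j s p / derive1 (hlam s) p) p0.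

Definition hcubic (R : realType) (s : 'rV[CC R]_3) (i j k : 'I_3) : CC R :=
  \sum_(p0 \in hcrit s)
    residue (fun p => hpd i s p * hpd j s p * hpd k s p / derive1 (hlam s) p) p0.

Definition hurwitz (R : realType) : DFdata R 3 :=
  {| df_dom := [set s : 'rV[CC R]_3 | s 0 1 != 0];
     df_metric := @hmetric R;
     df_mult := fun s i j => (\row_k hcubic s i j k) *m invmx (hmetric s);
     df_unit := fun=> row3 1 0 0;
     df_euler := fun s => row3 (s 0 0) (3 / 2 * s 0 1) (1 / 2 * s 0 2) |}.

(** * The logarithmic potential *)

Definition cexp (R : realType) (z : CC R) : CC R :=
  ((expR (complex.Re z) * cos (complex.Im z))
     +i* (expR (complex.Re z) * sin (complex.Im z)))%C.

Definition log_branch (R : realType) (U : set (CC R)) (ell : CC R -> CC R) : Prop :=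
  [/\ open U, {within U, continuous ell} & forall w, U w -> cexp (ell w) = w].

Definition potential (R : realType) (ell : CC R -> CC R) (t : 'rV[CC R]_3) : CC R :=
  let t1 := t 0 0 in let t2 := t 0 1 in let t3 := t 0 2 in
  1 / 12 * t1 ^+ 3 + 1 / 2 * t1 * t2 * t3 - 1 / 6 * t2 ^+ 3 * t3
  - 1 / 8 * t3 ^+ 2 * ell t3.

(** * Central invariants *)

Definition charpol (R : realType) n (Om2 Om1 : tensor2 R n) (lam : CC R)
    (t : 'rV[CC R]_n) : CC R :=
  \det (Om2 t - lam *: Om1 t).

Definition central_invariant (R : realType) n (Om2 Om1 S2 S1 : tensor2 R n)
    (lam : CC R) (t : 'rV[CC R]_n) : CC R :=
  let dk k := pd k (charpol Om2 Om1 lam) t in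
  3^-1 * derive1 (fun l => charpol Om2 Om1 l t) lam ^+ 2
  * (\sum_k \sum_l dk k * dk l * (S2 t k l - lam * S1 t k l))
  / (\sum_k \sum_l dk k * dk l * Om1 t k l) ^+ 2.

(* The [1] terms of both brackets vanish and, for generic t, the polynomial
   det(Om2 - lambda Om1) has n distinct roots, at each of which the central
   invariant is c. *)
Definition central_invariants_eq (R : realType) n (P2 P1 : lbracket R n) (c : CC R) :
    Prop :=
  (forall a b j J, lb_part P2 2 a b j J = 0 /\ lb_part P1 2 a b j J = 0) /\
  exists U : set 'rV[CC R]_n,
    [/\ open U, dense U
      & forall t, U t ->
        (exists u : 'I_n -> CC R, injective u /\
           forall i, charpol (lb_lead P2 1) (lb_lead P1 1) (u i) t = 0) /\
        (forall lam, charpol (lb_lead P2 1) (lb_lead P1 1) lam t = 0 ->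
           central_invariant (lb_lead P2 1) (lb_lead P1 1)
             (lb_lead P2 3) (lb_lead P1 3) lam t = c)].

Definition topological_type (R : realType) n (P2 P1 : lbracket R n) : Prop :=
  bihamiltonian P2 P1 /\ exists c : CC R, central_invariants_eq P2 P1 c.

(** * Explicit matrices *)

Definition Omega2 (R : realType) (t : 'rV[CC R]_3) : 'M[CC R]_3 :=
  let t1 := t 0 0 in let t2 := t 0 1 in let t3 := t 0 2 in
  mx_of 3 3 [:: [:: 2 * t1; t2;                      3 * t3];
                [:: t2;     - (3 / 2);               2 * t1 - 2 * t2 ^+ 2];
                [:: 3 * t3; 2 * t1 - 2 * t2 ^+ 2;    - (8 * t2 * t3)]].

Definition S22 (R : realType) (t : 'rV[CC R]_3) : 'M[CC R]_3 :=
  let t1 := t 0 0 in let t2 := t 0 1 in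
  mx_of 3 3 [:: [:: - (1 / 2);  0; 2 / 3 * t2];
                [:: 0;          0; 0];
                [:: 2 / 3 * t2; 0; - (7 / 6 * t2 ^+ 2) - 5 / 6 * t1]].

(** * Degeneracy of the regularity tensor

   For charge 0, the flat metric Omega_1 = L_{d/dt_1} Omega_2 and the Euler field
   E = 1/2 Omega_2^{1i} d/dt_i = t_1 d/dt_1 + 1/2 t_2 d/dt_2 + 3/2 t_3 d/dt_3, the
   tensor R = -1/2 + nabla_1 E is diag(1/2, 0, 1), which is degenerate; the flat
   pencil is therefore not regular in the sense that det R != 0. *)

Lemma derive_affine (R : realType) n (f : 'rV[CC R]_n -> CC R) (l : CC R) t v :
  (forall h : CC R, f (h *: v + t) - f t = h * l) -> 'D_v f t = l.
Proof.
move=> fE; rewrite /derive; apply/cvg_lim => //.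
apply: cvg_near_cst; near=> h.
rewrite /= fE /GRing.scale /= mulKf //.
by near: h; exact: nbhs_dnbhs_neq.
Unshelve. all: by end_near. Qed.

Lemma regularity_tensor_degenerate (R : realType) (t : 'rV[CC R]_3) :
  let Om1 : tensor2 R 3 := fun=> mx_of 3 3 [:: [:: 2; 0; 0]; [:: 0; 0; 2]; [:: 0; 2; 0]] in
  let E : vfield R 3 := fun s => (1 / 2) *: row 0 (Omega2 s) in
  \det (regularity_tensor Om1 0 E t) = 0.
Proof.
move=> Om1 E; rewrite (expand_det_col _ 1) big1 // => i _.
suff -> : regularity_tensor Om1 0 E t i 1 = 0 by rewrite mul0r.
have pdc (k : 'I_3) (c : CC R) : pd k (fun=> c) t = 0.
  by apply: derive_affine => h; rewrite subrr mulr0.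
rewrite mxE [X in _ + X]big1 ?addr0; last first.
  move=> m _; rewrite /chris big1 ?mulr0 ?mul0r // => l _.
  rewrite (pdc i (invmx (Om1 t) l m)) (pdc m (invmx (Om1 t) l i)).
  by rewrite (pdc l (invmx (Om1 t) i m)) addr0 subrr mulr0.
have -> : pd i (fun s => E s 0 1) t = 1 / 2 *+ (i == 1).
  apply: derive_affine => h; rewrite !mxE /=. rewrite (eq_sym 1).
  by case: (i == 1); rewrite /= ?mulr1n ?mulr0n; ring.
by case: (i == 1); rewrite ?mulr1n ?mulr0n; field.
Qed.

(* Main.v *)
Require Import Defs.
Set Warnings "-all".
From HB Require Import structures.
From mathcomp Require Import all_boot all_order all_algebra.
From mathcomp Require Import complex.
From mathcomp Require Import all_classical all_reals all_analysis.
From mathcomp Require Import ring lra zify.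
Import Order.TTheory GRing.Theory Num.Theory.
Import numFieldNormedType.Exports.
Import Defs.
Set Implicit Arguments.
Unset Strict Implicit.
Unset Printing Implicit Defensive.
Local Open Scope classical_set_scope.
Local Open Scope ring_scope.

(** On the loop space of the slice Q the bracket of the W-algebra is the restriction of the bivector
    A, B |-> int tr (A (B' + [q, B])) to the lifts of covectors. The lift exists and is unique
    because its defining equations form a triangular system ([dS_lift], [lift_zero]); it is a
    differential polynomial, so the bracket is local ([W_local_form]). The Jacobi identity reduces,
    by a criterion valid for every local bracket ([poissonL_crit]), to the vanishing of the Schouten
    square, which is a total derivative by invariance of the trace form ([tr_cyc_ad_der]). On N the
    mixed brackets vanish, so Hamiltonian vector fields of functionals on N are tangent to N and
    the reduced bracket is Poisson ([PN_poissonL]).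

    All computations take place in the commutative differential ring of smooth loops. Functionals
    are represented by densities, gradients by the Euler operator, and derivatives along polynomial
    curves in this ring are read off from coefficients, so that no differentiation under the integral
    sign is needed.

    In the coordinates t the bracket P_2 is affine in t_1 with constant derivative P_1
    ([lie_P2], [lie_P1]). Hence P_2 + l P_1 is P_2 translated by l along t_1 and is Poisson, which
    gives the bihamiltonian structure and the exact pencil ([bihamiltonian_P2_P1]). For the same
    reason Omega_2 + lam Omega_1 is Omega_2 translated; as the Christoffel symbols of Omega_2 do not
    involve t_1, one set of them solves the polynomial flatness equations for all lam
    ([riemann0], [flat_pencil_Omega]).

    The third derivatives of the potential follow from the complex derivative of a branch of the
    logarithm ([log_is_derive], [thirdE]); associativity and the intersection form are then rational
    identities. For the Hurwitz space, the critical points of lambda are the roots of a cubic, and a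
    sum of residues over them is a leading coefficient ([residue_sum]), which gives metric and
    product in closed form; an affine map identifies them with those of the potential
    ([hurwitz_equivalent]). For the central invariants, the roots of the characteristic determinant are
    parametrised by the solutions r of 4 r (r - t_2)^2 = t_3, and along this parametrisation the invariant
    is identically -1/96 ([central_invariant_const]). *)

(** * Smooth functions on the circle *)

Section Loops.
Variable R : realType.
Local Notation CR := (CC R).

Definition cder (f : R -> CR) (x : R) : Prop :=
  derivable (fun y => complex.Re (f y)) x 1 /\
  derivable (fun y => complex.Im (f y)) x 1.

Lemma cder_cst (c : CR) x : cder (fun=> c) x.
Proof. by split; exact: derivable_cst. Qed.

Lemma cd_cst (c : CR) : cd (fun=> c) = (fun=> 0).
Proof. by apply/funext => x; rewrite /cd !derive1_cst. Qed.

Lemma cReD (u v : CR) : complex.Re (u + v) = complex.Re u + complex.Re v.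
Proof. by case: u v => [a b] [c d]. Qed.
Lemma cImD (u v : CR) : complex.Im (u + v) = complex.Im u + complex.Im v.
Proof. by case: u v => [a b] [c d]. Qed.
Lemma cReM (u v : CR) : complex.Re (u * v)
  = complex.Re u * complex.Re v - complex.Im u * complex.Im v.
Proof. by case: u v => [a b] [c d]. Qed.
Lemma cImM (u v : CR) : complex.Im (u * v)
  = complex.Re u * complex.Im v + complex.Im u * complex.Re v.
Proof. by case: u v => [a b] [c d]. Qed.

Lemma cderD f g x : cder f x -> cder g x -> cder (fun y => f y + g y) x.
Proof.
move=> [f1 f2] [g1 g2]; split.
  under eq_fun do rewrite cReD; exact: (derivableD f1 g1).
under eq_fun do rewrite cImD; exact: (derivableD f2 g2).
Qed.

Lemma cderM f g x : cder f x -> cder g x -> cder (fun y => f y * g y) x.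
Proof.
move=> [f1 f2] [g1 g2]; split.
  under eq_fun do rewrite cReM.
  exact: (derivableB (derivableM f1 g1) (derivableM f2 g2)).
under eq_fun do rewrite cImM.
exact: (derivableD (derivableM f1 g2) (derivableM f2 g1)).
Qed.

Lemma cdD f g : (forall x, cder f x) -> (forall x, cder g x) ->
  cd (fun y => f y + g y) = (fun x => cd f x + cd g x).
Proof.
move=> Hf Hg; apply/funext => x; have [f1 f2] := Hf x; have [g1 g2] := Hg x.
rewrite /cd; under eq_fun do rewrite cReD; under [in X in Complex _ X]eq_fun do rewrite cImD.
by rewrite !derive1E (deriveD f1 g1) (deriveD f2 g2).
Qed.

Lemma cdM f g : (forall x, cder f x) -> (forall x, cder g x) ->
  cd (fun y => f y * g y) = (fun x => cd f x * g x + f x * cd g x).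
Proof.
move=> Hf Hg; apply/funext => x; have [f1 f2] := Hf x; have [g1 g2] := Hg x.
rewrite /cd; under eq_fun do rewrite cReM; under [in X in Complex _ X]eq_fun do rewrite cImM.
rewrite !derive1E (deriveB (derivableM f1 g1) (derivableM f2 g2)).
rewrite (deriveD (derivableM f1 g2) (derivableM f2 g1)).
rewrite (deriveM f1 g1) (deriveM f2 g2) (deriveM f1 g2) (deriveM f2 g1) /GRing.scale /=.
move: ('D_1 _ x) ('D_1 _ x) ('D_1 _ x) ('D_1 _ x) => a1 a2 b1 b2.
case: (f x) (g x) => [c1 c2] [d1 d2] /=.
by apply/eqP; rewrite eq_complex /=; apply/andP; split; apply/eqP; ring.
Qed.

(** Complex-valued functions with k+1 derivatives: an inductive form of the entrywise condition in [cloop], along which closure under products can be proved. *)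
Fixpoint csm (k : nat) (f : R -> CR) : Prop :=
  (forall x, cder f x) /\ if k is k'.+1 then csm k' (cd f) else True.

Lemma csm0 k f : csm k f -> forall x, cder f x.
Proof. by case: k => [|k] H; exact: H.1. Qed.

Lemma csmW k f : csm k.+1 f -> csm k f.
Proof.
elim: k f => [|k IH] f [f1 f2]; first exact: (conj f1 I).
exact: (conj f1 (IH _ f2)).
Qed.

Lemma csmD k f g : csm k f -> csm k g -> csm k (fun y => f y + g y).
Proof.
elim: k f g => [|k IH] f g [f1 f2] [g1 g2].
  exact: (conj (fun x => cderD (f1 x) (g1 x)) I).
apply: (conj (fun x => cderD (f1 x) (g1 x))).
rewrite (cdD f1 g1); exact: IH f2 g2.
Qed.

Lemma csmM k f g : csm k f -> csm k g -> csm k (fun y => f y * g y).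
Proof.
elim: k f g => [|k IH] f g sf sg.
  exact: (conj (fun x => cderM (sf.1 x) (sg.1 x)) I).
apply: (conj (fun x => cderM (sf.1 x) (sg.1 x))).
rewrite (cdM sf.1 sg.1); apply: csmD.
  exact: (IH _ _ sf.2 (csmW sg)).
exact: (IH _ _ (csmW sf) sg.2).
Qed.

Lemma csm_iter f : (forall k, csm k f) <-> (forall k x, cder (iter k (@cd R) f) x).
Proof.
split=> H k; last first.
  elim: k f H => [|k IH] f H; first exact: (conj (H 0%N) I).
  apply: (conj (H 0%N)); apply: IH => j x; rewrite -iterSr; exact: H.
elim: k f H => [|k IH] f H x; first exact: (csm0 (H 0%N)).
rewrite iterSr; apply: IH => j; exact: (H j.+1).2.
Qed.

Lemma cloopP (f : R -> CR) : cloop f <-> (forall x, f (x + 1) = f x) /\ (forall k, csm k f).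
Proof. by split=> -[H1 H2]; apply: (conj H1); apply/csm_iter. Qed.

Lemma cloop_cst (c : CR) : cloop (fun=> c).
Proof.
apply: (conj (fun=> erefl)) => k x.
suff [d ->] : exists d, iter k (@cd R) (fun=> c) = (fun=> d) by exact: cder_cst.
by elim: k => [|k [d IH]]; [exists c | exists 0; rewrite iterS IH cd_cst].
Qed.

Lemma cloopD (f g : R -> CR) : cloop f -> cloop g -> cloop (fun x => f x + g x).
Proof.
move=> /cloopP[f1 f2] /cloopP[g1 g2]; apply/cloopP; split => [x|k]; first by rewrite f1 g1.
exact: csmD.
Qed.

Lemma cloopM (f g : R -> CR) : cloop f -> cloop g -> cloop (fun x => f x * g x).
Proof.
move=> /cloopP[f1 f2] /cloopP[g1 g2]; apply/cloopP; split => [x|k]; first by rewrite f1 g1.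
exact: csmM.
Qed.

Lemma derive1_shift (V : normedModType R) (f : R -> V) (a x : R) :
  derive1 (fun y => f (y + a)) x = derive1 f (x + a).
Proof. by rewrite /derive1; under eq_fun do rewrite -addrA. Qed.

Lemma cloop_cd (f : R -> CR) : cloop f -> cloop (cd f).
Proof.
move=> [f1 f2]; split => [x|k x]; last (rewrite -iterSr; exact: f2).
rewrite /cd -(derive1_shift (fun y => complex.Re (f y))) -(derive1_shift (fun y => complex.Im (f y))).
have e : (fun y => f (y + 1)) = f by apply/funext => y; exact: f1.
by rewrite -[in RHS]e.
Qed.

Lemma cloop_conj (f : R -> CR) : cloop f -> cloop (fun x => (f x)^*%C).
Proof.
have ReJ (u : CR) : complex.Re u^*%C = complex.Re u by case: u.
have ImJ (u : CR) : complex.Im u^*%C = - complex.Im u by case: u.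
have dJ g x : cder g x -> cder (fun x => (g x)^*%C) x.
  move=> [g1 g2]; split; first (under eq_fun do rewrite ReJ; exact: g1).
  by under eq_fun do rewrite ImJ; exact: (derivableN g2).
have cJ g x : cder g x -> cd (fun x => (g x)^*%C) x = (cd g x)^*%C.
  move=> [g1 g2]; rewrite /cd; under eq_fun do rewrite ReJ.
  under [in X in Complex _ X]eq_fun do rewrite ImJ.
  by rewrite !derive1E (deriveN g2).
move=> [f1 f2]; split => [x|k x]; first by rewrite f1.
have -> : iter k (@cd R) (fun x => (f x)^*%C) = (fun x => (iter k (@cd R) f x)^*%C).
  elim: k => [//|k IH]; rewrite !iterS IH; apply/funext => y; apply: cJ; exact: f2.
apply: dJ; exact: f2.
Qed.

Definition cloop_pred : {pred R -> CR} := fun f => `[< cloop f >].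

(** Smooth loops packed as a commutative ring: all later identities between loops are
    equations in this ring. *)
Record sloop := SLoop { lval : R -> CR; lvalP : cloop_pred lval }.

HB.instance Definition _ := [isSub for lval].
HB.instance Definition _ := [Choice of sloop by <:].

Lemma cloop_subring : subring_closed cloop_pred.
Proof.
split => [|f g|f g].
- by apply/asboolP; exact: cloop_cst.
- move=> /asboolP Hf /asboolP Hg; apply/asboolP.
  have := cloopD Hf (cloopM (cloop_cst (-1)) Hg).
  by congr cloop; apply/funext => x; rewrite mulN1r.
- by move=> /asboolP Hf /asboolP Hg; apply/asboolP; exact: cloopM.
Qed.

HB.instance Definition _ := GRing.isSubringClosed.Build _ cloop_pred cloop_subring.
HB.instance Definition _ := [SubChoice_isSubComNzRing of sloop by <:].

End Loops.

(** * The ring of smooth loops *)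

Section Loops2.
Variable R : realType.
Local Notation CR := (CC R).
Local Notation S := (sloop R).

Lemma sloopP (f : S) : cloop (lval f).
Proof. exact/asboolP/(lvalP f). Qed.

Definition mkS (f : R -> CR) (Hf : cloop f) : S := @SLoop R f (asboolT Hf).

Lemma mkSE f (Hf : cloop f) : lval (mkS Hf) = f. Proof. by []. Qed.

Lemma sloop_eq (f g : S) : (forall x, lval f x = lval g x) -> f = g.
Proof. by move=> e; apply/val_inj/funext. Qed.

Lemma lvalD (f g : S) x : lval (f + g) x = lval f x + lval g x.
Proof. by []. Qed.
Lemma lvalM (f g : S) x : lval (f * g) x = lval f x * lval g x.
Proof. by []. Qed.
Lemma lvalN (f : S) x : lval (- f) x = - lval f x.
Proof. by []. Qed.
Lemma lval0 x : lval (0 : S) x = 0.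
Proof. by []. Qed.
Lemma lval1 x : lval (1 : S) x = 1.
Proof. by []. Qed.

Lemma lval_sum (I : Type) (r : seq I) (P : pred I) (F : I -> S) x :
  lval (\sum_(i <- r | P i) F i) x = \sum_(i <- r | P i) lval (F i) x.
Proof. exact: (big_morph (fun f : S => lval f x) (fun _ _ => erefl) erefl). Qed.

(** Constant loops. *)
Definition cS (c : CR) : S := mkS (cloop_cst c).

Lemma cS_is_zmod_morphism : zmod_morphism cS.
Proof. by move=> a b; apply: sloop_eq. Qed.
Lemma cS_is_monoid_morphism : monoid_morphism cS.
Proof. by split => [|a b]; apply: sloop_eq. Qed.
HB.instance Definition _ := GRing.isZmodMorphism.Build CR S cS cS_is_zmod_morphism.
HB.instance Definition _ := GRing.isMonoidMorphism.Build CR S cS cS_is_monoid_morphism.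

Lemma lval_cS c x : lval (cS c) x = c. Proof. by []. Qed.

Definition Dx (f : S) : S := mkS (cloop_cd (sloopP f)).

Lemma lval_Dx (f : S) : lval (Dx f) = cd (lval f). Proof. by []. Qed.

Lemma lval_iterD k (f : S) : lval (iter k Dx f) = iter k (@cd R) (lval f).
Proof. by elim: k => [//|k IH]; rewrite !iterS lval_Dx IH. Qed.

Lemma sloop_cder (f : S) x : cder (lval f) x.
Proof. exact: ((sloopP f).2 0%N x). Qed.

Lemma DcS c : Dx (cS c) = 0.
Proof. by apply: sloop_eq => x; rewrite lval_Dx cd_cst. Qed.
Lemma D_add (f g : S) : Dx (f + g) = Dx f + Dx g.
Proof.
by apply: sloop_eq => x; rewrite lval_Dx (cdD (sloop_cder f) (sloop_cder g)).
Qed.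
Lemma DM (f g : S) : Dx (f * g) = Dx f * g + f * Dx g.
Proof.
by apply: sloop_eq => x; rewrite lval_Dx (cdM (sloop_cder f) (sloop_cder g)).
Qed.
Lemma DcSM c (f : S) : Dx (cS c * f) = cS c * Dx f.
Proof. by rewrite DM DcS mul0r add0r. Qed.
Lemma DN (f : S) : Dx (- f) = - Dx f.
Proof. by rewrite -mulN1r -(rmorph1 cS) -rmorphN DcSM rmorphN rmorph1 mulN1r. Qed.
Lemma DB (f g : S) : Dx (f - g) = Dx f - Dx g.
Proof. by rewrite D_add DN. Qed.
Lemma Dx_is_zmod_morphism : zmod_morphism Dx.
Proof. exact: DB. Qed.
HB.instance Definition _ := GRing.isZmodMorphism.Build S S Dx Dx_is_zmod_morphism.

Definition oI (f : S) : CR := oint (lval f).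

Local Notation mu := (@lebesgue_measure R).

Lemma derivable_cont (f : R -> R) : (forall x, derivable f x 1) -> continuous f.
Proof. by move=> df x; apply/differentiable_continuous/derivable1_diffP. Qed.

Lemma derivable_int (f : R -> R) : (forall x, derivable f x 1) ->
  mu.-integrable `[0%R, 1%R] (EFin \o f).
Proof.
move=> df; apply: continuous_compact_integrable; first exact: segment_compact.
exact/continuous_subspaceT/(derivable_cont df).
Qed.

Lemma Re_int (f : S) : mu.-integrable `[0%R, 1%R] (EFin \o (fun x => complex.Re (lval f x))).
Proof. apply: derivable_int => x; exact: (sloop_cder f x).1. Qed.
Lemma Im_int (f : S) : mu.-integrable `[0%R, 1%R] (EFin \o (fun x => complex.Im (lval f x))).
Proof. apply: derivable_int => x; exact: (sloop_cder f x).2. Qed.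

Lemma oI_add (f g : S) : oI (f + g) = oI f + oI g.
Proof.
rewrite /oI /oint; under eq_Rintegral do rewrite lvalD cReD.
under [in X in Complex _ X]eq_Rintegral do rewrite lvalD cImD.
rewrite (RintegralD _ (Re_int f) (Re_int g)); last exact: measurable_itv.
by rewrite (RintegralD _ (Im_int f) (Im_int g)); last exact: measurable_itv.
Qed.

Lemma oI_cSM c (f : S) : oI (cS c * f) = c * oI f.
Proof.
have mI : measurable (`[0%R, 1%R] : set (measurableTypeR R)) by exact: measurable_itv.
rewrite /oI /oint; under eq_Rintegral do rewrite lvalM cReM.
under [in X in Complex _ X]eq_Rintegral do rewrite lvalM cImM.
have Rl (r : R) (h : R -> R) : mu.-integrable `[0%R, 1%R] (EFin \o h) ->
   mu.-integrable `[0%R, 1%R] (EFin \o (fun x => r * h x)).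
  by move=> ih; exact: (integrableZl mI r ih).
rewrite (RintegralB mI (Rl _ _ (Re_int f)) (Rl _ _ (Im_int f))).
rewrite (RintegralD mI (Rl _ _ (Im_int f)) (Rl _ _ (Re_int f))).
rewrite !(RintegralZl _ mI (Re_int f)) !(RintegralZl _ mI (Im_int f)).
by case: c.
Qed.

Lemma oI_is_zmod_morphism : zmod_morphism oI.
Proof.
move=> f g; rewrite oI_add -(mulN1r g) -(rmorph1 cS) -rmorphN oI_cSM mulN1r //.
Qed.
HB.instance Definition _ := GRing.isZmodMorphism.Build S CR oI oI_is_zmod_morphism.

(** A periodic primitive makes the integral of a derivative over a period vanish: the only
    analytic input of integration by parts. *)
Lemma FTC_periodic (F : R -> R) : (forall x, derivable F x 1) ->
  (forall x, derivable (derive1 F) x 1) -> F 1 = F 0 ->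
  \int[mu]_(x in `[0%R, 1%R]) derive1 F x = 0.
Proof.
move=> dF ddF F10.
have cF := derivable_cont dF.
have c' : {within `[0, 1], continuous (derive1 F)}.
  exact/continuous_subspaceT/(derivable_cont ddF).
have d01 : derivable_oo_LRcontinuous F 0 1.
  split=> [x _||]; first exact: dF.
    exact/cvg_at_right_filter/cF.
  exact/cvg_at_left_filter/cF.
rewrite /Rintegral (@continuous_FTC2 _ (derive1 F) F _ _ ltr01 c' d01 (fun _ _ => erefl)).
by rewrite F10 -EFinB subrr.
Qed.

Lemma oI_D (f : S) : oI (Dx f) = 0.
Proof.
have [p1 p2] := sloopP f.
rewrite /oI /oint lval_Dx /cd /=.
have e1 : lval f 1 = lval f 0 by rewrite -[in RHS](p1 0) add0r.
rewrite (@FTC_periodic (fun y => complex.Re (lval f y)) (fun x => (p2 0%N x).1)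
  (fun x => (p2 1%N x).1)); last by rewrite e1.
rewrite (@FTC_periodic (fun y => complex.Im (lval f y)) (fun x => (p2 0%N x).2)
  (fun x => (p2 1%N x).2)); last by rewrite e1.
by [].
Qed.

Lemma oI_parts (f g : S) : oI (Dx f * g) = - oI (f * Dx g).
Proof. by apply/eqP; rewrite -addr_eq0 -oI_add -DM oI_D. Qed.

Lemma periodicZ (f : R -> CR) : (forall x, f (x + 1) = f x) ->
  forall (m : int) x, f (x + m%:~R) = f x.
Proof.
move=> p; elim=> [|n IH|n IH] x; first by rewrite addr0.
  by rewrite -addn1 PoszD intrD addrA (p (x + n%:~R)) IH.
rewrite -(p (x + _)) -addrA -addn1 PoszD opprD intrD.
by rewrite (_ : (- 1%:Z)%:~R = -1 :> R) // subrK IH.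
Qed.

(** Where g is positive, continuity bounds it below on a short interval to the right, whose
    contribution makes the integral positive. *)
Lemma ge0_Rintegral_eq0 (g : R -> R) : continuous g -> (forall x, 0 <= g x) ->
  \int[mu]_(x in `[0%R, 1%R]) g x = 0 -> forall x, 0 <= x < 1 -> g x = 0.
Proof.
move=> cg g0 ig x /andP[x0 x1].
apply/eqP; rewrite eq_le g0 andbT leNgt; apply/negP => gx.
have [e e0 He] : exists2 e : R, 0 < e & forall y, `|x - y| < e -> g x / 2 < g y.
  have /(_ (ball (g x) (g x / 2))) := cg x.
  move=> /(_ (nbhsx_ballx _ _ _)) -/(_ (divr_gt0 gx (ltr0n _ 2))).
  move=> /nbhs_ballP[e e0 He]; exists e => // y xy.
  have := He y xy; rewrite /= /ball /= ltr_distlC => /andP[+ _].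
  by rewrite {1}(splitr (g x)) addrK.
pose d := Num.min (e / 2) ((1 - x) / 2).
have d0 : 0 < d by rewrite lt_min !divr_gt0 ?subr_gt0.
have de : d < e by rewrite gt_min ltr_pdivrMr // ltr_pMr // ltr1n.
have dx : x + d < 1.
  rewrite -ltrBrDl gt_min; apply/orP; right.
  by rewrite ltr_pdivrMr // ltr_pMr ?subr_gt0 // ltr1n.
have iT : mu.-integrable `[0%R, 1%R] (EFin \o g).
  apply: continuous_compact_integrable; first exact: segment_compact.
  exact: continuous_subspaceT.
have mg := measurable_int _ iT.
have mI (a b : R) : measurable (`[a, b] : set (measurableTypeR R)) by exact: measurable_itv.
have sub : `[x, (x + d)]%classic `<=` `[0%R, 1%R].
  apply: subset_itv; rewrite ?bnd_simp //; exact: ltW.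
suff : (0 < \int[mu]_(x in `[0%R, 1%R]) (g x)%:E)%E.
  have := EFin_normr_Rintegral (mI _ _) iT.
  rewrite ig normr0 => /esym/eqP; rewrite abse_eq0 => /eqP ->.
  by rewrite ltxx.
apply: (@lt_le_trans _ _ (\int[mu]_(y in `[x, (x + d)%R]) (g x / 2)%:E)%E); last first.
  apply: (@le_trans _ _ (\int[mu]_(y in `[x, (x + d)%R]) (g y)%:E)%E).
    apply: ge0_le_integral; [exact: mI|move=> y _|exact: measurable_cst
                            |exact: (measurable_funS (mI _ _) sub mg)|move=> y].
      by rewrite lee_fin divr_ge0 // ltW.
    rewrite /= in_itv /= => /andP[xy yd]; rewrite lee_fin ltW // He //.
    by rewrite distrC ger0_norm ?subr_ge0 // (le_lt_trans _ de) // lerBlDl.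
  by apply: ge0_subset_integral mg _ sub => // y _; rewrite lee_fin.
rewrite integral_cst /=; last exact: mI.
rewrite lebesgue_measure_itv /= lte_fin ltrDl d0 -EFinB -EFinM lte_fin.
by rewrite addrAC subrr add0r mulr_gt0 // divr_gt0.
Qed.

(** The fundamental lemma of the calculus of variations, with the test loop conjugate to d. *)
Lemma sum_normsq_eq0 n (d : 'I_n -> S) :
  oI (\sum_i d i * mkS (cloop_conj (sloopP (d i)))) = 0 -> forall i, d i = 0.
Proof.
move=> Id.
pose g x := \sum_i (complex.Re (lval (d i) x) ^+ 2 + complex.Im (lval (d i) x) ^+ 2).
have gE x : complex.Re (lval (\sum_i d i * mkS (cloop_conj (sloopP (d i)))) x) = g x.
  rewrite lval_sum (big_morph (@complex.Re R) (id1 := 0) (op1 := +%R) (@cReD R)) //.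
  apply: eq_bigr => i _; rewrite lvalM mkSE cReM; case: (lval _ _) => a b /=.
  by rewrite mulrN opprK !expr2.
have g0 x : 0 <= g x.
  by apply: sumr_ge0 => i _; rewrite addr_ge0 // sqr_ge0.
have cg : continuous g.
  apply: derivable_cont => x; rewrite -(funext gE); exact: (sloop_cder _ x).1.
have ig : \int[mu]_(x in `[0%R, 1%R]) g x = 0.
  by move: Id => /(congr1 (@complex.Re R)) /=; under eq_Rintegral do rewrite gE.
move=> i; apply: sloop_eq => x; rewrite lval0.
(* reduce to the interval [0, 1[ by periodicity *)
rewrite -(periodicZ (sloopP (d i)).1 (- Num.floor x) x).
set y := x + _.
have y01 : 0 <= y < 1.
  rewrite /y rmorphN /= subr_ge0 ltrBlDl; have := Num.Theory.real_floor_itv (num_real x).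
  by rewrite intrD1 addrC.
have := ge0_Rintegral_eq0 cg g0 ig y01.
rewrite /g => /eqP; rewrite psumr_eq0 => [/allP/(_ i)|j _]; last by rewrite addr_ge0 // sqr_ge0.
rewrite mem_index_enum => /(_ isT) /=; rewrite paddr_eq0 ?sqr_ge0 // !sqrf_eq0.
by case: (lval (d i) y) => a b /= /andP[/eqP -> /eqP ->].
Qed.

End Loops2.

(** * Differential polynomials and variational derivatives *)

Lemma is_derive_horner (K : numFieldType) (p : {poly K}) (x : K) :
  is_derive x 1 (horner p) (p^`()).[x].
Proof.
elim/poly_ind: p => [|p c IH].
  rewrite deriv0 horner0 (_ : horner 0 = fun=> 0); first exact: is_derive_cst.
  by apply/funext => y; rewrite horner0.
have -> : horner (p * 'X + c%:P) = (horner p * id) + (fun=> c).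
  by apply/funext => y; rewrite !hornerE.
apply: is_derive_eq.
rewrite derivMXaddC !hornerE.
by rewrite /GRing.scale /= mulr1 [x * _]mulrC.
Qed.

Section DiffPoly.
Variable R : realType.
Local Notation CR := (CC R).
Local Notation S := (sloop R).
Local Notation cS := (@cS R).
Local Notation Dx := (@Dx R).
Local Notation oI := (@oI R).

(** Curves in the ring of loops that depend polynomially on the parameter, with their 0th
    and 1st coefficients. Every variation met below is of this form, so its derivative under
    the integral sign is algebraic. *)
Definition pcurve (f : CR -> S) (f0 f1 : S) : Prop :=
  exists p : {poly S}, [/\ forall s, f s = p.[cS s], p`_0 = f0 & p`_1 = f1].

Lemma pcurve_affine (a b : S) : pcurve (fun s => a + cS s * b) a b.
Proof.
exists (a%:P + b%:P * 'X); split => [s||].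
- by rewrite hornerD hornerMX !hornerC mulrC.
- by rewrite coefD coefC coefMX addr0.
- by rewrite coefD coefC coefMX coefC add0r.
Qed.

Lemma pcurve_cst (a : S) : pcurve (fun=> a) a 0.
Proof. by exists a%:P; split => [s||]; rewrite ?hornerC ?coefC. Qed.

Lemma pcurveD f g f0 f1 g0 g1 : pcurve f f0 f1 -> pcurve g g0 g1 ->
  pcurve (fun s => f s + g s) (f0 + g0) (f1 + g1).
Proof.
move=> [p [p1 <- <-]] [r [r1 <- <-]]; exists (p + r).
by split => [s||]; rewrite ?hornerD ?coefD ?p1 ?r1.
Qed.

Lemma pcurveM f g f0 f1 g0 g1 : pcurve f f0 f1 -> pcurve g g0 g1 ->
  pcurve (fun s => f s * g s) (f0 * g0) (f1 * g0 + f0 * g1).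
Proof.
move=> [p [p1 <- <-]] [r [r1 <- <-]]; exists (p * r).
split => [s||]; first by rewrite hornerM p1 r1.
  by rewrite coefM big_ord1.
by rewrite coefM !big_ord_recl big_ord0 addr0 addrC.
Qed.

Lemma DxX (c : CR) k : Dx (cS c ^+ k) = 0.
Proof. by rewrite -rmorphXn DcS. Qed.

Lemma pcurveDx f f0 f1 : pcurve f f0 f1 -> pcurve (fun s => Dx (f s)) (Dx f0) (Dx f1).
Proof.
move=> [p [p1 <- <-]]; exists (map_poly Dx p).
split => [s||]; [|by rewrite coef_map_id0 ?raddf0..].
rewrite p1 horner_coef raddf_sum (@horner_coef_wide _ (size p)) ?size_poly //.
apply: eq_bigr => i _; rewrite [LHS]DM DxX mulr0 addr0 coef_map_id0 ?raddf0 //.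
Qed.

Lemma oI_pcurve f f0 f1 : pcurve f f0 f1 ->
  exists P : {poly CR}, [/\ forall s, oI (f s) = P.[s], P`_0 = oI f0 & P`_1 = oI f1].
Proof.
move=> [p [p1 <- <-]]; exists (map_poly oI p); split => [s||]; [|by rewrite coef_map_id0 ?raddf0..].
 rewrite p1 horner_coef raddf_sum (@horner_coef_wide _ (size p)) ?size_poly //.
apply: eq_bigr => i _.
by rewrite -rmorphXn mulrC [LHS]oI_cSM coef_map_id0 ?raddf0 // mulrC.
Qed.

(** The integral is linear over the constants, so it turns a polynomial in the parameter with
    loops as coefficients into a polynomial with complex coefficients. *)
Lemma pcurve_is_derive f f0 f1 : pcurve f f0 f1 ->
  is_derive (0 : CR) 1 (fun s => oI (f s)) (oI f1).
Proof.
move=> /oI_pcurve[P [P0 _ P1]]; rewrite (_ : (fun s => _) = horner P); last exact/funext.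
apply: is_derive_eq (is_derive_horner P 0) _.
by rewrite horner_coef0 coef_deriv P1.
Qed.

Variable n : nat.

(** Differential polynomials in n loops whose coefficients are loops; [DV k i] is the k-th
    derivative of the i-th loop. The syntax makes total derivative, linearisation and its transpose
    recursive functions. *)
Inductive dexp :=
  | DC (c : S) | DV (k : nat) (i : 'I_n) | DA (a b : dexp) | DP (a b : dexp).

Fixpoint ev (e : dexp) (q : 'I_n -> S) : S :=
  match e with
  | DC c => c
  | DV k i => iter k Dx (q i)
  | DA a b => ev a q + ev b q
  | DP a b => ev a q * ev b q
  end.

Fixpoint total_d (e : dexp) : dexp :=
  match e with
  | DC c => DC (Dx c)
  | DV k i => DV k.+1 i
  | DA a b => DA (total_d a) (total_d b)
  | DP a b => DA (DP (total_d a) b) (DP a (total_d b))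
  end.

Lemma ev_total_d e q : ev (total_d e) q = Dx (ev e q).
Proof. by elim: e => //= a -> b ->; rewrite ?D_add ?DM. Qed.

Lemma ev_iter_total_d k e q : ev (iter k total_d e) q = iter k Dx (ev e q).
Proof. by elim: k => //= k IH; rewrite ev_total_d IH. Qed.

(** Linearisation (Frechet derivative) in the direction w. *)
Fixpoint lin (e : dexp) (w : 'I_n -> S) : dexp :=
  match e with
  | DC c => DC 0
  | DV k i => DC (iter k Dx (w i))
  | DA a b => DA (lin a w) (lin b w)
  | DP a b => DA (DP (lin a w) b) (DP a (lin b w))
  end.

(** Symmetry of second derivatives. *)
Lemma lin_sym e v w q : ev (lin (lin e v) w) q = ev (lin (lin e w) v) q.
Proof. elim: e => //= a -> b -> //; ring. Qed.

Lemma lin_total_d e w q : ev (lin (total_d e) w) q = Dx (ev (lin e w) q).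
Proof.
elim: e => //= [c|a -> b ->|a IHa b IHb]; first by rewrite raddf0.
  by rewrite D_add.
by rewrite IHa IHb D_add !DM !ev_total_d; ring.
Qed.

Lemma lin_iter_total_d k e w q : ev (lin (iter k total_d e) w) q = iter k Dx (ev (lin e w) q).
Proof. by elim: k => //= k IH; rewrite lin_total_d IH. Qed.

Lemma iterDx_affine k (a b : S) s : iter k Dx (a + cS s * b) = iter k Dx a + cS s * iter k Dx b.
Proof. by elim: k => //= k ->; rewrite D_add DcSM. Qed.

Lemma pcurve_ev e q w :
  pcurve (fun s => ev e (fun i => q i + cS s * w i)) (ev e q) (ev (lin e w) q).
Proof.
elim: e => [c|k i|a IHa b IHb|a IHa b IHb] /=; first exact: pcurve_cst.
- under eq_fun do rewrite iterDx_affine; exact: pcurve_affine.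
- exact: pcurveD.
- exact: pcurveM.
Qed.

(** Transpose of the linearisation: f times [lin e w] and the sum of [adj e f i] times w_i
    differ by a total derivative. *)
Fixpoint adj (e f : dexp) (i : 'I_n) : dexp :=
  match e with
  | DC _ => DC 0
  | DV k j => if i == j then DP (DC ((-1) ^+ k)) (iter k total_d f) else DC 0
  | DA a b => DA (adj a f i) (adj b f i)
  | DP a b => DA (adj a (DP f b) i) (adj b (DP f a) i)
  end.

Lemma oI_parts_iter k (f g : S) : oI (f * iter k Dx g) = oI ((-1) ^+ k * iter k Dx f * g).
Proof.
elim: k f => [|k IH] f; first by rewrite expr0 mul1r.
have e := oI_parts f (iter k Dx g).
rewrite iterS -(opprK (oI (f * _))) -e IH -raddfN -iterSr exprS /=.
by congr oI; ring.
Qed.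

Lemma adjP e f q w :
  oI (ev f q * ev (lin e w) q) = oI (\sum_i ev (adj e f i) q * w i).
Proof.
elim: e f => [c|k j|a IHa b IHb|a IHa b IHb] f /=.
- by rewrite mulr0 big1 // => i _; rewrite mul0r.
- rewrite oI_parts_iter (bigD1 j) //= eqxx big1 ?addr0 => [|i /negPf ij] /=.
    by rewrite ev_iter_total_d.
  by rewrite ij /= mul0r.
- under eq_bigr do rewrite mulrDl.
  by rewrite mulrDr oI_add IHa IHb big_split oI_add.
- under eq_bigr do rewrite mulrDl.
  rewrite mulrDr oI_add big_split oI_add -IHa -IHb /=.
  by congr (oI _ + oI _); ring.
Qed.

(** Euler operator: the variational derivative of the functional with density e. *)
Definition eul (e : dexp) (i : 'I_n) : dexp := adj e (DC 1) i.

Lemma eulP e q w : oI (ev (lin e w) q) = oI (\sum_i ev (eul e i) q * w i).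
Proof. by rewrite -adjP mul1r. Qed.

Definition dsum (T : Type) (r : seq T) (F : T -> dexp) : dexp :=
  foldr (fun x e => DA (F x) e) (DC 0) r.

Lemma ev_dsum (T : Type) (r : seq T) F q : ev (dsum r F) q = \sum_(x <- r) ev (F x) q.
Proof. by elim: r => [|x r IH] /=; rewrite ?big_nil // big_cons IH. Qed.

Lemma lin_dsum (T : Type) (r : seq T) F w q :
  ev (lin (dsum r F) w) q = \sum_(x <- r) ev (lin (F x) w) q.
Proof. by elim: r => [|x r IH] /=; rewrite ?big_nil // big_cons IH. Qed.

(** The Hessian of a local functional is symmetric, because [lin_sym] holds for its density
    and [eulP] moves the derivatives from one direction to the other. *)
Lemma hess_sym e q v w :
  oI (\sum_i ev (lin (eul e i) w) q * v i) = oI (\sum_i ev (lin (eul e i) v) q * w i).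
Proof.
have H v' w' : oI (\sum_i ev (lin (eul e i) w') q * v' i) = oI (ev (lin (lin e v') w') q).
  have E1 := pcurve_is_derive (pcurve_ev (lin e v') q w').
  pose e2 := dsum (index_enum 'I_n) (fun i => DP (eul e i) (DC (v' i))).
  have E2 := pcurve_is_derive (pcurve_ev e2 q w').
  have ee : (fun s => oI (ev e2 (fun i => q i + cS s * w' i))) =
            (fun s => oI (ev (lin e v') (fun i => q i + cS s * w' i))).
    by apply/funext => s; rewrite eulP ev_dsum.
  move: E2; rewrite ee => E2.
  case: E2 => _; case: E1 => _ -> ->.
  rewrite lin_dsum; congr oI; apply: eq_bigr => i _ /=; rewrite mulr0 addr0 //.
by rewrite !H lin_sym.
Qed.

End DiffPoly.

(** * Local functionals and the Jacobi identity *)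

Section Functionals.
Variable R : realType.
Local Notation CR := (CC R).
Local Notation S := (sloop R).
Local Notation cS := (@cS R).
Local Notation Dx := (@Dx R).
Local Notation oI := (@oI R).

Lemma iterDx0 k : iter k Dx 0 = 0.
Proof. by elim: k => //= k ->; rewrite raddf0. Qed.

Lemma congr3_add (a b c a' b' c' : CR) :
  a = a' -> b = b' -> c = c' -> a + b + c = a' + b' + c'.
Proof. by move=> -> -> ->. Qed.

Section OneDim.
Variable n : nat.
Local Notation loopv := ('I_n -> S).

(** The two encodings of a vector-valued loop: a family of scalar loops, and a function
    with values in row vectors. *)
Definition rowl (v : loopv) : R -> 'rV[CR]_n := fun x => \row_i lval (v i) x.

Lemma mxloop_rowl v : mxloop (rowl v).
Proof.
move=> i j; rewrite (_ : (fun x => _) = lval (v j)); first exact: sloopP.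
by apply/funext => x; rewrite mxE.
Qed.

Lemma mxloopP q : mxloop q -> exists v, q = rowl v.
Proof.
move=> Hq; exists (fun i => mkS (Hq 0 i)); apply/funext => x; apply/rowP => i.
by rewrite mxE mkSE.
Qed.

Lemma rowl_inj v w : rowl v = rowl w -> v = w.
Proof.
move=> e; apply/funext => i; apply: sloop_eq => x.
by have := congr1 (fun f : R -> 'rV_n => f x 0 i) e; rewrite !mxE.
Qed.

Lemma mxd_rowl v k x i : mxd k (rowl v) x 0 i = lval (iter k Dx (v i)) x.
Proof.
rewrite mxE lval_iterD; congr (iter _ _ _ _); apply/funext => y; by rewrite mxE.
Qed.

Lemma jet_of_rowl v x k i : jet_of (rowl v) x k 0 i = lval (iter k Dx (v i)) x.
Proof. exact: mxd_rowl. Qed.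

Lemma rowl_affine q v (s : CR) :
  (fun x => rowl q x + s *: rowl v x) = rowl (fun i => q i + cS s * v i).
Proof. by apply/funext => x; apply/rowP => i; rewrite !mxE. Qed.

Lemma dpolyP (f : jet R n -> CR) : dpoly f ->
  exists e : dexp R n, forall v x, f (jet_of (rowl v) x) = lval (ev e v) x.
Proof.
elim=> {f} [c|k i|f g _ [a Ha] _ [b Hb]|f g _ [a Ha] _ [b Hb]].
- by exists (DC n (cS c)).
- by exists (DV R k i) => v x; rewrite jet_of_rowl.
- by exists (DA a b) => v x; rewrite Ha Hb.
- by exists (DP a b) => v x; rewrite Ha Hb.
Qed.

(** F is the functional with density e. *)
Definition lfunc (F : functional R n) (e : dexp R n) : Prop :=
  forall q, F (rowl q) = oI (ev e q).

Lemma lfuncP F : local_functional F -> exists e, lfunc F e.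
Proof.
move=> [m [c [g [Hc Hg HF]]]].
have /choice[e He] : forall i, exists e : dexp R n, forall v x,
    g i (jet_of (rowl v) x) = lval (ev e v) x := fun i => dpolyP (Hg i).
exists (dsum (index_enum 'I_m) (fun i => DP (DC n (mkS (Hc i))) (e i))) => q.
rewrite HF; last exact: mxloop_rowl.
congr oint; apply/funext => x; rewrite ev_dsum lval_sum; apply: eq_bigr => i _.
by rewrite He.
Qed.

(** Pairing of a covector with a tangent vector at a loop. *)
Definition pair (xi v : loopv) : CR := oI (\sum_i xi i * v i).

Lemma oint_pair xi v : oint (fun x => \sum_i rowl xi x 0 i * rowl v x 0 i) = pair xi v.
Proof.
congr oint; apply/funext => x; rewrite lval_sum.
by apply: eq_bigr => i _; rewrite !mxE.
Qed.

Lemma pairC xi v : pair xi v = pair v xi.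
Proof. by congr oI; apply: eq_bigr => i _; rewrite mulrC. Qed.

Lemma pairDr xi v w : pair xi (fun i => v i + w i) = pair xi v + pair xi w.
Proof. by rewrite -oI_add -big_split; congr oI; apply: eq_bigr => i _; rewrite mulrDr. Qed.

Lemma pairZr xi v c : pair xi (fun i => cS c * v i) = c * pair xi v.
Proof.
by rewrite -oI_cSM mulr_sumr; congr oI; apply: eq_bigr => i _; rewrite mulrCA.
Qed.

(** Test with the conjugate of the difference. *)
Lemma pair_nondeg xi xi' : (forall v, pair xi v = pair xi' v) -> xi = xi'.
Proof.
move=> H; pose d i := xi i - xi' i.
have d0 := @sum_normsq_eq0 R n d; apply/funext => i; apply/eqP.
rewrite -subr_eq0; apply/eqP; apply: d0.
under eq_bigr do rewrite mulrBl.
by rewrite sumrB raddfB /= -!/(pair _ _) H subrr.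
Qed.

Definition grad (e : dexp R n) (q : loopv) : loopv := fun i => ev (eul e i) q.

Lemma pair_grad e q w : pair (grad e q) w = oI (ev (lin e w) q).
Proof. by rewrite eulP. Qed.

Lemma has_vder_of F (q : loopv) (g : loopv) (dF : loopv -> CR) :
  (forall w, is_derive (0 : CR) 1 (fun s => F (rowl (fun i => q i + cS s * w i))) (dF w)) ->
  (forall w, dF w = pair g w) -> has_vder F (rowl q) (rowl g).
Proof.
move=> H1 H2; split=> [|v /mxloopP[w ->]]; first exact: mxloop_rowl.
rewrite oint_pair -H2; under eq_fun do rewrite rowl_affine; exact: H1.
Qed.

Lemma has_vder_uniq F q xi xi' :
  has_vder F (rowl q) xi -> has_vder F (rowl q) xi' -> xi = xi'.
Proof.
move=> [/mxloopP[g ->] H] [/mxloopP[g' ->] H']; congr rowl.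
apply: pair_nondeg => v; rewrite -!oint_pair.
by case: (H _ (mxloop_rowl v)) => _ <-; case: (H' _ (mxloop_rowl v)) => _ <-.
Qed.

Lemma vderE F q xi : has_vder F (rowl q) xi -> vder F (rowl q) = xi.
Proof.
move=> H; apply: (has_vder_uniq _ H); rewrite /vder.
exact: (@xgetPex _ (fun=> 0) [set xi | has_vder F (rowl q) xi] (ex_intro _ xi H)).
Qed.

(** The variational derivative is the Euler operator of any density: it has the defining
    property by [eulP] and is the only such covector by [pair_nondeg]. *)
Lemma vder_grad F e q : lfunc F e -> vder F (rowl q) = rowl (grad e q).
Proof.
move=> HF; apply: vderE; apply: has_vder_of => w; last by rewrite pair_grad.
under eq_fun do rewrite HF; exact: pcurve_is_derive (pcurve_ev _ _ _).
Qed.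

(** P acts on covectors as the operator Pop of loops. *)
Definition is_op (P : lbracket R n) (Pop : loopv -> loopv -> loopv) : Prop :=
  forall q eta, lop P (rowl q) (rowl eta) = rowl (Pop q eta).

(** The action of a local bracket on a covector, written as differential polynomials. *)
Definition exop (E : 'I_n -> 'I_n -> nat -> dexp R n) (m : nat) (eta : 'I_n -> dexp R n)
    (a : 'I_n) : dexp R n :=
  dsum (index_enum 'I_n) (fun b => dsum (index_iota 0 m.+1) (fun k =>
    DP (E a b k) (iter k (@total_d R n) (eta b)))).

Lemma lop_finite (P : lbracket R n) m q eta x a :
  (forall a b k, (m < k)%N -> P a b k = (fun=> 0)) ->
  lop P q eta x 0 a
  = \sum_b \sum_(0 <= k < m.+1) P a b k (jet_of q x) * mxd k eta x 0 b.
Proof.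
move=> Hm; rewrite mxE; apply: eq_bigr => b _.
rewrite (fsbigE (index_iota 0 m.+1)) ?iota_uniq //.
  by apply: eq_bigl => k; rewrite in_setT.
by move=> k _; rewrite mem_index_iota ltnS /= -ltnNge => km; rewrite Hm // mul0r.
Qed.

Lemma is_localP P : is_local P -> exists E m, forall q eta x a,
  lop P (rowl q) (rowl eta) x 0 a = lval (ev (exop E m (fun b => DC n (eta b)) a) q) x.
Proof.
move=> [dP [m Hm]].
have /choice[E HE] : forall i : 'I_n * 'I_n * nat, exists e : dexp R n, forall v x,
    P i.1.1 i.1.2 i.2 (jet_of (rowl v) x) = lval (ev e v) x.
  by move=> i; exact: dpolyP (dP _ _ _).
exists (fun a b k => E (a, b, k)), m => q eta x a.
rewrite (lop_finite _ _ _ _ Hm) /exop ev_dsum lval_sum; apply: eq_bigr => b _.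
rewrite ev_dsum lval_sum; apply: eq_bigr => k _.
by rewrite (HE (a, b, k)) mxd_rowl [ev (DP _ _) _]/= ev_iter_total_d.
Qed.

Lemma pbracketE P Pop F G eF eG q : is_op P Pop -> lfunc F eF -> lfunc G eG ->
  pbracket P F G (rowl q) = pair (grad eF q) (Pop q (grad eG q)).
Proof.
move=> HP HF HG; rewrite /pbracket (vder_grad _ HF) (vder_grad _ HG) -oint_pair.
by congr oint; apply/funext => x; rewrite HP.
Qed.

Lemma pbracketE' P Pop F G eF eG q : is_op P Pop -> lfunc F eF -> lfunc G eG ->
  pbracket P F G (rowl q) = oI (ev (lin eF (Pop q (grad eG q))) q).
Proof. by move=> HP HF HG; rewrite (pbracketE _ HP HF HG) pair_grad. Qed.

(** Skew-symmetry and the Jacobi identity for functionals given by densities. Composition with a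
    change of coordinates and brackets are then constructions on densities. *)
Definition poissonL (P : lbracket R n) : Prop :=
  (forall F G eF eG, lfunc F eF -> lfunc G eG ->
     forall q, pbracket P F G (rowl q) = - pbracket P G F (rowl q)) /\
  (forall F G H eF eG eH, lfunc F eF -> lfunc G eG -> lfunc H eH -> forall q,
     pbracket P (pbracket P F G) H (rowl q) + pbracket P (pbracket P G H) F (rowl q)
     + pbracket P (pbracket P H F) G (rowl q) = 0).

Lemma poisson_of_L P : is_local P -> poissonL P -> poisson P.
Proof.
move=> lP [sk ja]; split => // [F G|F G H].
  by move=> /lfuncP[e He] /lfuncP[e' He'] q /mxloopP[v ->]; exact: sk He He' v.
move=> /lfuncP[e He] /lfuncP[e' He'] /lfuncP[e'' He''] q /mxloopP[v ->].
exact: ja He He' He'' v.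
Qed.

(** Brackets of functionals with densities have densities, so that the iterated brackets in the
    Jacobi identity are computed by [vder_grad] again. *)
Lemma lfunc_pbracket P F G eF eG : is_local P -> lfunc F eF -> lfunc G eG ->
  exists eB, lfunc (pbracket P F G) eB.
Proof.
move=> /is_localP[E [m HP]] HF HG.
exists (dsum (index_enum 'I_n) (fun a => DP (eul eF a) (exop E m (eul eG) a))) => q.
have HP' : is_op P (fun q eta a => ev (exop E m (fun b => DC n (eta b)) a) q).
  by move=> q' eta; apply/funext => x; apply/rowP => a; rewrite HP mxE.
rewrite (pbracketE _ HP' HF HG) ev_dsum; congr oI; apply: eq_bigr => a _ /=.
congr (_ * _); rewrite /exop !ev_dsum; apply: eq_bigr => b _.
rewrite !ev_dsum; apply: eq_bigr => k _ /=; by rewrite !ev_iter_total_d.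
Qed.

(** With T the derivative of the bivector along the loop, the Jacobi identity is
    the vanishing of the Schouten square. In the iterated bracket the terms with second
    derivatives of the functionals cancel by [hess_pair] and skew-symmetry; what remains is the
    cyclic sum of T, evaluated on gradients. *)
Section Criterion.
Variables (P : lbracket R n) (Pop : loopv -> loopv -> loopv).
Hypotheses (lP : is_local P) (HP : is_op P Pop).
Hypothesis skew : forall q xi eta, pair xi (Pop q eta) = - pair eta (Pop q xi).
Variable T : loopv -> loopv -> loopv -> loopv -> CR.
Hypothesis dT : forall q xi eta w, is_derive (0 : CR) 1
  (fun s => pair xi (Pop (fun i => q i + cS s * w i) eta)) (T q xi eta w).
Hypothesis jac : forall q xi eta zeta,
  T q xi eta (Pop q zeta) + T q eta zeta (Pop q xi) + T q zeta xi (Pop q eta) = 0.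

Let lingrad e w q : loopv := fun i => ev (lin (eul e i) w) q.

Lemma hess_pair e q v w : pair v (lingrad e w q) = pair w (lingrad e v q).
Proof. by rewrite 2!(pairC _ (lingrad _ _ _)); exact: hess_sym. Qed.

Lemma grad_bracket F G eF eG : lfunc F eF -> lfunc G eG ->
  exists2 eB, lfunc (pbracket P F G) eB & forall q w,
    oI (ev (lin eB w) q) = pair (lingrad eF w q) (Pop q (grad eG q))
       + T q (grad eF q) (grad eG q) w
       - pair (lingrad eG w q) (Pop q (grad eF q)).
Proof.
move=> HF HG; have [E [m HE]] := is_localP lP.
have PopE q eta a : Pop q eta a = ev (exop E m (fun b => DC n (eta b)) a) q.
  by apply: sloop_eq => x; rewrite -HE HP mxE.
have exopE q e a : ev (exop E m e a) q = Pop q (fun b => ev (e b) q) a.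
  rewrite PopE !ev_dsum; apply: eq_bigr => b _; rewrite !ev_dsum.
  by apply: eq_bigr => k _ /=; rewrite !ev_iter_total_d.
pose eB := dsum (index_enum 'I_n) (fun a => DP (eul eF a) (exop E m (eul eG) a)).
exists eB => [q|q w].
  rewrite (pbracketE _ HP HF HG) ev_dsum; congr oI; apply: eq_bigr => a _ /=.
  by rewrite exopE.
have TE xi eta : T q xi eta w = pair xi (fun a => ev (lin (exop E m (fun b => DC n (eta b)) a) w) q).
  pose e := dsum (index_enum 'I_n) (fun a => DP (DC n (xi a)) (exop E m (fun b => DC n (eta b)) a)).
  have E1 := pcurve_is_derive (pcurve_ev e q w).
  have ee : (fun s => oI (ev e (fun i => q i + cS s * w i))) =
            (fun s => pair xi (Pop (fun i => q i + cS s * w i) eta)).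
    by apply/funext => s; rewrite ev_dsum; congr oI; apply: eq_bigr => a _; rewrite PopE.
  case: (dT q xi eta w) => _ <-; rewrite -ee; case: E1 => _ ->.
  by rewrite lin_dsum; congr oI; apply: eq_bigr => a _ /=; rewrite mul0r add0r.
rewrite TE lin_dsum -skew /pair -!oI_add -!big_split /=; congr oI.
apply: eq_bigr => a _ /=; rewrite exopE -addrA; congr (_ + _).
rewrite -mulrDr; congr (_ * _).
rewrite PopE !lin_dsum !ev_dsum -big_split; apply: eq_bigr => b _.
rewrite !lin_dsum !ev_dsum -big_split; apply: eq_bigr => k _ /=.
by rewrite lin_iter_total_d !ev_iter_total_d lin_iter_total_d /= iterDx0 mulr0 addr0.
Qed.

Theorem poissonL_crit : poissonL P.
Proof.
split=> [F G eF eG HF HG q|F G H eF eG eH HF HG HH q].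
  by rewrite (pbracketE _ HP HF HG) (pbracketE _ HP HG HF) skew.
have [eFG HFG FG] := grad_bracket HF HG.
have [eGH HGH GH] := grad_bracket HG HH.
have [eHF HHF HFe] := grad_bracket HH HF.
apply: etrans (congr3_add (pbracketE' q HP HFG HH) (pbracketE' q HP HGH HF)
  (pbracketE' q HP HHF HG)) _.
rewrite FG GH HFe.
have hs e v w : pair (lingrad e v q) w = pair (lingrad e w q) v.
  by rewrite pairC hess_pair pairC.
rewrite (hs eF _ (Pop q (grad eG q))) (hs eG _ (Pop q (grad eH q))) (hs eH _ (Pop q (grad eF q))).
have := jac q (grad eF q) (grad eG q) (grad eH q).
move: (T _ _ _ _) (T _ _ _ _) (T _ _ _ _) => t1 t2 t3 t0.
move: (pair _ _) (pair _ _) (pair _ _) => x1 x2 x3.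
rewrite -[RHS]t0; ring.
Qed.

End Criterion.
End OneDim.
End Functionals.

(** * Changes of coordinates and pencils *)

Section Transfer.
Variable R : realType.
Local Notation CR := (CC R).
Local Notation S := (sloop R).
Local Notation cS := (@cS R).
Local Notation Dx := (@Dx R).
Local Notation oI := (@oI R).
Variable n : nat.
Local Notation loopv := ('I_n -> S).

(** Polynomial change of coordinates. The gradients transform by the transpose
    Jt of the Jacobian, so a bracket is carried to another one as soon as the operators correspond
    under congruence by Jt. If the change of coordinates is onto on loops, the Poisson property is
    inherited. *)
Section Change.
Variables (phi : 'rV[CR]_n -> 'rV[CR]_n) (ph : 'I_n -> dexp R n).
Let phS (q : loopv) : loopv := fun i => ev (ph i) q.
Hypothesis phiE : forall q, (fun x => phi (rowl q x)) = rowl (phS q).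

Fixpoint dsubst (e : dexp R n) : dexp R n :=
  match e with
  | DC c => DC n c
  | DV k i => iter k (@total_d R n) (ph i)
  | DA a b => DA (dsubst a) (dsubst b)
  | DP a b => DP (dsubst a) (dsubst b)
  end.

Lemma ev_dsubst e q : ev (dsubst e) q = ev e (phS q).
Proof. by elim: e => //= [k i|a -> b ->|a -> b ->] //; rewrite ev_iter_total_d. Qed.

Lemma lin_dsubst e w q :
  ev (lin (dsubst e) w) q = ev (lin e (fun i => ev (lin (ph i) w) q)) (phS q).
Proof.
elim: e => //= [k i|a -> b ->|a IHa b IHb] //; first by rewrite lin_iter_total_d.
by rewrite IHa IHb !ev_dsubst.
Qed.

Lemma lfunc_comp F e : lfunc F e -> lfunc (fun u => F (fun x => phi (u x))) (dsubst e).
Proof. by move=> HF q; rewrite phiE HF ev_dsubst. Qed.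

Variable Jt : loopv -> loopv -> loopv.
Hypothesis JtP : forall q xi w, pair xi (fun i => ev (lin (ph i) w) q) = pair (Jt q xi) w.

Lemma grad_comp e q : grad (dsubst e) q = Jt q (grad e (phS q)).
Proof. by apply: pair_nondeg => w; rewrite pair_grad lin_dsubst -pair_grad JtP. Qed.

Variables (P P' : lbracket R n) (Pop Pop' : loopv -> loopv -> loopv).
Hypotheses (lP : is_local P) (lP' : is_local P').
Hypotheses (HP : is_op P Pop) (HP' : is_op P' Pop').
Hypothesis PP' : forall q xi eta,
  pair (Jt q xi) (Pop q (Jt q eta)) = pair xi (Pop' (phS q) eta).

Lemma pbracket_comp F G e e' q : lfunc F e -> lfunc G e' ->
  pbracket P (fun u => F (fun x => phi (u x))) (fun u => G (fun x => phi (u x))) (rowl q)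
  = pbracket P' F G (rowl (phS q)).
Proof.
move=> HF HG; rewrite (pbracketE q HP (lfunc_comp HF) (lfunc_comp HG)).
by rewrite (pbracketE (phS q) HP' HF HG) !grad_comp PP'.
Qed.

Lemma lb_in_coordinates_op : lb_in_coordinates phi P P'.
Proof.
move=> F G /lfuncP[e He] /lfuncP[e' He'] q /mxloopP[v ->].
by rewrite phiE; exact: pbracket_comp He He'.
Qed.

Hypothesis surj : forall t, exists q, t = phS q.

Lemma poissonL_transfer : poissonL P -> poissonL P'.
Proof.
move=> [sk ja]; split=> [F G eF eG HF HG t|F G H eF eG eH HF HG HH t].
  have [q ->] := surj t; rewrite -!(pbracket_comp q HF HG) -!(pbracket_comp q HG HF).
  exact: sk (lfunc_comp HF) (lfunc_comp HG) q.
have [q ->] := surj t.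
have key A B C eA eB eC : lfunc A eA -> lfunc B eB -> lfunc C eC ->
    pbracket P' (pbracket P' A B) C (rowl (phS q)) =
    pbracket P (pbracket P (fun u => A (fun x => phi (u x))) (fun u => B (fun x => phi (u x))))
      (fun u => C (fun x => phi (u x))) (rowl q).
  move=> HA HB HC; have [eAB HAB] := lfunc_pbracket lP' HA HB.
  have HAB' : lfunc (pbracket P (fun u => A (fun x => phi (u x)))
      (fun u => B (fun x => phi (u x)))) (dsubst eAB).
    by move=> v; rewrite (pbracket_comp v HA HB) HAB ev_dsubst.
  apply: etrans (esym (pbracket_comp q HAB HC)) _.
  apply: etrans (pbracketE' q HP (lfunc_comp HAB) (lfunc_comp HC)) _.
  exact: esym (pbracketE' q HP HAB' (lfunc_comp HC)).
apply: etrans (congr3_add (key _ _ _ _ _ _ HF HG HH) (key _ _ _ _ _ _ HG HH HF)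
  (key _ _ _ _ _ _ HH HF HG)) _.
exact: ja (lfunc_comp HF) (lfunc_comp HG) (lfunc_comp HH) q.
Qed.

End Change.

Section Pencil.
Variables (P2 P1 : lbracket R n) (Op2 Op1 : loopv -> loopv -> loopv).
Hypotheses (lP2 : is_local P2) (lP1 : is_local P1).
Hypotheses (HP2 : is_op P2 Op2) (HP1 : is_op P1 Op1).

Lemma is_local_comb c1 c2 : is_local (lb_comb c1 c2 P2 P1).
Proof.
move: lP2 lP1 => [d2 [m2 H2]] [d1 [m1 H1]]; split.
  move=> a b k; apply: dpoly_add; apply: dpoly_mul => //; exact: dpoly_const.
exists (maxn m2 m1) => a b k; rewrite gtn_max => /andP[k2 k1].
by apply/funext => J; rewrite /lb_comb H2 // H1 // !mulr0 addr0.
Qed.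

Lemma is_op_comb c1 c2 : is_op (lb_comb c1 c2 P2 P1)
  (fun q eta i => cS c1 * Op2 q eta i + cS c2 * Op1 q eta i).
Proof.
move=> q eta; apply/funext => x; apply/rowP => a.
have e2 : lop P2 (rowl q) (rowl eta) x 0 a = lval (Op2 q eta a) x by rewrite HP2 mxE.
have e1 : lop P1 (rowl q) (rowl eta) x 0 a = lval (Op1 q eta a) x by rewrite HP1 mxE.
move: (is_local_comb c1 c2) lP2 lP1 => [_ [m0 H0]] [_ [m2 H2]] [_ [m1 H1]].
pose m := maxn m0 (maxn m2 m1).
have W (P : lbracket R n) m' : (m' <= m)%N -> (forall a b k, (m' < k)%N -> P a b k = (fun=> 0)) ->
    (forall a b k, (m < k)%N -> P a b k = (fun=> 0)).
  by move=> mm HH a' b k mk; apply: HH; exact: leq_ltn_trans mk.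
have {}H0 := W _ _ (leq_maxl _ _) H0.
have {}H2 := W _ _ (leq_trans (leq_maxl _ _) (leq_maxr _ _)) H2.
have {}H1 := W _ _ (leq_trans (leq_maxr _ _) (leq_maxr _ _)) H1.
rewrite (lop_finite _ _ _ _ H0) [RHS]mxE lvalD !lvalM !lval_cS -e1 -e2.
rewrite (lop_finite _ _ _ _ H2) (lop_finite _ _ _ _ H1).
rewrite !mulr_sumr -big_split; apply: eq_bigr => b _ /=.
rewrite !mulr_sumr -big_split; apply: eq_bigr => k _ /=.
by rewrite /lb_comb mulrDl !mulrA.
Qed.

(** The skew-symmetry and Jacobi expressions of P_2 + l P_1 are polynomials in l that vanish
    for every l, so their coefficients vanish; an arbitrary combination only involves the same
    coefficients. *)
Lemma poissonL_comb :
  (forall l, poissonL (lb_comb 1 l P2 P1)) -> forall c1 c2, poissonL (lb_comb c1 c2 P2 P1).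
Proof.
move=> Hl.
have bE F G eF eG c1 c2 q : lfunc F eF -> lfunc G eG ->
    pbracket (lb_comb c1 c2 P2 P1) F G (rowl q) =
    c1 * pbracket P2 F G (rowl q) + c2 * pbracket P1 F G (rowl q).
  move=> HF HG; rewrite (pbracketE q (is_op_comb c1 c2) HF HG).
  by rewrite (pbracketE q HP2 HF HG) (pbracketE q HP1 HF HG) pairDr !pairZr.
have eq3 (a b c : CR) : (forall l, a + l * b + l ^+ 2 * c = 0) -> [/\ a = 0, b = 0 & c = 0].
  move=> H; have a0 : a = 0 by have := H 0; rewrite mul0r expr0n /= mul0r !addr0.
  have h1 := H 1; have hN := H (-1); move: h1 hN.
  rewrite a0 !add0r !mul1r expr1n mul1r mulN1r sqrrN expr1n mul1r => h1 hN.
  have c0 : c = 0.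
    have : c * 2 = 0 by rewrite -[RHS](addr0 0) -{1}h1 -hN; ring.
    by move/eqP; rewrite mulf_eq0 pnatr_eq0 orbF => /eqP.
  by split => //; rewrite c0 addr0 in h1.
move=> c1 c2; split=> [F G eF eG HF HG q|F G H eF eG eH HF HG HH q].
  have E l : pbracket P2 F G (rowl q) + pbracket P2 G F (rowl q)
     + l * (pbracket P1 F G (rowl q) + pbracket P1 G F (rowl q)) + l ^+ 2 * 0 = 0.
    have := etrans (etrans (esym (bE _ _ _ _ 1 l q HF HG)) ((Hl l).1 _ _ _ _ HF HG q))
      (congr1 -%R (bE _ _ _ _ 1 l q HG HF)).
    move: (pbracket P2 F G _) (pbracket P1 F G _) (pbracket P2 G F _) (pbracket P1 G F _).
    move=> a b c d h; transitivity ((1 * a + l * b) + (1 * c + l * d)); first by ring.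
    by rewrite h addNr.
  have [e1 e2 _] := eq3 _ _ _ E.
  apply: etrans (bE _ _ _ _ _ _ q HF HG) _.
  apply: etrans _ (congr1 -%R (esym (bE _ _ _ _ _ _ q HG HF))).
  move: e1 e2.
  move: (pbracket P2 F G _) (pbracket P1 F G _) (pbracket P2 G F _) (pbracket P1 G F _).
  move=> a b c d /eqP; rewrite addr_eq0 => /eqP -> /eqP; rewrite addr_eq0 => /eqP ->.
  by rewrite !mulrN opprD.
have key A B C eA eB eC : lfunc A eA -> lfunc B eB -> lfunc C eC ->
    exists x : CR * CR * CR, forall c1 c2,
    pbracket (lb_comb c1 c2 P2 P1) (pbracket (lb_comb c1 c2 P2 P1) A B) C (rowl q) =
    c1 ^+ 2 * x.1.1 + c1 * c2 * x.1.2 + c2 ^+ 2 * x.2.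
  move=> HA HB HC; have [e2 H2] := lfunc_pbracket lP2 HA HB.
  have [e1 H1] := lfunc_pbracket lP1 HA HB.
  set w2 := Op2 q (grad eC q); set w1 := Op1 q (grad eC q).
  exists (pair (grad e2 q) w2, pair (grad e2 q) w1 + pair (grad e1 q) w2, pair (grad e1 q) w1).
  move=> a b; have HAB : lfunc (pbracket (lb_comb a b P2 P1) A B)
      (DA (DP (DC n (cS a)) e2) (DP (DC n (cS b)) e1)).
    by move=> v; rewrite (bE _ _ _ _ _ _ _ HA HB) H2 H1 oI_add !oI_cSM.
  rewrite (pbracketE' q (is_op_comb a b) HAB HC) /= !mul0r !add0r oI_add !oI_cSM.
  by rewrite -!pair_grad !pairDr !pairZr /=; ring.
have [[[x0 x1] x2] kx] := key _ _ _ _ _ _ HF HG HH.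
have [[[y0 y1] y2] ky] := key _ _ _ _ _ _ HG HH HF.
have [[[z0 z1] z2] kz] := key _ _ _ _ _ _ HH HF HG.
have E l : (x0 + y0 + z0) + l * (x1 + y1 + z1) + l ^+ 2 * (x2 + y2 + z2) = 0.
  rewrite -[RHS]((Hl l).2 _ _ _ _ _ _ HF HG HH q).
  by apply: etrans (esym (congr3_add (kx _ _) (ky _ _) (kz _ _))) => /=; ring.
have [e0 e1 e2] := eq3 _ _ _ E.
apply: etrans (congr3_add (kx _ _) (ky _ _) (kz _ _)) _ => /=.
transitivity (c1 ^+ 2 * (x0 + y0 + z0) + c1 * c2 * (x1 + y1 + z1) + c2 ^+ 2 * (x2 + y2 + z2)).
  ring.
by rewrite e0 e1 e2 !mulr0 !addr0.
Qed.

End Pencil.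
End Transfer.

(** * The Slodowy slice *)

(** Matrix from a table, with an explicit default: unlike [mx_of], over any ring. *)
Definition mxq (T : Type) m n (x0 : T) (s : seq (seq T)) : 'M[T]_(m, n) :=
  \matrix_(i < m, j < n) nth x0 (nth [::] s i) j.

Section M4.
Variable K : comNzRingType.

(** Matrices by their 16 entries, with multiplication and addition as rewriting rules: products
    are expanded once and for all, and entrywise identities become goals for [ring]. *)
Definition m4 (a00 a01 a02 a03 a10 a11 a12 a13 a20 a21 a22 a23 a30 a31 a32 a33 : K) : 'M[K]_4 :=
  mxq 4 4 0 [:: [:: a00; a01; a02; a03];
    [:: a10; a11; a12; a13];
    [:: a20; a21; a22; a23];
    [:: a30; a31; a32; a33]].

Lemma m4E (A : 'M[K]_4) : A = m4 (A 0 0) (A 0 1) (A 0 2) (A 0 3) (A 1 0) (A 1 1) (A 1 2) (A 1 3) (A 2 0) (A 2 1) (A 2 2) (A 2 3) (A 3 0) (A 3 1) (A 3 2) (A 3 3).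
Proof.
apply/matrixP => i j; rewrite mxE.
by move: i j => [[|[|[|[|//]]]] ?] [[|[|[|[|//]]]] ?] /=; congr (A _ _); apply: val_inj.
Qed.

Lemma m4M a00 a01 a02 a03 a10 a11 a12 a13 a20 a21 a22 a23 a30 a31 a32 a33 b00 b01 b02 b03 b10 b11 b12 b13 b20 b21 b22 b23 b30 b31 b32 b33 :
  m4 a00 a01 a02 a03 a10 a11 a12 a13 a20 a21 a22 a23 a30 a31 a32 a33 *m m4 b00 b01 b02 b03 b10 b11 b12 b13 b20 b21 b22 b23 b30 b31 b32 b33 = m4
    (a00 * b00 + a01 * b10 + a02 * b20 + a03 * b30)
    (a00 * b01 + a01 * b11 + a02 * b21 + a03 * b31)
    (a00 * b02 + a01 * b12 + a02 * b22 + a03 * b32)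
    (a00 * b03 + a01 * b13 + a02 * b23 + a03 * b33)
    (a10 * b00 + a11 * b10 + a12 * b20 + a13 * b30)
    (a10 * b01 + a11 * b11 + a12 * b21 + a13 * b31)
    (a10 * b02 + a11 * b12 + a12 * b22 + a13 * b32)
    (a10 * b03 + a11 * b13 + a12 * b23 + a13 * b33)
    (a20 * b00 + a21 * b10 + a22 * b20 + a23 * b30)
    (a20 * b01 + a21 * b11 + a22 * b21 + a23 * b31)
    (a20 * b02 + a21 * b12 + a22 * b22 + a23 * b32)
    (a20 * b03 + a21 * b13 + a22 * b23 + a23 * b33)
    (a30 * b00 + a31 * b10 + a32 * b20 + a33 * b30)
    (a30 * b01 + a31 * b11 + a32 * b21 + a33 * b31)
    (a30 * b02 + a31 * b12 + a32 * b22 + a33 * b32)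
    (a30 * b03 + a31 * b13 + a32 * b23 + a33 * b33).
Proof.
apply/matrixP => i j; rewrite mxE !big_ord_recl big_ord0 addr0 !addrA !mxE.
by move: i j => [[|[|[|[|//]]]] ?] [[|[|[|[|//]]]] ?].
Qed.

Lemma m4D a00 a01 a02 a03 a10 a11 a12 a13 a20 a21 a22 a23 a30 a31 a32 a33 b00 b01 b02 b03 b10 b11 b12 b13 b20 b21 b22 b23 b30 b31 b32 b33 :
  m4 a00 a01 a02 a03 a10 a11 a12 a13 a20 a21 a22 a23 a30 a31 a32 a33 + m4 b00 b01 b02 b03 b10 b11 b12 b13 b20 b21 b22 b23 b30 b31 b32 b33 = m4
    (a00 + b00) (a01 + b01) (a02 + b02) (a03 + b03) (a10 + b10) (a11 + b11) (a12 + b12) (a13 + b13) (a20 + b20) (a21 + b21) (a22 + b22) (a23 + b23) (a30 + b30) (a31 + b31) (a32 + b32) (a33 + b33).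
Proof.
apply/matrixP => i j; rewrite !mxE.
by move: i j => [[|[|[|[|//]]]] ?] [[|[|[|[|//]]]] ?].
Qed.

Lemma m4B a00 a01 a02 a03 a10 a11 a12 a13 a20 a21 a22 a23 a30 a31 a32 a33 b00 b01 b02 b03 b10 b11 b12 b13 b20 b21 b22 b23 b30 b31 b32 b33 :
  m4 a00 a01 a02 a03 a10 a11 a12 a13 a20 a21 a22 a23 a30 a31 a32 a33 - m4 b00 b01 b02 b03 b10 b11 b12 b13 b20 b21 b22 b23 b30 b31 b32 b33 = m4
    (a00 - b00) (a01 - b01) (a02 - b02) (a03 - b03) (a10 - b10) (a11 - b11) (a12 - b12) (a13 - b13) (a20 - b20) (a21 - b21) (a22 - b22) (a23 - b23) (a30 - b30) (a31 - b31) (a32 - b32) (a33 - b33).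
Proof.
apply/matrixP => i j; rewrite !mxE.
by move: i j => [[|[|[|[|//]]]] ?] [[|[|[|[|//]]]] ?].
Qed.

Lemma m4Z c a00 a01 a02 a03 a10 a11 a12 a13 a20 a21 a22 a23 a30 a31 a32 a33 :
  c *: m4 a00 a01 a02 a03 a10 a11 a12 a13 a20 a21 a22 a23 a30 a31 a32 a33 = m4
    (c * a00) (c * a01) (c * a02) (c * a03) (c * a10) (c * a11) (c * a12) (c * a13) (c * a20) (c * a21) (c * a22) (c * a23) (c * a30) (c * a31) (c * a32) (c * a33).
Proof.
apply/matrixP => i j; rewrite !mxE.
by move: i j => [[|[|[|[|//]]]] ?] [[|[|[|[|//]]]] ?].
Qed.

Lemma m4_tr a00 a01 a02 a03 a10 a11 a12 a13 a20 a21 a22 a23 a30 a31 a32 a33 : \tr (m4 a00 a01 a02 a03 a10 a11 a12 a13 a20 a21 a22 a23 a30 a31 a32 a33) = a00 + a11 + a22 + a33.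
Proof. by rewrite /mxtrace !big_ord_recl big_ord0 addr0 !addrA !mxE. Qed.

Lemma m4_eq0P a00 a01 a02 a03 a10 a11 a12 a13 a20 a21 a22 a23 a30 a31 a32 a33 : m4 a00 a01 a02 a03 a10 a11 a12 a13 a20 a21 a22 a23 a30 a31 a32 a33 = 0 <->
  [/\ [/\ a00 = 0, a01 = 0, a02 = 0 & a03 = 0], [/\ a10 = 0, a11 = 0, a12 = 0 & a13 = 0],
      [/\ a20 = 0, a21 = 0, a22 = 0 & a23 = 0] & [/\ a30 = 0, a31 = 0, a32 = 0 & a33 = 0]].
Proof.
split=> [e|[[-> -> -> ->] [-> -> -> ->] [-> -> -> ->] [-> -> -> ->]]].
  have E (i j : 'I_4) := congr1 (fun A : 'M[K]_4 => A i j) e.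
  split; split.
  by have := E 0 0; rewrite !mxE.
  by have := E 0 1; rewrite !mxE.
  by have := E 0 2; rewrite !mxE.
  by have := E 0 3; rewrite !mxE.
  by have := E 1 0; rewrite !mxE.
  by have := E 1 1; rewrite !mxE.
  by have := E 1 2; rewrite !mxE.
  by have := E 1 3; rewrite !mxE.
  by have := E 2 0; rewrite !mxE.
  by have := E 2 1; rewrite !mxE.
  by have := E 2 2; rewrite !mxE.
  by have := E 2 3; rewrite !mxE.
  by have := E 3 0; rewrite !mxE.
  by have := E 3 1; rewrite !mxE.
  by have := E 3 2; rewrite !mxE.
  by have := E 3 3; rewrite !mxE.
apply/matrixP => i j; rewrite !mxE.
by move: i j => [[|[|[|[|//]]]] ?] [[|[|[|[|//]]]] ?].
Qed.

End M4.

Section WAlgebra.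
Variable R : realType.
Local Notation CR := (CC R).
Local Notation S := (sloop R).
Local Notation cS := (@cS R).
Local Notation Dx := (@Dx R).
Local Notation oI := (@oI R).
Local Notation s3 := (sqrtC (3 : CR)).

Definition mloop (M : 'M[S]_4) : R -> 'M[CR]_4 := fun x => map_mx (fun f => lval f x) M.

Lemma mxloop_mloop M : mxloop (mloop M).
Proof.
move=> i j; rewrite (_ : (fun x => _) = lval (M i j)); first exact: sloopP.
by apply/funext => x; rewrite mxE.
Qed.

Lemma mxloop4P A : mxloop A -> exists M, A = mloop M.
Proof.
move=> HA; exists (\matrix_(i, j) mkS (HA i j)); apply/funext => x; apply/matrixP => i j.
by rewrite !mxE mkSE.
Qed.

Lemma mxd_mloop M : mxd 1 (mloop M) = mloop (map_mx Dx M).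
Proof.
apply/funext => x; apply/matrixP => i j.
have e : (fun y => mloop M y i j) = lval (M i j) by apply/funext => y; rewrite mxE.
by rewrite /mxd /mloop 3!mxE lval_Dx [iter 1 _ _]/= e.
Qed.

Lemma mloopM A B x : mloop (A *m B) x = mloop A x *m mloop B x.
Proof. by apply/matrixP => i j; rewrite !mxE lval_sum; apply: eq_bigr => k _; rewrite !mxE. Qed.
Lemma mloopD A B x : mloop (A + B) x = mloop A x + mloop B x.
Proof. by apply/matrixP => i j; rewrite !mxE. Qed.
Lemma mloopB A B x : mloop (A - B) x = mloop A x - mloop B x.
Proof. by apply/matrixP => i j; rewrite !mxE. Qed.
Lemma mloop_tr A x : \tr (mloop A x) = lval (\tr A) x.
Proof. by rewrite /mxtrace lval_sum; apply: eq_bigr => k _; rewrite !mxE. Qed.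
Lemma mloop_eq A B : (forall x, mloop A x = mloop B x) -> A = B.
Proof.
move=> H; apply/matrixP => i j; apply: sloop_eq => x.
by have := H x; move/matrixP/(_ i j); rewrite !mxE.
Qed.

(** The slice with its constant part o (1 for L1 + g^f, 0 for g^f), over any ring: it serves
    for loops and for points. The parameter r stands for 1/sqrt 3. *)
Definition qgen (K : comNzRingType) (r : K) (o : K) (z : 'I_5 -> K) : 'M[K]_4 :=
  m4 (r * z 1) o 0 0
     (2 * z 0) (r * z 1) o 0
     (4 * z 2) (2 * z 0) (r * z 1) (2 * z 3 - 2 * z 4)
     (2 * z 3 + 2 * z 4) 0 0 (- (3 * (r * z 1))).

Definition r3 : CR := s3^-1.

Lemma s3_neq0 : s3 != 0.
Proof. by rewrite sqrtC_eq0 pnatr_eq0. Qed.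

Lemma s3E : s3 = 3 * r3.
Proof. by rewrite /r3 -[X in X * _](sqrtCK 3) expr2 mulfK // s3_neq0. Qed.

Lemma r3sq : r3 ^+ 2 = 1 / 3.
Proof. by rewrite /r3 exprVn sqrtCK div1r. Qed.

Lemma r3_neq0 : r3 != 0.
Proof. by rewrite invr_eq0 s3_neq0. Qed.

Definition qS (z : 'I_5 -> S) : 'M[S]_4 := qgen (cS r3) 1 z.
Definition xS (z : 'I_5 -> S) : 'M[S]_4 := qgen (cS r3) 0 z.
Definition xmx (z : 'I_5 -> CR) : 'M[CR]_4 := qgen r3 0 z.

Lemma qmxE (z : 'rV[CR]_5) : qmx z = qgen r3 1 (fun i => z 0 i).
Proof.
apply/matrixP => i j; rewrite !mxE.
move: i j => [[|[|[|[|//]]]] ?] [[|[|[|[|//]]]] ?] /=;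
  first [by [] | by rewrite /r3 mulrC | by rewrite s3E; ring].
Qed.

Lemma qmxL1 (z : 'rV[CR]_5) : qmx z - L1 R = xmx (fun i => z 0 i).
Proof.
rewrite qmxE; apply/matrixP => i j; rewrite !mxE.
by move: i j => [[|[|[|[|//]]]] ?] [[|[|[|[|//]]]] ?] /=; ring.
Qed.

Lemma mloop_qS z x : mloop (qS z) x = qmx (rowl z x).
Proof.
rewrite qmxE; apply/matrixP => i j; rewrite !mxE.
by move: i j => [[|[|[|[|//]]]] ?] [[|[|[|[|//]]]] ?] /=; rewrite ?mxE.
Qed.

Lemma mloop_xS z x : mloop (xS z) x = xmx (fun i => rowl z x 0 i).
Proof.
apply/matrixP => i j; rewrite !mxE.
by move: i j => [[|[|[|[|//]]]] ?] [[|[|[|[|//]]]] ?] /=; rewrite ?mxE.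
Qed.

End WAlgebra.

(** * The bracket of the W-algebra and the lift of a covector *)

Section WTable.
Variables (R : realType) (J : jet R 5).
Local Notation CR := (CC R).
Local Notation r := (r3 R).
Local Notation Z k i := (J k%N 0 i).

(** Table of {z_a, z_b}: the k-th entry is the coefficient of the k-th derivative of delta. The
    entries are the coefficients of the operator [bS]. *)
Definition Wtab (a b : nat) : seq CR :=
  match a, b with
  | 0%N, 0%N => [:: Z 1 0;
        2 * Z 0 0;
        0;
        - (1 / 2)]
  | 0%N, 2%N => [:: 2 * Z 1 2;
        3 * Z 0 2]
  | 0%N, 3%N => [:: 4 * (r * Z 0 1) * Z 0 4 + Z 1 3;
        2 * Z 0 3]
  | 0%N, 4%N => [:: 4 * (r * Z 0 1) * Z 0 3 + Z 1 4;
        2 * Z 0 4]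
  | 1%N, 1%N => [:: 0;
        1]
  | 1%N, 3%N => [:: r * (- (4 * Z 0 4))]
  | 1%N, 4%N => [:: r * (- (4 * Z 0 3))]
  | 2%N, 0%N => [:: Z 1 2;
        3 * Z 0 2]
  | 2%N, 2%N => [:: 8 / 3 * Z 0 0 * Z 1 0 - 1 / 6 * Z 3 0 + 4 * Z 0 3 * Z 1 3 - 4 * Z 0 4 * Z 1 4;
        8 / 3 * Z 0 0 ^+ 2 - 3 / 4 * Z 2 0 + 4 * Z 0 3 ^+ 2 - 4 * Z 0 4 ^+ 2;
        - (5 / 4 * Z 1 0);
        - (5 / 6 * Z 0 0);
        0;
        1 / 24]
  | 2%N, 3%N => [:: - (2 * (r * Z 0 1) * Z 1 3) - 16 * (r * Z 0 1) ^+ 2 * Z 0 4 - 6 * (r * Z 1 1) * Z 0 3 + 8 / 3 * Z 0 0 * Z 0 4 - 1 / 6 * Z 2 4;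
        - (10 * (r * Z 0 1) * Z 0 3) - 5 / 6 * Z 1 4;
        - (5 / 3 * Z 0 4)]
  | 2%N, 4%N => [:: - (2 * (r * Z 0 1) * Z 1 4) - 16 * (r * Z 0 1) ^+ 2 * Z 0 3 - 6 * (r * Z 1 1) * Z 0 4 + 8 / 3 * Z 0 0 * Z 0 3 - 1 / 6 * Z 2 3;
        - (10 * (r * Z 0 1) * Z 0 4) - 5 / 6 * Z 1 3;
        - (5 / 3 * Z 0 3)]
  | 3%N, 0%N => [:: - (4 * (r * Z 0 1) * Z 0 4) + Z 1 3;
        2 * Z 0 3]
  | 3%N, 1%N => [:: r * (4 * Z 0 4)]
  | 3%N, 2%N => [:: - (8 * (r * Z 0 1) * Z 1 3) + 16 * (r * Z 0 1) ^+ 2 * Z 0 4 - 4 * (r * Z 1 1) * Z 0 3 - 8 / 3 * Z 0 0 * Z 0 4 + Z 2 4;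
        - (10 * (r * Z 0 1) * Z 0 3) + 5 / 2 * Z 1 4;
        5 / 3 * Z 0 4]
  | 3%N, 3%N => [:: 24 * (r * Z 0 1) * (r * Z 1 1) - Z 1 0;
        24 * (r * Z 0 1) ^+ 2 - 2 * Z 0 0;
        0;
        1 / 2]
  | 3%N, 4%N => [:: - (8 * (r * Z 0 1) * Z 0 0) + 32 * (r * Z 0 1) ^+ 3 + 2 * (r * Z 2 1) + 2 * Z 0 2;
        6 * (r * Z 1 1);
        6 * (r * Z 0 1)]
  | 4%N, 0%N => [:: - (4 * (r * Z 0 1) * Z 0 3) + Z 1 4;
        2 * Z 0 4]
  | 4%N, 1%N => [:: r * (4 * Z 0 3)]
  | 4%N, 2%N => [:: - (8 * (r * Z 0 1) * Z 1 4) + 16 * (r * Z 0 1) ^+ 2 * Z 0 3 - 4 * (r * Z 1 1) * Z 0 4 - 8 / 3 * Z 0 0 * Z 0 3 + Z 2 3;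
        - (10 * (r * Z 0 1) * Z 0 4) + 5 / 2 * Z 1 3;
        5 / 3 * Z 0 3]
  | 4%N, 3%N => [:: 8 * (r * Z 0 1) * Z 0 0 - 32 * (r * Z 0 1) ^+ 3 - 2 * (r * Z 2 1) - 2 * Z 0 2;
        - (6 * (r * Z 1 1));
        - (6 * (r * Z 0 1))]
  | 4%N, 4%N => [:: - (24 * (r * Z 0 1) * (r * Z 1 1)) + Z 1 0;
        - (24 * (r * Z 0 1) ^+ 2) + 2 * Z 0 0;
        0;
        - (1 / 2)]
  | _, _ => [::]
  end.

End WTable.

Definition Wop (R : realType) : lbracket R 5 :=
  fun a b k J => (Wtab J a b)`_k.

Lemma dpoly_opp (R : realType) n (f : jet R n -> CC R) : dpoly f -> dpoly (fun J => - f J).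
Proof.
move=> df; rewrite (_ : (fun J => _) = (fun J => (-1) * f J)).
  by apply: dpoly_mul => //; exact: dpoly_const.
by apply/funext => J; rewrite mulN1r.
Qed.

Lemma dpoly_exp (R : realType) n (f : jet R n -> CC R) k : dpoly f -> dpoly (fun J => f J ^+ k).
Proof.
move=> df; elim: k => [|k IH]; first by under eq_fun do rewrite expr0; exact: dpoly_const.
by under eq_fun do rewrite exprS; exact: dpoly_mul.
Qed.

Ltac dpoly_tac := lazymatch goal with
  | |- dpoly (fun J => - _) => apply: dpoly_opp; dpoly_tac
  | |- dpoly (fun J => _ + _) => apply: dpoly_add; dpoly_tac
  | |- dpoly (fun J => _ ^+ _) => apply: dpoly_exp; dpoly_tac
  | |- dpoly (fun J => _ / _) => exact: dpoly_const
  | |- dpoly (fun J => _ * _) => apply: dpoly_mul; dpoly_tac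
  | |- dpoly _ => first [exact: dpoly_var | exact: dpoly_const]
  end.

Lemma Wop_high (R : realType) (a b : 'I_5) k : (5 < k)%N -> @Wop R a b k = (fun=> 0).
Proof.
move=> k5; apply/funext => J; rewrite /Wop nth_default //.
move: a b => [[|[|[|[|[|//]]]]] ?] [[|[|[|[|[|//]]]]] ?]; exact: leq_trans k5.
Qed.

Lemma Wop_local (R : realType) : is_local (@Wop R).
Proof.
split; last by exists 5%N; exact: Wop_high.
move=> a b k; rewrite /Wop.
move: a b => [[|[|[|[|[|//]]]]] ?] [[|[|[|[|[|//]]]]] ?] /=;
  move: k => [|[|[|[|[|[|k]]]]]] /=; rewrite ?nth_nil; dpoly_tac.
Qed.

Lemma sum5 (V : nmodType) (F : 'I_5 -> V) : \sum_i F i = F 0 + F 1 + F 2 + F 3 + F 4.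
Proof.
rewrite !big_ord_recl big_ord0 addr0 !addrA.
by congr (F _ + F _ + F _ + F _ + F _); apply: val_inj.
Qed.

Lemma ord5P (P : 'I_5 -> Prop) : P 0 -> P 1 -> P 2 -> P 3 -> P 4 -> forall i, P i.
Proof.
move=> p0 p1 p2 p3 p4 i; have : i \in [:: (0 : 'I_5); 1; 2; 3; 4] by move: i => [[|[|[|[|[|//]]]]] ?].
by rewrite !inE => /orP[/eqP ->|/orP[/eqP ->|/orP[/eqP ->|/orP[/eqP ->|/eqP ->]]]].
Qed.

Lemma ord5E : ((nat_of_ord (0%R : 'I_5) = 0%N) * (nat_of_ord (1%R : 'I_5) = 1%N) *
  (nat_of_ord (2%R : 'I_5) = 2%N) * (nat_of_ord (3%R : 'I_5) = 3%N) *
  (nat_of_ord (4%R : 'I_5) = 4%N))%type.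
Proof. by []. Qed.

Lemma lval_nat (R : realType) (n : nat) x : lval (n%:R : sloop R) x = n%:R.
Proof. by elim: n => [//|n IH]; rewrite !mulrS lvalD IH. Qed.

Definition lvalE (R : realType) :=
  (@lvalD R, @lvalM R, @lvalN R, @lval_cS R, @lval0 R, @lval1 R, @lval_nat R).

Ltac gen_entries z x :=
  repeat match goal with |- context [?h z x] => generalize (h z x); intro end;
  repeat match goal with |- context [?h x] => generalize (h x); intro end.
(** Treats the entries of the two families and their derivatives as atoms, evaluates at a point
    and concludes over the complex numbers. *)
Ltac pfield :=
  try match goal with z : 'I_5 -> sloop _, x : 'I_5 -> sloop _ |- _ => gen_entries z x end;
  repeat match goal with |- context [@Dx ?T ?f] => generalize (@Dx T f); intro end;
  apply: sloop_eq => ?; rewrite !lvalE;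
  repeat match goal with |- context [@lval ?T ?f ?t] => generalize (@lval T f t); intro end;
  try match goal with |- context [r3 ?T] => generalize (r3 T); intro end; by field.

Section Lift.
Variable R : realType.
Local Notation CR := (CC R).
Local Notation S := (sloop R).
Local Notation cS := (@cS R).
Local Notation Dx := (@Dx R).
Local Notation oI := (@oI R).
Local Notation r := (cS (r3 R)).
Local Notation h2 := (cS (1 / 2)).
Local Notation h3 := (cS (1 / 3)).

Section Entries.
Variables z x : 'I_5 -> S.
Local Notation y := (r * z 1).
Local Notation z1 := (z 0).
Local Notation z3 := (z 2).
Local Notation xy := (3 * (r * x 1)).
Local Notation p := (2 * z 3 - 2 * z 4).
Local Notation s := (2 * z 3 + 2 * z 4).

(** Entries of the lift A of x at the loop z. The pairings with the basis of g^f
    and the vanishing of the trace give A_02, A_03, A_32, A_33, A_01 + A_12 and the trace of the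
    3x3 block; each condition on the entries of D A = A' + [q, A] then expresses one more entry
    of A through earlier ones and their derivatives. *)
Definition lA02 := x 2.
Definition lA03 := x 3 + x 4.
Definition lA32 := x 3 - x 4.
Definition lA33 := - xy.
Definition lA01 := x 0 + h2 * Dx lA02.
Definition lA12 := x 0 - h2 * Dx lA02.
Definition lA13 := p * lA02 - 4 * y * lA03 - Dx lA03.
Definition lA31 := Dx lA32 + s * lA02 - 4 * y * lA32.
Definition lu := 2 * z1 * lA02 - Dx lA01.
Definition lw := - Dx lA12 - 2 * z1 * lA02.
Definition lA11 := h3 * (xy + lu - lw).
Definition lA00 := lA11 - lu.
Definition lA22 := lA11 + lw.
Definition lA23 := p * lA12 - Dx lA13 - 2 * z1 * lA03 - 4 * y * lA13.
Definition lA30 := Dx lA31 + s * lA01 - 4 * y * lA31 - 2 * z1 * lA32.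
Definition lyb := - (h3 * (Dx lA33 + s * lA03 - p * lA32)).
Definition lA10 := lyb - Dx lA00 + 2 * z1 * lA01 + 4 * z3 * lA02 + s * lA03.
Definition lA21 := - lyb + Dx lA22 + 4 * z3 * lA02 + 2 * z1 * lA12 + p * lA32.
Definition lA20 := h2 * (Dx lA21 - Dx lA10 - 2 * z1 * lA00 + 2 * z1 * lA11 + 4 * z3 * lA12
  + s * lA13 + 4 * z3 * lA01 + 2 * z1 * lA11 + p * lA31 - 2 * z1 * lA22).

Definition liftS : 'M[S]_4 :=
  m4 lA00 lA01 lA02 lA03 lA10 lA11 lA12 lA13 lA20 lA21 lA22 lA23 lA30 lA31 lA32 lA33.

(** The components of D A in g^f, read off from the remaining entries. *)
Definition lb0 := h2 * (Dx lA10 + 2 * z1 * lA00 + lA20 - 2 * z1 * lA11 - 4 * z3 * lA12 - s * lA13).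
Definition lb1 := 3 * r * lyb.
Definition lb2 := h2 * h2 * (Dx lA20 + 4 * z3 * lA00 + 2 * z1 * lA10 + p * lA30
   - 2 * z1 * lA21 - 4 * z3 * lA22 - s * lA23).
Definition l23 := Dx lA23 + 4 * z3 * lA03 + 2 * z1 * lA13 + 4 * y * lA23 + p * lA33 - p * lA22.
Definition l30 := Dx lA30 + s * lA00 - 4 * y * lA30 - 2 * z1 * lA31 - 4 * z3 * lA32 - s * lA33.
Definition lb3 := h2 * h2 * (l30 + l23).
Definition lb4 := h2 * h2 * (l30 - l23).

Definition bS : 'I_5 -> S := fun i => nth 0 [:: lb0; lb1; lb2; lb3; lb4] i.

End Entries.

Definition dS (z : 'I_5 -> S) (A : 'M[S]_4) := map_mx Dx A + (qS z *m A - A *m qS z).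

Lemma m4_map (K K' : comNzRingType) (f : K -> K') (a00 a01 a02 a03 a10 a11 a12 a13 a20 a21 a22 a23 a30 a31 a32 a33 : K) :
  map_mx f (m4 a00 a01 a02 a03 a10 a11 a12 a13 a20 a21 a22 a23 a30 a31 a32 a33) =
  m4 (f a00) (f a01) (f a02) (f a03) (f a10) (f a11) (f a12) (f a13)
     (f a20) (f a21) (f a22) (f a23) (f a30) (f a31) (f a32) (f a33).
Proof.
apply/matrixP => i j; rewrite !mxE.
by move: i j => [[|[|[|[|//]]]] ?] [[|[|[|[|//]]]] ?].
Qed.

Lemma r3S : r * (3 * r) = 1.
Proof.
apply: sloop_eq => x; rewrite !lvalE mulrCA -expr2 r3sq; by field.
Qed.

Lemma h2E (a : S) : h2 * (a + a) = a.
Proof. by apply: sloop_eq => x; rewrite !lvalE; by field. Qed.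

Lemma h3E (a : S) : h3 * (a + a + a) = a.
Proof. by apply: sloop_eq => x; rewrite !lvalE; by field. Qed.

Lemma h2S : 2 * h2 = 1.
Proof. by apply: sloop_eq => t; rewrite !lvalE; field. Qed.
Lemma h3S : 3 * h3 = 1.
Proof. by apply: sloop_eq => t; rewrite !lvalE; field. Qed.

Lemma lift_tr z x : lA00 z x + lA11 z x + lA22 z x + lA33 x = 0.
Proof. by rewrite /lA00 /lA22 /lA11 /lA33; pfield. Qed.

(** Each entry of D A either vanishes by the choice of an entry of A or defines a
    component; the last diagonal entry follows from the derivative of the trace condition. *)
Lemma dS_lift z x : dS z (liftS z x) = xS (bS z x).
Proof.
have Htr : Dx (lA22 z x) = - Dx (lA33 x) - Dx (lA00 z x) - Dx (lA11 z x).
  have := congr1 Dx (lift_tr z x); rewrite !D_add raddf0 => e.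
  by apply/eqP; rewrite -subr_eq0 -[X in _ == X]e; apply/eqP; ring.
have rb : r * lb1 z x = lyb z x by rewrite /lb1 mulrA r3S mul1r.
apply/subr0_eq; rewrite /dS /liftS /qS /xS /qgen m4_map !m4M m4B m4D m4B.
apply/m4_eq0P; rewrite /bS /=; split; split.
- rewrite rb /lA10; ring.
- rewrite /lA00 /lu; ring.
- rewrite /lA01 /lA12; by pfield.
- rewrite /lA13; ring.
- rewrite /lb0; by pfield.
- rewrite rb /lA21 /lA10 Htr /lyb; by pfield.
- rewrite /lA22 /lw; ring.
- rewrite /lA23; ring.
- rewrite /lb2; by pfield.
- rewrite /lb0 /lA20; by pfield.
- rewrite rb /lA21; ring.
- rewrite /lb3 /lb4 /l23; by pfield.
- rewrite /lb3 /lb4 /l30; by pfield.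
- rewrite /lA30; ring.
- rewrite /lA31; ring.
- rewrite rb /lyb; by pfield.
Qed.

End Lift.

(** * Identities between differential polynomials *)

Section Reflect.
Variable R : realType.
Local Notation CR := (CC R).
Local Notation S := (sloop R).
Local Notation cS := (@cS R).
Local Notation Dx := (@Dx R).

(** Syntax of expressions in loops. [rnorm] pushes the derivation to the atoms, so that an identity
    between differential polynomials becomes one between the values of the atoms and their derivatives
    at a point, which [field] decides. *)
Inductive rexp :=
  | RC (c : CR) | RI (n : nat) | RV (k i : nat) | RA (a b : rexp) | RM (a b : rexp)
  | RN (a : rexp) | RD (a : rexp).

Fixpoint rev_ (env : seq S) (e : rexp) : S :=
  match e with
  | RC c => cS c
  | RI n => n%:R
  | RV k i => iter k Dx (nth 0 env i)
  | RA a b => rev_ env a + rev_ env b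
  | RM a b => rev_ env a * rev_ env b
  | RN a => - rev_ env a
  | RD a => Dx (rev_ env a)
  end.

Fixpoint rdiff (e : rexp) : rexp :=
  match e with
  | RC _ | RI _ => RI 0
  | RV k i => RV k.+1 i
  | RA a b => RA (rdiff a) (rdiff b)
  | RM (RC c) b => RM (RC c) (rdiff b)
  | RM (RI c) b => RM (RI c) (rdiff b)
  | RM a b => RA (RM (rdiff a) b) (RM a (rdiff b))
  | RN a => RN (rdiff a)
  | RD a => RD (rdiff a)
  end.

Fixpoint rnorm (e : rexp) : rexp :=
  match e with
  | RA a b => RA (rnorm a) (rnorm b)
  | RM a b => RM (rnorm a) (rnorm b)
  | RN a => RN (rnorm a)
  | RD a => rdiff (rnorm a)
  | _ => e
  end.

(** Value of an expression; [at_ k i] stands for the value of the k-th derivative of atom i. *)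
Fixpoint rval (at_ : nat -> nat -> CR) (e : rexp) : CR :=
  match e with
  | RC c => c
  | RI n => n%:R
  | RV k i => at_ k i
  | RA a b => rval at_ a + rval at_ b
  | RM a b => rval at_ a * rval at_ b
  | RN a => - rval at_ a
  | RD a => 0
  end.

Fixpoint rfree (e : rexp) : Prop :=
  match e with
  | RA a b | RM a b => rfree a /\ rfree b
  | RN a => rfree a
  | RD _ => False
  | _ => True
  end.

Lemma Dnat (n : nat) : Dx (n%:R) = 0.
Proof. by rewrite -(rmorph_nat cS) DcS. Qed.

Lemma rdiffP env e : rev_ env (rdiff e) = Dx (rev_ env e).
Proof.
elim: e => //= [c|n|a -> b ->|a IHa b IHb|a ->|a ->] //; rewrite ?DcS ?Dnat ?D_add ?DN //.
by case: a IHa => [c|n|k i|a1 a2|a1 a2|a1|a1] IHa /=; rewrite ?IHb DM ?DcS ?Dnat ?mul0r ?add0r //;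
  congr (_ + _); rewrite -IHa.
Qed.

Lemma rnormP env e : rev_ env (rnorm e) = rev_ env e.
Proof. by elim: e => //= [a -> b ->|a -> b ->|a ->|a <-] //; rewrite rdiffP. Qed.

Lemma rdiff_free e : rfree e -> rfree (rdiff e).
Proof.
elim: e => //= [a IHa b IHb [fa fb]|a IHa b IHb [fa fb]]; first by split; auto.
by case: a IHa fa => //=; intuition.
Qed.

Lemma rnorm_free e : rfree (rnorm e).
Proof. by elim: e => //= a; exact: rdiff_free. Qed.

Lemma rvalP env t e :
  lval (rev_ env e) t = rval (fun k i => lval (iter k Dx (nth 0 env i)) t) (rnorm e).
Proof.
rewrite -rnormP; elim: (rnorm e) (rnorm_free e) => //= [n _|a IHa b IHb [fa fb]|a IHa b IHb [fa fb]|a IHa fa].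
- exact: lval_nat.
- by rewrite -IHa // -IHb.
- by rewrite -IHa // -IHb.
- by rewrite -IHa.
Qed.

End Reflect.

Ltac rlookup env f :=
  lazymatch env with
  | cons f _ => constr:(O)
  | cons _ ?env' => let i := rlookup env' f in constr:(i.+1)
  end.

Ltac reify T env t :=
  lazymatch t with
  | ?a + ?b => let a' := reify T env a in let b' := reify T env b in constr:(@RA T a' b')
  | ?a * ?b => let a' := reify T env a in let b' := reify T env b in constr:(@RM T a' b')
  | - ?a => let a' := reify T env a in constr:(@RN T a')
  | ?a ^+ 2 => let a' := reify T env a in constr:(@RM T a' a')
  | ?a ^+ 3 => let a' := reify T env a in constr:(@RM T a' (@RM T a' a'))
  | Dx ?a => let a' := reify T env a in constr:(@RD T a')
  | cS ?c => constr:(@RC T c)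
  | ?n%:R => constr:(@RI T n)
  | ?f => let i := rlookup env f in constr:(@RV T 0 i)
  end.

(** Turns the right-hand side of an equation between values at t into an expression in the
    values of the derivatives of the loops listed in env. *)
Ltac rpush env :=
  lazymatch goal with |- _ = @lval ?T ?e ?t =>
    let e' := reify T env e in
    rewrite (_ : e = rev_ env e'); [rewrite rvalP; cbn [rnorm rdiff rval nth iter]|reflexivity]
  end.

Ltac rpushl env :=
  lazymatch goal with |- @lval ?T ?e ?t = _ =>
    let e' := reify T env e in
    rewrite (_ : e = rev_ env e'); [rewrite rvalP; cbn [rnorm rdiff rval nth iter]|reflexivity]
  end.
Ltac gen_lval :=
  repeat match goal with |- context [@lval ?T ?f ?t] => generalize (@lval T f t); intro end.

Section WOp.
Variable R : realType.
Local Notation CR := (CC R).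
Local Notation S := (sloop R).
Local Notation cS := (@cS R).
Local Notation Dx := (@Dx R).

Lemma lop_rowl n (P : lbracket R n) m q eta x a :
  (forall a b k, (m < k)%N -> P a b k = (fun=> 0)) ->
  lop P (rowl q) (rowl eta) x 0 a
  = \sum_b \sum_(0 <= k < m.+1) P a b k (jet_of (rowl q) x) * lval (iter k Dx (eta b)) x.
Proof.
move=> H; rewrite (lop_finite _ _ _ _ H); apply: eq_bigr => b _; apply: eq_bigr => k _.
by rewrite mxd_rowl.
Qed.

Lemma sum_nat6 (V : nmodType) (F : nat -> V) :
  \sum_(0 <= k < 6) F k = F 0%N + F 1%N + F 2%N + F 3%N + F 4%N + F 5%N.
Proof. by rewrite !big_nat_recr //= big_geq // add0r. Qed.

Lemma lb1E (z x : 'I_5 -> S) : lb1 z x =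
  Dx (x 1) - cS (r3 R) * ((2 * z 3 + 2 * z 4) * lA03 x - (2 * z 3 - 2 * z 4) * lA32 x).
Proof.
rewrite /lb1 /lyb /lA33 DN DM Dnat mul0r add0r DcSM.
move: (Dx _) (lA03 x) (lA32 x) => X a b.
transitivity ((cS (r3 R) * (3 * cS (r3 R))) * (3 * cS (1 / 3)) * X - (3 * cS (1 / 3)) *
  (cS (r3 R) * ((2 * z 3 + 2 * z 4) * a - (2 * z 3 - 2 * z 4) * b))); first by ring.
by rewrite r3S h3S !mul1r.
Qed.

(** The table is the operator: both sides are differential polynomials in z and x with the
    same coefficients. *)
Lemma Wop_op : is_op (@Wop R) (@bS R).
Proof.
move=> z x; apply/funext => t; apply/rowP => a; rewrite (lop_rowl _ _ _ _ (@Wop_high R)).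
have E k i : jet_of (rowl z) t k 0 i = lval (iter k Dx (z i)) t by exact: jet_of_rowl.
rewrite [RHS]mxE; move: (jet_of (rowl z) t) E => J E.
rewrite sum5 !sum_nat6.
rewrite /Wop.
have B := (erefl : bS z x 0 = lb0 z x, erefl : bS z x 1 = lb1 z x, erefl : bS z x 2 = lb2 z x,
  erefl : bS z x 3 = lb3 z x, erefl : bS z x 4 = lb4 z x).
move: a; apply: ord5P; rewrite !ord5E B; cbn [Wtab nth iter]; rewrite ?E; cbn [iter].
all: rewrite ?lb1E /lb0 /lb2 /lb3 /lb4 /l30 /l23 /lA20 /lA21 /lA10 /lA30 /lA23 /lA00 /lA22 /lA11 /lu /lw
  /lyb /lA13 /lA31 /lA12 /lA01 /lA02 /lA03 /lA33 /lA32.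
all: rpush [:: z 0; z 1; z 2; z 3; z 4; x 0; x 1; x 2; x 3; x 4].
all: cbn [iter].
all: gen_lval.
all: generalize (r3 R); intro; by field.
Qed.
End WOp.

(** * Characterisation of the lift *)

Section WLift.
Variable R : realType.
Local Notation CR := (CC R).
Local Notation S := (sloop R).
Local Notation cS := (@cS R).
Local Notation Dx := (@Dx R).
Local Notation oI := (@oI R).
Local Notation h2 := (cS (1 / 2)).

Lemma L1E : L1 R = m4 0 1 0 0 0 0 1 0 0 0 0 0 0 0 0 0.
Proof.
apply/matrixP => i j; rewrite !mxE.
by move: i j => [[|[|[|[|//]]]] ?] [[|[|[|[|//]]]] ?] /=; rewrite ?addr0 ?add0r.
Qed.

Lemma fmxE : fmx R = m4 0 0 0 0 2 0 0 0 0 2 0 0 0 0 0 0.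
Proof.
apply/matrixP => i j; rewrite !mxE.
by move: i j => [[|[|[|[|//]]]] ?] [[|[|[|[|//]]]] ?] /=; ring.
Qed.

Lemma hmxE : hmx R = m4 1 0 0 0 0 0 0 0 0 0 (-1) 0 0 0 0 0.
Proof.
apply/matrixP => i j; rewrite !mxE.
by move: i j => [[|[|[|[|//]]]] ?] [[|[|[|[|//]]]] ?] /=; ring.
Qed.

Lemma triple_sl4 : sl4 (L1 R) /\ sl4 (hmx R) /\ sl4 (fmx R).
Proof.
by rewrite /sl4 /= L1E hmxE fmxE !m4_tr !addr0; split => //; split => //; rewrite subrr.
Qed.

Lemma triple_rel : lie_br (hmx R) (L1 R) = L1 R /\ lie_br (hmx R) (fmx R) = - fmx R /\
  lie_br (L1 R) (fmx R) = 2 *: hmx R.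
Proof.
rewrite -scaleN1r /lie_br L1E hmxE fmxE !m4Z !m4M !m4B.
by split; [|split]; congr m4; ring.
Qed.

Lemma form_den : \tr (L1 R *m fmx R) = 4.
Proof. by rewrite L1E fmxE m4M m4_tr; ring. Qed.

(** The centraliser of f, solved entry by entry. *)
Lemma gfP (B : 'M[CR]_4) : gf B <-> exists b : 'I_5 -> CR, B = xmx b.
Proof.
have r0 := r3_neq0 R.
split=> [[tr0 /eqP]|[b ->]]; last first.
  split; first by rewrite /sl4 /= /xmx /qgen m4_tr; ring.
  rewrite /lie_br fmxE /xmx /qgen !m4M m4B; apply/m4_eq0P; split; split; ring.
move: tr0; rewrite /sl4 /= /lie_br fmxE (m4E B) !m4M m4B m4_tr => tr0 /eqP.
move: tr0.
move: (B 0 0) (B 0 1) (B 0 2) (B 0 3) (B 1 0) (B 1 1) (B 1 2) (B 1 3)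
      (B 2 0) (B 2 1) (B 2 2) (B 2 3) (B 3 0) (B 3 1) (B 3 2) (B 3 3).
move=> a00 a01 a02 a03 a10 a11 a12 a13 a20 a21 a22 a23 a30 a31 a32 a33.
rewrite !(mul0r, mulr0, add0r, addr0, subr0, sub0r) => tr0 /m4_eq0P.
have two (a : CR) : 2 * a = 0 -> a = 0.
  by move/eqP; rewrite mulf_eq0 pnatr_eq0 /= => /eqP.
have twoN (a : CR) : - (a * 2) = 0 -> a = 0.
  by move/eqP; rewrite oppr_eq0 mulf_eq0 pnatr_eq0 orbF => /eqP.
have twoB (a b : CR) : 2 * a - b * 2 = 0 -> a = b.
  by move=> e; apply/eqP; rewrite -subr_eq0; apply/eqP; apply: two; rewrite -e; ring.
case=> [[e00 e01 _ _] [e10 e11 e12 e13] [e20 e21 e22 e23] [e30 e31 _ _]].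
have a01E := twoN _ e00; have a02E := twoN _ e01.
have a12E : a12 = 0 by rewrite -(twoB _ _ e11).
have a03E := two _ e13; have a13E := two _ e23.
have a31E := twoN _ e30; have a32E := twoN _ e31.
have a00E := twoB _ _ e10; have a10E := twoB _ _ e20; have a11E := twoB _ _ e21.
pose b := [:: a10 / 2; a00 / r3 R; a20 / 4; (a30 + a23) / 4; (a30 - a23) / 4].
exists (fun i => b`_i); rewrite /xmx /qgen /=.
rewrite a01E a02E a03E a12E a13E a31E a32E -a10E -a11E -a00E.
have a33E : a33 = - (3 * a00).
  by apply/eqP; rewrite -subr_eq0 opprK -tr0 -a11E -a00E; apply/eqP; ring.
rewrite a33E; congr m4; field; by rewrite ?r0.
Qed.

Lemma slodowy_qmx (z : 'rV[CR]_5) : slodowy (qmx z).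
Proof. by apply/gfP; exists (fun i => z 0 i); exact: qmxL1. Qed.

Lemma xmx_inj (b b' : 'I_5 -> CR) : xmx b = xmx b' -> b = b'.
Proof.
have r0 := r3_neq0 R.
move=> e; have : xmx b - xmx b' = 0 by rewrite e subrr.
rewrite /xmx /qgen m4B => /m4_eq0P; case=> [[e00 _ _ _] [e10 _ _ _] [e20 _ _ e23] [e30 _ _ _]].
have d c (a a' : CR) : c != 0 -> c * a - c * a' = 0 -> a = a'.
  move=> c0 /eqP; rewrite -mulrBr mulf_eq0 (negPf c0) /= subr_eq0 => /eqP //.
have n2 : (2 : CR) != 0 by rewrite pnatr_eq0.
have n4 : (4 : CR) != 0 by rewrite pnatr_eq0.
apply/funext; apply: ord5P.
- exact: d n2 e10.
- exact: d r0 e00.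
- exact: d n4 e20.
- by apply: d n4 _; rewrite -[RHS](addr0 0) -{1}e23 -e30; ring.
- by apply: d n4 _; rewrite -[RHS](subr0 0) -{1}e30 -e23; ring.
Qed.

Lemma slodowy_coord (A : 'M[CR]_4) : slodowy A -> exists! z : 'rV[CR]_5, A = qmx z.
Proof.
move=> /gfP[b Hb]; exists (\row_i b i); split.
  apply: (addIr (- L1 R)); rewrite Hb qmxL1; congr xmx.
  by apply/funext => i; rewrite mxE.
move=> z Hz; move: Hb; rewrite Hz qmxL1 => /xmx_inj e.
by apply/rowP => i; rewrite mxE -e.
Qed.

(** The pairings of a matrix with the basis of g^f. *)
Definition dual_coord (A : 'M[S]_4) : 'I_5 -> S := fun i => nth 0
  [:: h2 * (A 0 1 + A 1 2);
      h2 * h2 * (cS (r3 R) * (A 0 0 + A 1 1 + A 2 2 - 3 * A 3 3));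
      A 0 2; h2 * (A 3 2 + A 0 3); h2 * (A 0 3 - A 3 2)] i.

Definition formS (A B : 'M[S]_4) : S := h2 * h2 * \tr (A *m B).

Lemma formSE (A B : 'M[S]_4) x : form (mloop A x) (mloop B x) = lval (formS A B) x.
Proof.
by rewrite /form form_den -mloopM mloop_tr /formS !lvalE; field.
Qed.

Lemma formS_xS (A : 'M[S]_4) b : formS A (xS b) = \sum_i dual_coord A i * b i.
Proof.
rewrite sum5 /dual_coord !ord5E /= /formS (m4E A) /xS /qgen m4M m4_tr !mxE /=.
move: (A _ _) (A _ _) (A _ _) (A _ _) (A _ _) (A _ _) (A _ _) (A _ _) (A _ _) (A _ _)
   (A _ _) (A _ _) (A _ _) (A _ _) (A _ _) (A _ _) (b _) (b _) (b _) (b _) (b _).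
by move=> *; pfield.
Qed.

Lemma dual_coord_lift z x : dual_coord (liftS z x) = x.
Proof.
apply/funext; apply: ord5P; rewrite /dual_coord !ord5E [nth _ _ _]/= /liftS !mxE [nth _ _ _]/=.
- by rewrite /lA01 /lA12; pfield.
- have -> : cS (r3 R) * (lA00 z x + lA11 z x + lA22 z x - 3 * lA33 x) = - (4 * (cS (r3 R) * lA33 x)).
    have -> : lA00 z x + lA11 z x + lA22 z x = - lA33 x.
      by apply/eqP; rewrite -subr_eq0 opprK lift_tr.
    by ring.
  transitivity (2 * h2 * (2 * h2) * (cS (r3 R) * (3 * cS (r3 R))) * x 1); first by rewrite /lA33; ring.
  by rewrite h2S r3S !mul1r.
- by [].
- by rewrite /lA32 /lA03; pfield.
- by rewrite /lA32 /lA03; pfield.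
Qed.

Lemma tr_lift (z x : 'I_5 -> S) : \tr (liftS z x) = 0.
Proof. by rewrite /liftS m4_tr lift_tr. Qed.

(** The definition of the lift as equations between loops. *)
Lemma is_liftP (z x : 'I_5 -> S) (A : 'M[S]_4) :
  is_lift (rowl z) (rowl x) (mloop A) <->
  [/\ \tr A = 0, dual_coord A = x & exists b, dS z A = xS b].
Proof.
have formX t i : form (mloop A t) (Xbasis R i) = lval (dual_coord A i) t.
  have -> : Xbasis R i = mloop (xS (fun j => (j == i)%:R)) t.
    rewrite mloop_xS /Xbasis qmxL1; congr xmx; apply/funext => j.
    by rewrite !mxE eqxx /= lval_nat eq_sym.
  rewrite formSE formS_xS (bigD1 i) //= eqxx mulr1 big1 ?addr0 // => j /negPf ->.
  by rewrite mulr0.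
have dSE t : mxd 1 (mloop A) t + lie_br (qmx (rowl z t)) (mloop A t) = mloop (dS z A) t.
  by rewrite mxd_mloop /dS mloopD mloopB !mloopM mloop_qS.
split=> [[_ tr0 cfA gfA]|[tr0 cfA [b Hb]]]; last first.
  split=> [|t|t i|t]; first exact: mxloop_mloop.
  - by rewrite /sl4 /= mloop_tr tr0.
  - by rewrite formX cfA mxE.
  - by rewrite dSE Hb mloop_xS; apply/gfP; exists (fun i => rowl b t 0 i).
split.
- by apply: sloop_eq => t; rewrite -mloop_tr; exact: tr0.
- by apply/funext => i; apply: sloop_eq => t; rewrite -formX cfA mxE.
have H t : exists b, mloop (dS z A) t = xmx b by apply/gfP; rewrite -dSE.
pose B := dS z A; pose bb := [:: h2 * B 1 0; 3 * cS (r3 R) * B 0 0; h2 * h2 * B 2 0;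
  h2 * h2 * (B 3 0 + B 2 3); h2 * h2 * (B 3 0 - B 2 3)].
exists (fun i => bb`_i); apply: mloop_eq => t; have [b Hb] := H t.
rewrite mloop_xS Hb; congr xmx; apply/funext => i; rewrite mxE.
have E (k l : 'I_4) : lval (B k l) t = xmx b k l by rewrite -Hb [RHS]mxE.
have rr : r3 R * r3 R = 1 / 3 by rewrite -expr2 r3sq.
move: i; apply: ord5P; rewrite ord5E [nth _ _ _]/= !lvalE !E /xmx /qgen !mxE /=; try by field.
transitivity (3 * (r3 R * r3 R) * b 1); last by ring.
by rewrite rr; field.
Qed.

Lemma is_lift_liftS (z x : 'I_5 -> S) : is_lift (rowl z) (rowl x) (mloop (liftS z x)).
Proof.
by apply/is_liftP; split; [exact: tr_lift|exact: dual_coord_lift|exists (bS z x); exact: dS_lift].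
Qed.

Lemma two_eq0 (a : S) : a + a = 0 -> a = 0.
Proof. by move=> e; rewrite -[a]h2E e mulr0. Qed.
Lemma three_eq0 (a : S) : a + a + a = 0 -> a = 0.
Proof. by move=> e; rewrite -[a]h3E e mulr0. Qed.

(** Uniqueness of the lift: the same triangular system that determines [liftS], with zero data. *)
Lemma lift_zero (z : 'I_5 -> S) (A : 'M[S]_4) b : \tr A = 0 -> dual_coord A = (fun=> 0) -> dS z A = xS b -> A = 0.
Proof.
move=> tr0 c0 d0.
have C i : dual_coord A i = 0 by rewrite c0.
move: (C 0) (C 1) (C 2) (C 3) (C 4) tr0 d0; rewrite {C c0} /dual_coord !ord5E ![nth _ _ _]/= (m4E A) !mxE ![nth _ _ _]/=.
move: (A 0 0) (A 0 1) (A 0 2) (A 0 3) (A 1 0) (A 1 1) (A 1 2) (A 1 3)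
      (A 2 0) (A 2 1) (A 2 2) (A 2 3) (A 3 0) (A 3 1) (A 3 2) (A 3 3).
move=> a00 a01 a02 a03 a10 a11 a12 a13 a20 a21 a22 a23 a30 a31 a32 a33.
have h2i (a : S) : h2 * a = 0 -> a = 0.
  by move=> e; rewrite -[a]h2E mulrDr e addr0.
have ri (a : S) : cS (r3 R) * a = 0 -> a = 0.
  by move=> e; rewrite -[a]mul1r -r3S mulrAC e mul0r.
move=> /h2i c0; rewrite -mulrA => /h2i/h2i/ri c1 c2 /h2i c3 /h2i c4.
rewrite m4_tr => tr0 /eqP; rewrite -subr_eq0 => /eqP.
rewrite /dS /qS /xS /qgen m4_map !m4M m4B m4D m4B => /m4_eq0P.
have a03E : a03 = 0 by apply: two_eq0; rewrite -[RHS](addr0 0) -{1}c3 -c4; ring.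
have a32E : a32 = 0 by rewrite -[RHS]c3 a03E addr0.
have a33E : a33 = 0.
  by apply: two_eq0; apply: two_eq0; rewrite -[RHS](subr0 0) -{1}tr0 -c1; ring.
rewrite c2 a03E a32E a33E !raddf0 !(mulr0, mul0r, add0r, addr0, subr0, sub0r, mulr1, mul1r).
case=> [[e00 e01 e02 a13E] [e10 e11 e12 e13] [e20 e21 e22 e23] [e30 e31 e32 e33]].
have eq (u v : S) : u - v = 0 -> u = v by move/eqP; rewrite subr_eq0 => /eqP.
have a12E := eq _ _ e02.
have a01E : a01 = 0 by apply: two_eq0; rewrite -[RHS]c0 a12E.
have a31E : a31 = 0 by rewrite -[a31]opprK e32 oppr0.
have rb : cS (r3 R) * b 1 = 0 by apply: three_eq0; rewrite -[RHS]e33; ring.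
move: e00 e01 e10 e11 e12 e13 e20 e21 e22 e23 e30 e31.
rewrite a12E a01E a13E a31E rb !raddf0 !(mulr0, mul0r, add0r, addr0, subr0, sub0r).
move=> e00 e01 e10 e11 e12 e13 e20 e21 e22 e23 e30 e31.
have a11E := eq _ _ e01; have a22E := eq _ _ e12.
have a00E : a00 = 0 by apply: three_eq0; rewrite -[RHS]tr0 a33E a22E a11E addr0.
have a30E : a30 = 0 by rewrite -[RHS]oppr0 -e31; ring.
have a23E : a23 = 0 by rewrite -[RHS]e13; ring.
move: e00 e10 e21 e22; rewrite a22E a11E a00E !raddf0 !(mulr0, mul0r, add0r, addr0, subr0, sub0r).
move=> e00 e10 e21 e22.
have a10E : a10 = 0 by rewrite -[RHS]e00; ring.
have a21E : a21 = 0 by rewrite -[RHS]oppr0 -e22; ring.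
have a20E : a20 = 0.
  apply: two_eq0; rewrite -[RHS](subr0 0) -{1}e10 -e21 ?a10E ?a21E ?a23E ?raddf0; ring.
rewrite a10E a21E a30E a23E a20E; exact/m4_eq0P.
Qed.

End WLift.

(** * The Poisson property of the W-algebra *)

Section Traces.
Variables (K : comNzRingType) (n : nat).
Local Notation M := 'M[K]_n.
Implicit Types (A B C Q X Y Z : M).

Lemma tr_ad X Y Z : \tr ((X *m Y - Y *m X) *m Z) = \tr (X *m (Y *m Z - Z *m Y)).
Proof.
rewrite mulmxBl mulmxBr !raddfB /= !mulmxA; congr (_ - _).
by rewrite -!mulmxA mxtrace_mulC mulmxA.
Qed.

Lemma mx_jacobi A B C :
  (A *m (B *m C - C *m B) - (B *m C - C *m B) *m A)
  + (B *m (C *m A - A *m C) - (C *m A - A *m C) *m B)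
  + (C *m (A *m B - B *m A) - (A *m B - B *m A) *m C) = 0.
Proof.
rewrite !mulmxBr !mulmxBl !mulmxA.
move: (A *m B *m C) (A *m C *m B) (B *m C *m A) (B *m A *m C) (C *m A *m B) (C *m B *m A).
by move=> *; apply/matrixP => i j; rewrite !mxE; ring.
Qed.

(** The Jacobi identity of the commutator and invariance of the trace form. *)
Lemma tr_jacobi Q A B C :
  \tr (((Q *m C - C *m Q) *m A - A *m (Q *m C - C *m Q)) *m B)
  + \tr (((Q *m A - A *m Q) *m B - B *m (Q *m A - A *m Q)) *m C)
  + \tr (((Q *m B - B *m Q) *m C - C *m (Q *m B - B *m Q)) *m A) = 0.
Proof.
rewrite !tr_ad -!mxtraceD -!mulmxDr -[RHS](mxtrace0 _ n) -[X in _ = \tr X](mulmx0 _ Q).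
by congr (\tr (Q *m _)); rewrite -[RHS](mx_jacobi C A B).
Qed.

Variable d : {additive K -> K}.
Hypothesis dM : forall a b, d (a * b) = d a * b + a * d b.

Lemma map_mxM_der A B : map_mx d (A *m B) = map_mx d A *m B + A *m map_mx d B.
Proof.
apply/matrixP => i j; rewrite !mxE raddf_sum -big_split; apply: eq_bigr => k _.
by rewrite !mxE /= dM.
Qed.

Lemma tr_map_der A : \tr (map_mx d A) = d (\tr A).
Proof. by rewrite /mxtrace raddf_sum; apply: eq_bigr => i _; rewrite mxE. Qed.

Lemma tr_cyc_der A B C :
  \tr ((map_mx d C *m A - A *m map_mx d C) *m B)
  + \tr ((map_mx d A *m B - B *m map_mx d A) *m C)
  + \tr ((map_mx d B *m C - C *m map_mx d B) *m A) = d (\tr (C *m (A *m B - B *m A))).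
Proof.
rewrite -tr_map_der !tr_ad map_mxM_der map_mxB !map_mxM_der.
move: (map_mx d A) (map_mx d B) (map_mx d C) => A' B' C'.
have cyc X Y Z : \tr (X *m (Y *m Z)) = \tr (Y *m (Z *m X)).
  by rewrite mxtrace_mulC mulmxA.
have trN X : \tr (- X) = - \tr X by rewrite raddfN.
rewrite !(mulmxDr, mulmxBr, mulmxN, mxtraceD, trN) opprD.
rewrite (cyc C A' B) (cyc C A B') (cyc A B' C) (cyc C B' A) (cyc C B A') (cyc B A' C).
move: (\tr (C' *m (A *m B))) (\tr (C' *m (B *m A))) (\tr (A' *m (B *m C)))
  (\tr (A' *m (C *m B))) (\tr (B' *m (C *m A))) (\tr (B' *m (A *m C))) => *; ring.
Qed.

(** The operator X |-> X' + [Q, X]. *)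
Definition ad_der Q X := map_mx d X + (Q *m X - X *m Q).

(** The Schouten square of the bivector A, B |-> int tr (A (B' + [Q, B])) is a total derivative:
    the commutators with Q cancel by [tr_jacobi], and the derivatives add up by the Leibniz rule.
    This is the Jacobi identity of the affine Lie algebra bracket. *)
Lemma tr_cyc_ad_der Q A B C :
  \tr ((ad_der Q C *m A - A *m ad_der Q C) *m B)
  + \tr ((ad_der Q A *m B - B *m ad_der Q A) *m C)
  + \tr ((ad_der Q B *m C - C *m ad_der Q B) *m A) = d (\tr (C *m (A *m B - B *m A))).
Proof.
have E X Y Z : \tr ((ad_der Q X *m Y - Y *m ad_der Q X) *m Z) =
    \tr ((map_mx d X *m Y - Y *m map_mx d X) *m Z)
    + \tr (((Q *m X - X *m Q) *m Y - Y *m (Q *m X - X *m Q)) *m Z).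
  rewrite -mxtraceD -mulmxDl; congr (\tr (_ *m _)).
  rewrite /ad_der; move: (map_mx d X) (Q *m X - X *m Q) => u v.
  by rewrite mulmxDl mulmxDr opprD addrACA.
rewrite (E C A B) (E A B C) (E B C A) -tr_cyc_der; have := tr_jacobi Q A B C.
move: (\tr _) (\tr _) (\tr _) => a b c j.
move: (\tr _) (\tr _) (\tr _) => x y z.
by rewrite -[RHS]addr0 -j; ring.
Qed.

Lemma tr_ad_der_parts Q A B :
  \tr (A *m ad_der Q B) + \tr (ad_der Q A *m B) = d (\tr (A *m B)).
Proof.
rewrite -tr_map_der -mxtraceD map_mxM_der /ad_der mulmxDr mulmxDl mulmxBr mulmxBl !mulmxA.
have e : \tr (A *m B *m Q) = \tr (Q *m A *m B) by rewrite mxtrace_mulC mulmxA.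
have trN X : \tr (- X) = - \tr X by rewrite raddfN.
rewrite !(mxtraceD, trN) e.
move: (\tr _) (\tr _) (\tr _) (\tr _) => *; ring.
Qed.

End Traces.

Section WPoisson.
Variable R : realType.
Local Notation CR := (CC R).
Local Notation S := (sloop R).
Local Notation cS := (@cS R).
Local Notation Dx := (@Dx R).
Local Notation oI := (@oI R).
Local Notation h2 := (cS (1 / 2)).

Lemma oI_sub (f g : S) : oI (f - g) = oI f - oI g.
Proof. exact: raddfB. Qed.

Lemma formSC (A B : 'M[S]_4) : formS A B = formS B A.
Proof. by rewrite /formS mxtrace_mulC. Qed.

Lemma oI_h2 (a : S) : oI a = 0 -> oI (h2 * h2 * a) = 0.
Proof. by move=> e; rewrite -rmorphM oI_cSM e mulr0. Qed.

Lemma dS_parts q (A B : 'M[S]_4) : oI (formS A (dS q B)) = - oI (formS (dS q A) B).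
Proof.
apply/eqP; rewrite -addr_eq0 -oI_add /formS -mulrDr; apply/eqP/oI_h2.
have := tr_ad_der_parts (@DM R) (qS q) A B; rewrite /ad_der -!/(dS _ _) => ->.
exact: oI_D.
Qed.

Lemma pair_bS (z x y : 'I_5 -> S) : pair x (bS z y) = oI (formS (liftS z x) (dS z (liftS z y))).
Proof. by rewrite dS_lift formS_xS dual_coord_lift. Qed.

(** D_q is skew for the trace form, as a covariant derivative. *)
Lemma W_skew (z x y : 'I_5 -> S) : pair x (bS z y) = - pair y (bS z x).
Proof.
rewrite !pair_bS; apply: etrans (dS_parts z (liftS z x) (liftS z y)) _.
exact: (congr1 (fun a => - oI a) (formSC (dS z (liftS z x)) (liftS z y))).
Qed.

Definition mxcomm (X Y : 'M[S]_4) := X *m Y - Y *m X.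

(** Derivative of the bivector in the direction w. The variation of a lift A is orthogonal
    to g^f, as the pairings of A with the basis are fixed, while D_q of a lift lies in g^f;
    so only the variation of q in D_q contributes. *)
Definition W_var (z x y w : 'I_5 -> S) : CR :=
  - oI (formS (mxcomm (xS w) (liftS z x)) (liftS z y)).

(** At vectors of the form w = D_q C the expression [W_var] becomes the trace of [D_q C, A] B. *)
Lemma W_jac (z x y t : 'I_5 -> S) : W_var z x y (bS z t) + W_var z y t (bS z x) + W_var z t x (bS z y) = 0.
Proof.
rewrite /W_var -!dS_lift -!opprD -!oI_add /formS -!mulrDr; apply/eqP; rewrite oppr_eq0.
apply/eqP/oI_h2; rewrite /mxcomm.
have := tr_cyc_ad_der (@DM R) (qS z) (liftS z x) (liftS z y) (liftS z t).
by rewrite /ad_der -!/(dS _ _) => ->; exact: oI_D.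
Qed.

(** Polynomial dependence on the parameter, without control of the first coefficient. For the
    lift only the value at 0 and differentiability are needed, since its variation drops out of
    [W_var]. *)
Definition pc (f : CR -> S) (f0 : S) : Prop := exists f1, pcurve f f0 f1.

Lemma pcD f g f0 g0 : pc f f0 -> pc g g0 -> pc (fun s => f s + g s) (f0 + g0).
Proof. by move=> [f1 Hf] [g1 Hg]; exists (f1 + g1); exact: pcurveD. Qed.
Lemma pcM f g f0 g0 : pc f f0 -> pc g g0 -> pc (fun s => f s * g s) (f0 * g0).
Proof. by move=> [f1 Hf] [g1 Hg]; exists (f1 * g0 + f0 * g1); exact: pcurveM. Qed.
Lemma pc_cst a : pc (fun=> a) a.
Proof. by exists 0; exact: pcurve_cst. Qed.
Lemma pcN f f0 : pc f f0 -> pc (fun s => - f s) (- f0).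
Proof.
move=> Hf; have := pcM (pc_cst (-1)) Hf; rewrite mulN1r.
by under eq_fun do rewrite mulN1r.
Qed.
Lemma pcDx f f0 : pc f f0 -> pc (fun s => Dx (f s)) (Dx f0).
Proof. by move=> [f1 Hf]; exists (Dx f1); exact: pcurveDx. Qed.

Ltac pc_tac :=
  lazymatch goal with
  | |- pc (fun s => _ + _) _ => apply: pcD; pc_tac
  | |- pc (fun s => - _) _ => apply: pcN; pc_tac
  | |- pc (fun s => _ * _) _ => apply: pcM; pc_tac
  | |- pc (fun s => Dx _) _ => apply: pcDx; pc_tac
  | |- _ => first [assumption | exact: pc_cst]
  end.

Lemma pc_lift (z w x : 'I_5 -> S) (i j : 'I_4) :
  pc (fun s => liftS (fun k => z k + cS s * w k) x i j) (liftS z x i j).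
Proof.
have Hz k : pc (fun s => z k + cS s * w k) (z k) by exists (w k); exact: pcurve_affine.
have P02 : pc (fun s => lA02 x) (lA02 x) by exact: pc_cst.
have P01 : pc (fun s => lA01 x) (lA01 x) by exact: pc_cst.
have H0 := Hz 0; have H1 := Hz 1; have H2 := Hz 2; have H3 := Hz 3; have H4 := Hz 4.
pose zz := fun s k => z k + cS s * w k.
have P13 : pc (fun s => lA13 (zz s) x) (lA13 z x) by rewrite /lA13; pc_tac.
have P31 : pc (fun s => lA31 (zz s) x) (lA31 z x) by rewrite /lA31; pc_tac.
have Pu : pc (fun s => lu (zz s) x) (lu z x) by rewrite /lu; pc_tac.
have Pw : pc (fun s => lw (zz s) x) (lw z x) by rewrite /lw; pc_tac.
have P11 : pc (fun s => lA11 (zz s) x) (lA11 z x) by rewrite /lA11; pc_tac.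
have P00 : pc (fun s => lA00 (zz s) x) (lA00 z x) by rewrite /lA00; pc_tac.
have P22 : pc (fun s => lA22 (zz s) x) (lA22 z x) by rewrite /lA22; pc_tac.
have P23 : pc (fun s => lA23 (zz s) x) (lA23 z x) by rewrite /lA23; pc_tac.
have P30 : pc (fun s => lA30 (zz s) x) (lA30 z x) by rewrite /lA30; pc_tac.
have Pyb : pc (fun s => lyb (zz s) x) (lyb z x) by rewrite /lyb; pc_tac.
have P10 : pc (fun s => lA10 (zz s) x) (lA10 z x) by rewrite /lA10; pc_tac.
have P21 : pc (fun s => lA21 (zz s) x) (lA21 z x) by rewrite /lA21; pc_tac.
have P20 : pc (fun s => lA20 (zz s) x) (lA20 z x) by rewrite /lA20; pc_tac.
rewrite /liftS mxE; under eq_fun do rewrite mxE.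
by move: i j => [[|[|[|[|//]]]] ?] [[|[|[|[|//]]]] ?] /=; first [assumption|exact: pc_cst].
Qed.

Lemma dS_affine z w (s : CR) (A : 'M[S]_4) :
  dS (fun k => z k + cS s * w k) A = dS z A + cS s *: mxcomm (xS w) A.
Proof.
have -> : dS (fun k => z k + cS s * w k) A =
    map_mx Dx A + (qS (fun k => z k + cS s * w k) *m A - A *m qS (fun k => z k + cS s * w k)) by [].
have -> : qS (fun k => z k + cS s * w k) = qS z + cS s *: xS w.
  by rewrite /qS /xS /qgen m4Z m4D; congr m4; ring.
rewrite mulmxDl mulmxDr -scalemxAl -scalemxAr /mxcomm scalerBr /dS.
move: (map_mx Dx A) (qS z *m A) (A *m qS z) (_ *: (_ *m A)) (_ *: (A *m _)) => a b c d e.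
by apply/matrixP => i j; rewrite !mxE; ring.
Qed.

Lemma W_var_derive (z x y w : 'I_5 -> S) : is_derive (0 : CR) 1
  (fun s => pair x (bS (fun i => z i + cS s * w i) y)) (W_var z x y w).
Proof.
pose K := mxcomm (xS w) (liftS z x).
have E s : pair x (bS (fun i => z i + cS s * w i) y) =
    oI (formS (liftS z x) (dS z (liftS z y))
        - cS s * formS K (liftS (fun i => z i + cS s * w i) y)).
  set zs := fun i => z i + cS s * w i.
  have e1 : pair x (bS zs y) = oI (formS (liftS z x) (xS (bS zs y))).
    by rewrite formS_xS dual_coord_lift.
  have e2 : formS (xS (bS z x)) (liftS zs y) = formS (xS (bS z x)) (liftS z y).
    by rewrite formSC formS_xS dual_coord_lift [RHS]formSC formS_xS dual_coord_lift.
  rewrite e1 -(dS_lift zs y) dS_parts /zs dS_affine -/zs.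
  apply: etrans _ (esym (oI_sub _ _)); rewrite (dS_parts z (liftS z x) (liftS z y)).
  rewrite -opprD -oI_add; congr (- oI _).
  rewrite dS_lift -e2 /formS mulmxDl mxtraceD mulrDr; congr (_ + _).
  by rewrite -scalemxAl mxtraceZ mulrCA.
have [f1 Hf] : pc (fun s => formS K (liftS (fun i => z i + cS s * w i) y)) (formS K (liftS z y)).
  rewrite /formS; apply: pcM; first exact: pc_cst.
  have P i j : pc (fun s => K i j * liftS (fun i => z i + cS s * w i) y j i)
      (K i j * liftS z y j i) by apply: pcM; [exact: pc_cst | exact: pc_lift].
  have sumP (I : Type) (r : seq I) (F : I -> CR -> S) (F0 : I -> S) :
      (forall i, pc (F i) (F0 i)) -> pc (fun s => \sum_(i <- r) F i s) (\sum_(i <- r) F0 i).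
    move=> HF; elim: r => [|i r IH].
      by rewrite big_nil; under eq_fun do rewrite big_nil; exact: pc_cst.
    by rewrite big_cons; under eq_fun do rewrite big_cons; exact: pcD.
  rewrite /mxtrace; apply: (sumP _ _) => i; rewrite mxE.
  by under eq_fun do rewrite mxE; apply: (sumP _ _) => j; exact: P.
have Hs : pcurve (fun s => - (cS s * 1)) 0 (- 1).
  have := pcurve_affine 0 (-1 : S); rewrite (_ : (fun s => _) = (fun s => - (cS s * 1))) //.
  by apply/funext => s; rewrite add0r mulrN.
have := pcurve_is_derive (pcurveD (pcurve_cst (formS (liftS z x) (dS z (liftS z y)))) (pcurveM Hs Hf)).
rewrite mul0r addr0 add0r mulN1r raddfN /= -/K.
by under eq_fun do rewrite mulr1 mulNr -E.
Qed.

(** Existence is [dS_lift] with [dual_coord_lift]; uniqueness is [lift_zero] for the difference. *)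
Lemma lift_exists (q xi : R -> 'rV[CR]_5) : mxloop q -> mxloop xi ->
  exists! A : R -> 'M[CR]_4, is_lift q xi A.
Proof.
move=> /mxloopP[z ->] /mxloopP[x ->]; exists (mloop (liftS z x)).
split=> [|A HA]; first exact: is_lift_liftS.
have [lA _ _ _] := HA; have [M AE] := mxloop4P lA; rewrite AE in HA *.
have [tr0 cfM [b Hb]] := (is_liftP z x M).1 HA.
congr mloop; apply/eqP; rewrite eq_sym -subr_eq0; apply/eqP.
apply: (@lift_zero R z _ (fun i => b i - bS z x i)).
- by rewrite raddfB /= tr0 tr_lift subrr.
- apply/funext => i; have e j : dual_coord M j = dual_coord (liftS z x) j by rewrite cfM dual_coord_lift.
  move: (liftS z x) e => N e; rewrite /dual_coord !mxE.
  move: (e 0) (e 1) (e 2) (e 3) (e 4); rewrite /dual_coord !ord5E ![nth _ _ _]/= => e0 e1 e2 e3 e4.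
  move: i; apply: ord5P; rewrite ord5E [nth _ _ _]/=.
  + apply/eqP; rewrite -[X in _ == X](subrr (h2 * (M 0 1 + M 1 2))) {2}e0; apply/eqP; ring.
  + apply/eqP; rewrite -[X in _ == X](subrr (h2 * h2 * (cS (r3 R) * (M 0 0 + M 1 1 + M 2 2 - 3 * M 3 3)))) {2}e1; apply/eqP; ring.
  + by rewrite e2 subrr.
  + apply/eqP; rewrite -[X in _ == X](subrr (h2 * (M 3 2 + M 0 3))) {2}e3; apply/eqP; ring.
  + apply/eqP; rewrite -[X in _ == X](subrr (h2 * (M 0 3 - M 3 2))) {2}e4; apply/eqP; ring.
- have -> : xS (fun i => b i - bS z x i) = xS b - xS (bS z x).
    by rewrite /xS /qgen m4B; congr m4; ring.
  rewrite -Hb -dS_lift /dS map_mxB mulmxBr mulmxBl.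
  by move: (map_mx _ _) (map_mx _ _) (_ *m _) (_ *m _) (_ *m _) (_ *m _) => *;
     apply/matrixP => i j; rewrite !mxE; ring.
Qed.

Lemma liftE (z x : 'I_5 -> S) : lift (rowl z) (rowl x) = mloop (liftS z x).
Proof.
have [A [HA uA]] := lift_exists (mxloop_rowl z) (mxloop_rowl x).
rewrite -(uA _ (is_lift_liftS z x)); apply/esym/uA.
exact: (@xgetPex _ (fun=> 0) [set B | is_lift (rowl z) (rowl x) B] (ex_intro _ A HA)).
Qed.

(** The bracket of the W-algebra is the pairing of the gradient of one functional with the
    components of D_q applied to the lift of the other. *)
Lemma W_local_form : is_W_local_form (@Wop R).
Proof.
split; first exact: Wop_local.
move=> F I /lfuncP[e He] /lfuncP[e' He'] q /mxloopP[z ->].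
rewrite (pbracketE z (@Wop_op R) He He') pair_bS /Wbracket (vder_grad z He) (vder_grad z He') !liftE.
congr oint; apply/funext => t.
by rewrite mxd_mloop -mloop_qS /lie_br -!mloopM -mloopB -mloopD formSE.
Qed.

End WPoisson.

(** * Reduction to N *)

Section Reduction.
Variable R : realType.
Local Notation CR := (CC R).
Local Notation S := (sloop R).
Local Notation cS := (@cS R).
Local Notation Dx := (@Dx R).
Local Notation oI := (@oI R).

(** The bracket of Q restricted to N: the Dirac reduction is trivial by [W_mixed0]. *)
Definition PN : lbracket R 3 := fun a b k J => @Wop R (lshift 2 a) (lshift 2 b) k (inclN J).

Lemma inclN_r (J : jet R 3) k (i : 'I_2) : inclN J k 0 (rshift 3 i) = 0.
Proof. by apply: etrans (@row_mxEr _ 1 3 2 (J k) 0 0 i) _; rewrite mxE. Qed.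

Lemma inclN_l (J : jet R 3) k (i : 'I_3) : inclN J k 0 (lshift 2 i) = J k 0 i.
Proof. exact: (@row_mxEl _ 1 3 2 (J k) 0 0 i). Qed.

Lemma inclN_E (J : jet R 3) k : [/\ inclN J k 0 0 = J k 0 0, inclN J k 0 1 = J k 0 1,
  inclN J k 0 2 = J k 0 2, inclN J k 0 3 = 0 & inclN J k 0 4 = 0].
Proof.
split.
- by rewrite (_ : (0 : 'I_5) = lshift 2 (0 : 'I_3)) ?inclN_l //; apply: val_inj.
- by rewrite (_ : (1 : 'I_5) = lshift 2 (1 : 'I_3)) ?inclN_l //; apply: val_inj.
- by rewrite (_ : (2 : 'I_5) = lshift 2 (2 : 'I_3)) ?inclN_l //; apply: val_inj.
- by rewrite (_ : (3 : 'I_5) = rshift 3 (0 : 'I_2)) ?inclN_r //; apply: val_inj.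
- by rewrite (_ : (4 : 'I_5) = rshift 3 (1 : 'I_2)) ?inclN_r //; apply: val_inj.
Qed.

(** Every term of a mixed coefficient in the table has a factor z_4 or z_5, or a derivative of one
    of them. *)
Lemma W_mixed0 (a : 'I_3) (al : 'I_2) k J :
  @Wop R (lshift 2 a) (rshift 3 al) k (inclN J) = 0
  /\ @Wop R (rshift 3 al) (lshift 2 a) k (inclN J) = 0.
Proof.
rewrite /Wop.
have H3 k' : inclN J k' 0 3 = 0 by case: (inclN_E J k').
have H4 k' : inclN J k' 0 4 = 0 by case: (inclN_E J k').
by move: a al => [[|[|[|//]]] ?] [[|[|//]] ?] /=; rewrite ?nth_nil //; split; rewrite ?nth_nil //;
  move: k => [|[|[|k]]] /=; rewrite ?H3 ?H4 ?nth_nil //; ring.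
Qed.

Lemma PN_dirac : is_dirac_reduction (@Wop R) PN.
Proof. by split=> // a al k J; case: (W_mixed0 a al k J). Qed.

Lemma PN_high (a b : 'I_3) k : (5 < k)%N -> PN a b k = (fun=> 0).
Proof. by move=> k5; apply/funext => J; rewrite /PN Wop_high. Qed.

Lemma PN_local : is_local PN.
Proof.
split; last by exists 5%N; exact: PN_high.
move=> a b k; rewrite /PN; have [/(_ (lshift 2 a) (lshift 2 b) k) H _] := Wop_local R.
elim: H => {a b k} [c|k i|f g _ IHf _ IHg|f g _ IHf _ IHg]; last 2 first.
- exact: dpoly_add.
- exact: dpoly_mul.
- exact: dpoly_const.
- case: (@split_ordP 3 2 i) => j ->.
    by under eq_fun do rewrite inclN_l; exact: dpoly_var.
  by under eq_fun do rewrite inclN_r; exact: dpoly_const.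
Qed.

Definition incl (v : 'I_3 -> S) : 'I_5 -> S :=
  fun i => match @fintype.split 3 2 i with inl j => v j | inr _ => 0 end.

Lemma incl_l v (i : 'I_3) : incl v (lshift 2 i) = v i.
Proof.
rewrite /incl; case: split_ordP => j e; first by rewrite (lshift_inj e).
by move/eqP: e; rewrite eq_lrshift.
Qed.

Lemma incl_r v (i : 'I_2) : incl v (rshift 3 i) = 0.
Proof. by rewrite /incl; case: split_ordP => j e //; move/eqP: e; rewrite eq_rlshift. Qed.

Definition opN (z x : 'I_3 -> S) : 'I_3 -> S := fun i => bS (incl z) (incl x) (lshift 2 i).

Lemma jet_incl z t : jet_of (rowl (incl z)) t = inclN (jet_of (rowl z) t).
Proof.
apply/funext => k; apply/rowP => i; rewrite [LHS]mxd_rowl; case: (@split_ordP 3 2 i) => j ->.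
  by rewrite incl_l inclN_l [RHS]mxd_rowl.
by rewrite incl_r inclN_r iterDx0.
Qed.

Lemma PN_op : is_op PN opN.
Proof.
move=> z x; apply/funext => t; apply/rowP => a.
have e : lop (@Wop R) (rowl (incl z)) (rowl (incl x)) t 0 (lshift 2 a) =
    lval (bS (incl z) (incl x) (lshift 2 a)) t by rewrite Wop_op mxE.
rewrite [RHS]mxE /opN -e (lop_rowl _ _ _ _ PN_high) (lop_rowl _ _ _ _ (@Wop_high R)).
rewrite (@big_split_ord _ _ _ 3 2) /= [X in _ = _ + X]big1 ?addr0; last first.
  move=> i _; rewrite big1 // => k _; rewrite jet_incl; case: (W_mixed0 a i k (jet_of (rowl z) t)) => -> _.
  by rewrite mul0r.
apply: eq_bigr => b _; apply: eq_bigr => k _; rewrite jet_incl incl_l //.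
Qed.

(** Hamiltonian vector fields of functionals extended from N are tangent to N. *)
Lemma op_incl z x : bS (incl z) (incl x) = incl (opN z x).
Proof.
apply/funext => i; case: (@split_ordP 3 2 i) => j ->; first by rewrite incl_l.
rewrite incl_r; apply: sloop_eq => t.
have <- : lop (@Wop R) (rowl (incl z)) (rowl (incl x)) t 0 (rshift 3 j) =
    lval (bS (incl z) (incl x) (rshift 3 j)) t by rewrite Wop_op mxE.
rewrite (lop_rowl _ _ _ _ (@Wop_high R)).
rewrite big1 // => b _; rewrite big1 // => k _; rewrite jet_incl; case: (@split_ordP 3 2 b) => c ->.
  by case: (W_mixed0 c j k (jet_of (rowl z) t)) => _ ->; rewrite mul0r.
by rewrite incl_r iterDx0 mulr0.
Qed.

Lemma pair_incl x v : pair (incl x) v = pair x (fun i => v (lshift 2 i)).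
Proof.
congr oI; rewrite (@big_split_ord _ _ _ 3 2) /= [X in _ + X]big1 ?addr0.
  by apply: eq_bigr => i _; rewrite incl_l.
by move=> i _; rewrite incl_r mul0r.
Qed.

Lemma incl_affine z w s : incl (fun i => z i + cS s * w i) = (fun i => incl z i + cS s * incl w i).
Proof.
apply/funext => i; case: (@split_ordP 3 2 i) => j ->; first by rewrite !incl_l.
by rewrite !incl_r mulr0 addr0.
Qed.

(** By tangency [op_incl], the Jacobi identity on the loops in N is the one on Q. *)
Lemma PN_poissonL : poissonL PN.
Proof.
apply: (@poissonL_crit _ _ _ opN PN_local PN_op _
  (fun z x y w => W_var (incl z) (incl x) (incl y) (incl w))) => [z x y|z x y w|z x y w].
- by rewrite /opN -!pair_incl W_skew.
- have := W_var_derive (incl z) (incl x) (incl y) (incl w).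
  under eq_fun do rewrite -incl_affine pair_incl; exact.
- rewrite -!op_incl; exact: W_jac.
Qed.

End Reduction.

(** * The reduced bracket in the coordinates t *)

Section P2Table.
Variables (R : realType) (J : jet R 3).
Local Notation CR := (CC R).
Local Notation Z k i := (J k%N 0 i).

(** Table of {t_a, t_b}: the k-th entry is the coefficient of the k-th derivative of delta. *)
Definition P2tab (a b : nat) : seq CR :=
  match a, b with
  | 0%N, 0%N => [:: Z 1 0;
        2 * Z 0 0;
        0;
        - (1 / 2)]
  | 0%N, 1%N => [:: 0;
        Z 0 1]
  | 0%N, 2%N => [:: 2 / 3 * Z 3 1 + 2 * Z 1 2;
        2 * Z 2 1 + 3 * Z 0 2;
        2 * Z 1 1;
        2 / 3 * Z 0 1]
  | 1%N, 0%N => [:: Z 1 1;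
        Z 0 1]
  | 1%N, 1%N => [:: 0;
        - (3 / 2)]
  | 1%N, 2%N => [:: 2 * Z 1 0 - 4 * Z 0 1 * Z 1 1;
        2 * Z 0 0 - 2 * Z 0 1 ^+ 2]
  | 2%N, 0%N => [:: Z 1 2;
        3 * Z 0 2;
        0;
        2 / 3 * Z 0 1]
  | 2%N, 1%N => [:: 0;
        2 * Z 0 0 - 2 * Z 0 1 ^+ 2]
  | 2%N, 2%N => [:: - (1 / 6 * Z 3 0) - Z 0 1 * Z 3 1 - 4 * Z 0 1 * Z 1 2 - 1 / 3 * Z 1 1 * Z 2 1 - 4 * Z 1 1 * Z 0 2;
        - (3 / 4 * Z 2 0) - 19 / 6 * Z 0 1 * Z 2 1 - 8 * Z 0 1 * Z 0 2 - 1 / 2 * Z 1 1 ^+ 2;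
        - (5 / 4 * Z 1 0) - 7 / 2 * Z 0 1 * Z 1 1;
        - (5 / 6 * Z 0 0) - 7 / 6 * Z 0 1 ^+ 2;
        0;
        1 / 24]
  | _, _ => [::]
  end.

Definition P1tab (a b : nat) : seq CR :=
  match a, b with
  | 0%N, 0%N => [:: 0; 2]
  | 1%N, 2%N => [:: 0; 2]
  | 2%N, 1%N => [:: 0; 2]
  | 2%N, 2%N => [:: 0; 0; 0; - (5 / 6)]
  | _, _ => [::]
  end.

End P2Table.

Definition P2 (R : realType) : lbracket R 3 := fun a b k J => (P2tab J a b)`_k.
Definition P1 (R : realType) : lbracket R 3 := fun a b k J => (P1tab R a b)`_k.

Lemma derive1_horner (K : numFieldType) (f : K -> K) (p : {poly K}) x :
  (forall s, f s = p.[s]) -> derive1 f x = p^`().[x].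
Proof.
move=> H; rewrite (_ : f = horner p); last exact/funext.
by rewrite derive1E; case: (is_derive_horner p x).
Qed.

Lemma derive1_affine (K : numFieldType) (f : K -> K) (a b x : K) :
  (forall s, f s = a + s * b) -> derive1 f x = b.
Proof.
move=> H; rewrite (@derive1_horner _ _ (a%:P + b%:P * 'X)).
  by rewrite derivD derivC derivM derivX derivC mul0r !add0r mulr1 hornerC.
by move=> s; rewrite H !hornerE mulrC.
Qed.

Lemma ord3P (P : 'I_3 -> Prop) : P 0 -> P 1 -> P 2 -> forall i, P i.
Proof.
move=> p0 p1 p2 i; have : i \in [:: (0 : 'I_3); 1; 2] by move: i => [[|[|[|//]]] ?].
by rewrite !inE => /orP[/eqP ->|/orP[/eqP ->|/eqP ->]].
Qed.

Lemma sum3 (V : nmodType) (F : 'I_3 -> V) : \sum_i F i = F 0 + F 1 + F 2.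
Proof.
rewrite !big_ord_recl big_ord0 addr0 !addrA.
by congr (F _ + F _ + F _); apply: val_inj.
Qed.

Lemma ord3E : ((nat_of_ord (0%R : 'I_3) = 0%N) * (nat_of_ord (1%R : 'I_3) = 1%N) *
  (nat_of_ord (2%R : 'I_3) = 2%N))%type.
Proof. by []. Qed.

Lemma P2_high (R : realType) (a b : 'I_3) k : (5 < k)%N -> @P2 R a b k = (fun=> 0).
Proof.
move=> k5; apply/funext => J; rewrite /P2 nth_default //.
move: a b => [[|[|[|//]]] ?] [[|[|[|//]]] ?]; exact: leq_trans k5.
Qed.

Lemma P1_high (R : realType) (a b : 'I_3) k : (5 < k)%N -> @P1 R a b k = (fun=> 0).
Proof.
move=> k5; apply/funext => J; rewrite /P1 nth_default //.
move: a b => [[|[|[|//]]] ?] [[|[|[|//]]] ?]; exact: leq_trans k5.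
Qed.

Lemma P2_local (R : realType) : is_local (@P2 R).
Proof.
split; last by exists 5%N; exact: P2_high.
move=> a b k; rewrite /P2.
move: a b => [[|[|[|//]]] ?] [[|[|[|//]]] ?] /=;
  move: k => [|[|[|[|[|[|k]]]]]] /=; rewrite ?nth_nil; dpoly_tac.
Qed.

Lemma P1_local (R : realType) : is_local (@P1 R).
Proof. by split; [move=> a b k; exact: dpoly_const | exists 5%N; exact: P1_high]. Qed.

(** The bracket is affine in t_1. *)
Lemma lie_P2 (R : realType) : lb_lie 0 (@P2 R) = @P1 R.
Proof.
apply/funext => a; apply/funext => b; apply/funext => k; apply/funext => J.
rewrite /lb_lie; apply: (@derive1_affine _ _ (P2 a b k J)) => s; rewrite /P2 /P1.
move: a b => [[|[|[|//]]] ?] [[|[|[|//]]] ?] /=;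
  move: k => [|[|[|[|[|[|k]]]]]] /=; rewrite ?nth_nil ?mxE /=; try by field.
all: by rewrite ?mulr0 ?addr0.
Qed.

Lemma lie_P1 (R : realType) : lb_lie 0 (@P1 R) = (fun _ _ _ _ => 0).
Proof.
apply/funext => a; apply/funext => b; apply/funext => k; apply/funext => J.
rewrite /lb_lie; apply: (@derive1_affine _ _ (P1 a b k J)) => s.
by rewrite mulr0 addr0.
Qed.

Section Ops.
Variable R : realType.
Local Notation CR := (CC R).
Local Notation S := (sloop R).
Local Notation cS := (@cS R).
Local Notation Dx := (@Dx R).
Local Notation oI := (@oI R).
Local Notation d k f := (iter k%N Dx f).

(** The operators of the three brackets, term by term as in the tables, with d for the iterated
    derivative. *)
Definition op_N (t x : 'I_3 -> S) : 'I_3 -> S := fun i => nth 0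
  [:: d 1 (t 0) * x 0 + 2 * t 0 * d 1 (x 0) + (- (cS (1 / 2))) * d 3 (x 0) + 2 * d 1 (t 2) * x 2 + 3 * t 2 * d 1 (x 2);
    d 1 (x 1);
    d 1 (t 2) * x 0 + 3 * t 2 * d 1 (x 0) + (cS (8 / 3) * t 0 * d 1 (t 0) - cS (1 / 6) * d 3 (t 0)) * x 2 + (cS (8 / 3) * t 0 ^+ 2 - cS (3 / 4) * d 2 (t 0)) * d 1 (x 2) + (- (cS (5 / 4) * d 1 (t 0))) * d 2 (x 2) + (- (cS (5 / 6) * t 0)) * d 3 (x 2) + cS (1 / 24) * d 5 (x 2)] i.

Definition op_2 (t x : 'I_3 -> S) : 'I_3 -> S := fun i => nth 0
  [:: d 1 (t 0) * x 0 + 2 * t 0 * d 1 (x 0) + (- (cS (1 / 2))) * d 3 (x 0) + t 1 * d 1 (x 1) + (cS (2 / 3) * d 3 (t 1) + 2 * d 1 (t 2)) * x 2 + (2 * d 2 (t 1) + 3 * t 2) * d 1 (x 2) + 2 * d 1 (t 1) * d 2 (x 2) + cS (2 / 3) * t 1 * d 3 (x 2);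
    d 1 (t 1) * x 0 + t 1 * d 1 (x 0) + (- (cS (3 / 2))) * d 1 (x 1) + (2 * d 1 (t 0) - 4 * t 1 * d 1 (t 1)) * x 2 + (2 * t 0 - 2 * t 1 ^+ 2) * d 1 (x 2);
    d 1 (t 2) * x 0 + 3 * t 2 * d 1 (x 0) + cS (2 / 3) * t 1 * d 3 (x 0) + (2 * t 0 - 2 * t 1 ^+ 2) * d 1 (x 1) + (- (cS (1 / 6) * d 3 (t 0)) - t 1 * d 3 (t 1) - 4 * t 1 * d 1 (t 2) - cS (1 / 3) * d 1 (t 1) * d 2 (t 1) - 4 * d 1 (t 1) * t 2) * x 2 + (- (cS (3 / 4) * d 2 (t 0)) - cS (19 / 6) * t 1 * d 2 (t 1) - 8 * t 1 * t 2 - cS (1 / 2) * d 1 (t 1) ^+ 2) * d 1 (x 2) + (- (cS (5 / 4) * d 1 (t 0)) - cS (7 / 2) * t 1 * d 1 (t 1)) * d 2 (x 2) + (- (cS (5 / 6) * t 0) - cS (7 / 6) * t 1 ^+ 2) * d 3 (x 2) + cS (1 / 24) * d 5 (x 2)] i.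

Definition op_1 (x : 'I_3 -> S) : 'I_3 -> S := fun i => nth 0
  [:: 2 * d 1 (x 0); 2 * d 1 (x 2); 2 * d 1 (x 1) + (- cS (5 / 6)) * d 3 (x 2)] i.

Lemma is_op_2 : is_op (@P2 R) op_2.
Proof.
move=> z x; apply/funext => t; apply/rowP => a; rewrite (lop_rowl _ _ _ _ (@P2_high R)).
have E k i : jet_of (rowl z) t k 0 i = lval (iter k Dx (z i)) t by exact: jet_of_rowl.
rewrite [RHS]mxE; move: (jet_of (rowl z) t) E => J E.
rewrite sum3 !sum_nat6 /P2 /op_2.
move: a; apply: ord3P; rewrite !ord3E; cbn [P2tab nth iter]; rewrite ?E; cbn [iter].
all: rpush [:: z 0; z 1; z 2; x 0; x 1; x 2]; cbn [iter]; gen_lval; by field.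
Qed.

Lemma is_op_1 : is_op (@P1 R) (fun _ => op_1).
Proof.
move=> z x; apply/funext => t; apply/rowP => a; rewrite (lop_rowl _ _ _ _ (@P1_high R)).
rewrite [RHS]mxE sum3 !sum_nat6 /P1 /op_1.
move: a; apply: ord3P; rewrite !ord3E; cbn [P1tab nth iter].
all: rpush [:: z 0; z 1; z 2; x 0; x 1; x 2]; cbn [iter]; gen_lval; by field.
Qed.

Lemma opNE z x : opN z x = op_N z x.
Proof.
apply/funext => a; apply: sloop_eq => t.
have <- : lop (PN (R:=R)) (rowl z) (rowl x) t 0 a = lval (opN z x a) t by rewrite PN_op mxE.
rewrite (lop_rowl _ _ _ _ (@PN_high R)).
have E k i : jet_of (rowl z) t k 0 i = lval (iter k Dx (z i)) t by exact: jet_of_rowl.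
move: (jet_of (rowl z) t) E => J E.
have F0 k : inclN J k 0 0 = J k 0 0 by case: (inclN_E J k).
have F1 k : inclN J k 0 1 = J k 0 1 by case: (inclN_E J k).
have F2 k : inclN J k 0 2 = J k 0 2 by case: (inclN_E J k).
have third_tab k : inclN J k 0 3 = 0 by case: (inclN_E J k).
have F4 k : inclN J k 0 4 = 0 by case: (inclN_E J k).
rewrite sum3 !sum_nat6 /PN /Wop /op_N.
have L := (erefl : nat_of_ord (lshift 2 (0%R : 'I_3)) = 0%N, erefl : nat_of_ord (lshift 2 (1%R : 'I_3)) = 1%N,
  erefl : nat_of_ord (lshift 2 (2%R : 'I_3)) = 2%N).
move: a; apply: ord3P; rewrite !L !ord3E; cbn [Wtab nth iter]; rewrite ?(F0, F1, F2, third_tab, F4) ?E; cbn [iter].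
all: rpush [:: z 0; z 1; z 2; x 0; x 1; x 2]; cbn [iter]; gen_lval; by field.
Qed.

End Ops.

(** * The change of coordinates *)

Section Coordinates.
Variable R : realType.
Local Notation CR := (CC R).
Local Notation S := (sloop R).
Local Notation cS := (@cS R).
Local Notation Dx := (@Dx R).
Local Notation oI := (@oI R).

(** With this constant the coordinates t involve no other irrationality: t_2 = 3/2 kap z_2. *)
Definition kap : CR := 'i * sqrtC (2 / 3).

Lemma kapsq : kap ^+ 2 = - (2 / 3).
Proof. by rewrite /kap exprMn sqrCi sqrtCK mulN1r. Qed.

Lemma kap32 : 'i * sqrtC (3 / 2) = 3 / 2 * kap.
Proof.
have p (a b : nat) : 0 <= a%:R / b%:R :> CR by rewrite divr_ge0 ?ler0n.
rewrite /kap mulrCA; congr (_ * _); apply/eqP.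
rewrite -(eqrXn2 (n := 2)) ?sqrtC_ge0 ?mulr_ge0 ?sqrtC_ge0 ?p //.
by rewrite exprMn !sqrtCK; apply/eqP; field.
Qed.

Lemma tcoordE (z : 'rV[CR]_3) : tcoord z =
  row3 (z 0 0 + 1 / 2 * z 0 1 ^+ 2) (3 / 2 * kap * z 0 1)
       (z 0 2 - 4 / 3 * kap * z 0 1 ^+ 3 - 2 * kap * z 0 0 * z 0 1).
Proof.
by rewrite /tcoord kap32 /kap; congr row3; rewrite !mulrA.
Qed.

Definition tcoord_inv (t : 'rV[CR]_3) : 'rV[CR]_3 :=
  row3 (t 0 0 + 1 / 3 * t 0 1 ^+ 2) (- (kap * t 0 1))
       (t 0 2 - 16 / 27 * t 0 1 ^+ 3 + 4 / 3 * (t 0 0 + 1 / 3 * t 0 1 ^+ 2) * t 0 1).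

Lemma row3_eq (a b : 'rV[CR]_3) : a 0 0 = b 0 0 -> a 0 1 = b 0 1 -> a 0 2 = b 0 2 -> a = b.
Proof. by move=> e0 e1 e2; apply/rowP; apply: ord3P. Qed.

Lemma zcoordK : cancel tcoord_inv (@tcoord R).
Proof.
move=> t; rewrite tcoordE /tcoord_inv; apply: row3_eq; rewrite !mxE /=.
- by rewrite sqrrN exprMn kapsq; field.
- transitivity (- (3 / 2 * kap ^+ 2 * t 0 1)); first by field.
  by rewrite kapsq; field.
- move: (t 0 0) (t 0 1) (t 0 2) => a b c.
  transitivity (c - 16 / 27 * b ^+ 3 + 4 / 3 * (a + 1 / 3 * b ^+ 2) * b
     + 4 / 3 * kap ^+ 2 * kap ^+ 2 * b ^+ 3 + 2 * kap ^+ 2 * (a + 1 / 3 * b ^+ 2) * b); first by field.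
  by rewrite kapsq; field.
Qed.

Lemma tcoordK : cancel (@tcoord R) tcoord_inv.
Proof.
move=> z; rewrite tcoordE /tcoord_inv; apply: row3_eq; rewrite !mxE /=.
- transitivity (z 0 0 + 1 / 2 * z 0 1 ^+ 2 + 3 / 4 * kap ^+ 2 * z 0 1 ^+ 2); first by field.
  by rewrite kapsq; field.
- transitivity (- (3 / 2 * kap ^+ 2 * z 0 1)); first by field.
  by rewrite kapsq; field.
- move: (z 0 0) (z 0 1) (z 0 2) => a b c.
  transitivity (c - 4 / 3 * kap * b ^+ 3 - 2 * kap * a * b - 2 * kap ^+ 2 * kap * b ^+ 3
    + 4 / 3 * (a + 1 / 2 * b ^+ 2 + 3 / 4 * kap ^+ 2 * b ^+ 2) * (3 / 2 * kap * b)); first by field.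
  by rewrite kapsq; field.
Qed.

Lemma tcoord_bij : bijective (@tcoord R).
Proof. exact: Bijective tcoordK zcoordK. Qed.

(** The coordinates t as differential polynomials (of order 0) in z. *)
Definition tph (i : 'I_3) : dexp R 3 :=
  nth (DC 3 0) [::
    DA (DV R 0 0) (DP (DC 3 (cS (1 / 2))) (DP (DV R 0 1) (DV R 0 1)));
    DP (DC 3 (cS (3 / 2 * kap))) (DV R 0 1);
    DA (DA (DV R 0 2) (DP (DC 3 (- cS (4 / 3 * kap))) (DP (DV R 0 1) (DP (DV R 0 1) (DV R 0 1)))))
       (DP (DC 3 (- cS (2 * kap))) (DP (DV R 0 0) (DV R 0 1)))] i.

Lemma tcoord_rowl q : (fun x => tcoord (rowl q x)) = rowl (fun i => ev (tph i) q).
Proof.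
apply/funext => x; rewrite tcoordE; apply: row3_eq; rewrite !mxE /tph ?ord3E [nth _ _ _]/=;
  cbn [ev iter]; rewrite !lvalE //; by field.
Qed.

Lemma tph_surj t : exists q, t = (fun i => ev (tph i) q).
Proof.
have dz : exists q, rowl q = (fun x => tcoord_inv (rowl t x)).
  exists (fun i : 'I_3 => nth 0 [:: t 0 + cS (1 / 3) * (t 1 * t 1); - (cS kap * t 1);
    t 2 - cS (16 / 27) * (t 1 * (t 1 * t 1)) + cS (4 / 3) * (t 0 + cS (1 / 3) * (t 1 * t 1)) * t 1] i).
  apply/funext => x; rewrite /tcoord_inv; apply: row3_eq; rewrite !mxE ?ord3E [nth _ _ _]/= !lvalE [RHS]/=; by field.
have [q Hq] := dz; exists q; apply: rowl_inj; rewrite -tcoord_rowl Hq.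
by apply/funext => x; rewrite zcoordK.
Qed.

(** Transpose of the Jacobian matrix of the coordinates t. The variable z_2 enters only through
    u = kap z_2, which makes all coefficients rational. *)
Definition tJt1 (q x : 'I_3 -> S) : S :=
  - cS (3 / 2) * (cS kap * q 1) * x 0 + cS (3 / 2) * x 1
  + (6 * (cS kap * q 1) * (cS kap * q 1) - 2 * q 0) * x 2.
Definition tJt (q x : 'I_3 -> S) : 'I_3 -> S := fun i => nth 0
  [:: x 0 - 2 * (cS kap * q 1) * x 2; cS kap * tJt1 q x; x 2] i.

Lemma cSkap2 : cS kap * cS kap = - cS (2 / 3).
Proof. by rewrite -rmorphM -expr2 kapsq rmorphN. Qed.

Lemma tJt1E q x : cS kap * tJt1 q x =
  q 1 * x 0 + cS (3 / 2 * kap) * x 1 - cS kap * (4 * q 1 * q 1 + 2 * q 0) * x 2.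
Proof.
transitivity (- cS (3 / 2) * (cS kap * cS kap) * q 1 * x 0 + cS (3 / 2) * cS kap * x 1
  + cS kap * (6 * (cS kap * cS kap) * (q 1 * q 1) - 2 * q 0) * x 2); first by rewrite /tJt1; ring.
by rewrite cSkap2; apply: sloop_eq => t; rewrite !lvalE; field.
Qed.

Lemma tJtP q xi w : pair xi (fun i => ev (lin (tph i) w) q) = pair (tJt q xi) w.
Proof.
congr oI; rewrite !sum3 /tph /tJt tJt1E !ord3E ![nth _ _ _]/=; cbn [ev lin iter].
apply: sloop_eq => t; rewrite !lvalE; by field.
Qed.

(** In the variables z_1, u, z_3 this is an identity of differential polynomials with rational
    coefficients. *)
Lemma tJt_op q xi eta :
  pair (tJt q xi) (opN q (tJt q eta)) = pair xi (op_2 (fun i => ev (tph i) q) eta).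
Proof.
congr oI; rewrite opNE !sum3.
have -> : tJt q xi 1 * op_N q (tJt q eta) 1 = - cS (2 / 3) * (tJt1 q xi * Dx (tJt1 q eta)).
  by rewrite /op_N /tJt !ord3E [nth _ _ _]/= [nth _ _ _]/= DcSM -cSkap2; ring.
rewrite /op_N /op_2 /tJt /tJt1 !ord3E; cbn [nth iter].
have -> : ev (tph 0) q = q 0 - cS (3 / 4) * ((cS kap * q 1) * (cS kap * q 1)).
  rewrite (_ : (cS kap * q 1) * (cS kap * q 1) = cS kap * cS kap * (q 1 * q 1)); last by ring.
  rewrite cSkap2 /tph ord3E; cbn [nth ev iter].
  by apply: sloop_eq => t; rewrite !lvalE; field.
have -> : ev (tph 1) q = cS (3 / 2) * (cS kap * q 1).
  by rewrite /tph ord3E /= rmorphM mulrA.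
have -> : ev (tph 2) q = q 2 + 2 * ((cS kap * q 1) * ((cS kap * q 1) * (cS kap * q 1)))
    - 2 * (cS kap * q 1) * q 0.
  rewrite (_ : (cS kap * q 1) * ((cS kap * q 1) * (cS kap * q 1)) =
    cS kap * cS kap * cS kap * (q 1 * (q 1 * q 1))); last by ring.
  rewrite cSkap2 /tph ord3E; cbn [nth ev iter].
  by apply: sloop_eq => t; rewrite !lvalE; field.
move: (cS kap * q 1) => u.
apply: sloop_eq => t.
rpushl [:: q 0; u; q 2; xi 0; xi 1; xi 2; eta 0; eta 1; eta 2].
rpush [:: q 0; u; q 2; xi 0; xi 1; xi 2; eta 0; eta 1; eta 2].
cbn [rnorm rdiff rval nth iter].
gen_lval; by field.
Qed.

End Coordinates.

(** * The bihamiltonian structure *)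

Section Bihamiltonian.
Variable R : realType.
Local Notation CR := (CC R).
Local Notation S := (sloop R).
Local Notation cS := (@cS R).
Local Notation Dx := (@Dx R).
Local Notation oI := (@oI R).

Lemma P2_coordinates : lb_in_coordinates (@tcoord R) (@PN R) (@P2 R).
Proof.
exact: (lb_in_coordinates_op (@tcoord_rowl R) (@tJtP R) (@PN_op R) (@is_op_2 R) (@tJt_op R)).
Qed.

Lemma P2_poissonL : poissonL (@P2 R).
Proof.
apply: (poissonL_transfer (@tcoord_rowl R) (@tJtP R) (P2_local R) (@PN_op R) (@is_op_2 R)
  (@tJt_op R) (@tph_surj R)); exact: PN_poissonL.
Qed.

(** Translation of t_1 by l: since P_2 is affine in t_1, with derivative P_1, it carries P_2 to
    P_2 + l P_1. *)
Section Shift.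
Variable l : CR.

Definition shift1 (t : 'rV[CR]_3) : 'rV[CR]_3 := t - l *: delta_mx 0 0.

Definition sph (i : 'I_3) : dexp R 3 := DA (DV R 0 i) (DC 3 (if i == 0 then - cS l else 0)).

Lemma shift1_rowl q : (fun x => shift1 (rowl q x)) = rowl (fun i => ev (sph i) q).
Proof.
apply/funext => x; apply/rowP => i; rewrite !mxE /= eq_sym.
by case: (0 == i); rewrite ?mulr1 ?mulr0 ?oppr0.
Qed.

Lemma sphP q xi w : pair xi (fun i => ev (lin (sph i) w) q) = pair xi w.
Proof. by congr oI; apply: eq_bigr => i _ /=; rewrite addr0. Qed.

Lemma sph_surj t : exists q, t = (fun i => ev (sph i) q).
Proof.
exists (fun i => t i - (if i == 0 then - cS l else 0)).
by apply/funext => i /=; rewrite subrK.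
Qed.

Lemma sph_op q xi eta : pair xi (op_2 q eta) =
  pair xi (fun i => cS 1 * op_2 (fun i => ev (sph i) q) eta i + cS l * op_1 eta i).
Proof.
congr oI; apply: eq_bigr => i _; congr (_ * _); move: i.
have e0 : ev (sph 0) q = q 0 - cS l by [].
have e1 : ev (sph 1) q = q 1 + 0 by [].
have e2 : ev (sph 2) q = q 2 + 0 by [].
apply: ord3P; rewrite /op_2 /op_1 !ord3E e0 e1 e2 !addr0; cbn [nth iter].
all: apply: sloop_eq => t.
all: rpushl [:: q 0; q 1; q 2; eta 0; eta 1; eta 2].
all: rpush [:: q 0; q 1; q 2; eta 0; eta 1; eta 2].
all: cbn [rnorm rdiff rval nth iter]; gen_lval; by field.
Qed.

Lemma P2_shift_poissonL : poissonL (lb_comb 1 l (@P2 R) (@P1 R)).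
Proof.
apply: (poissonL_transfer shift1_rowl sphP (is_local_comb (P2_local R) (P1_local R) 1 l)
  (@is_op_2 R) (is_op_comb (P2_local R) (P1_local R) (@is_op_2 R) (@is_op_1 R) 1 l) sph_op sph_surj).
exact: P2_poissonL.
Qed.

End Shift.

Lemma pencil_poissonL c1 c2 : poissonL (lb_comb c1 c2 (@P2 R) (@P1 R)).
Proof.
exact: (poissonL_comb (P2_local R) (P1_local R) (@is_op_2 R) (@is_op_1 R) P2_shift_poissonL).
Qed.

(** Each P_2 + l P_1 is P_2 translated, hence Poisson; this gives all linear combinations. *)
Lemma bihamiltonian_P2_P1 : bihamiltonian (@P2 R) (@P1 R).
Proof.
have H c1 c2 : poisson (lb_comb c1 c2 (@P2 R) (@P1 R)).
  by apply: poisson_of_L (pencil_poissonL _ _); exact: is_local_comb (P2_local R) (P1_local R) _ _.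
split=> //.
- have := H 1 0; congr poisson; do 3 apply/funext => ?; apply/funext => J.
  by rewrite /lb_comb mul1r mul0r addr0.
- have := H 0 1; congr poisson; do 3 apply/funext => ?; apply/funext => J.
  by rewrite /lb_comb mul1r mul0r add0r.
Qed.

End Bihamiltonian.

(** * Leading terms *)

Section Leading.
Variable R : realType.
Local Notation CR := (CC R).

Lemma derive1n_horner (K : numFieldType) (p : {poly K}) k :
  derive1n k (horner p) = horner (derivn k p).
Proof.
elim: k => [|k IH]; first by rewrite derivn0.
rewrite derive1nS IH derivnS; apply/funext => x.
exact: (@derive1_horner _ _ (derivn k p)).
Qed.

(** The homogeneous components are the coefficients of the polynomial obtained by rescaling the
    jet. *)
Lemma hpart_poly n d (f : jet R n -> CR) J (p : {poly CR}) :
  (forall s : CR, f (fun k => s ^+ k *: J k) = p.[s]) -> hpart d f J = p`_d.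
Proof.
move=> H; rewrite /hpart (_ : (fun s : CR => _) = horner p); last exact/funext.
rewrite derive1n_horner horner_coef0 coef_derivn addn0 ffactnn -[X in _ * X]mulr_natr.
by rewrite mulrCA mulVf ?mulr1 // pnatr_eq0 -lt0n fact_gt0.
Qed.

Lemma lb_leadE n (P : lbracket R n) m t a b : lb_lead P m t a b = P a b m (cjet t).
Proof.
rewrite mxE /lb_part leqnn subnn /hpart derive1n0 invr1 mul1r; congr (P a b m _).
by apply/funext => -[|k] /=; rewrite ?expr0 ?scale1r // scaler0.
Qed.

Ltac ord3_cases := move=> [[|[|[|//]]] ?] [[|[|[|//]]] ?].

Lemma P2_displess : dispersionless_limit (@P2 R).
Proof.
move=> t; apply/matrixP => a b; rewrite lb_leadE mxE /P2; move: a b.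
by ord3_cases; rewrite /= ?mxE ?expr0n /=; ring.
Qed.

Lemma P1_displess : dispersionless_limit (@P1 R).
Proof.
move=> t; apply/matrixP => a b; rewrite lb_leadE mxE /P1; move: a b.
by ord3_cases.
Qed.

Lemma P2_lead1 t : lb_lead (@P2 R) 1 t = Omega2 t.
Proof.
apply/matrixP => a b; rewrite lb_leadE mxE /P2; move: a b.
by ord3_cases; rewrite /= ?mxE; ring.
Qed.

Lemma P2_lead2 t : lb_lead (@P2 R) 2 t = 0.
Proof.
apply/matrixP => a b; rewrite lb_leadE mxE /P2; move: a b.
by ord3_cases; rewrite /= ?mxE; ring.
Qed.

Lemma P2_lead3 t : lb_lead (@P2 R) 3 t = S22 t.
Proof.
apply/matrixP => a b; rewrite lb_leadE mxE /P2; move: a b.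
by ord3_cases; rewrite /= ?mxE; ring.
Qed.

Definition Om1 : 'M[CR]_3 := mx_of 3 3 [:: [:: 2; 0; 0]; [:: 0; 0; 2]; [:: 0; 2; 0]].
Definition S12 : 'M[CR]_3 := mx_of 3 3 [:: [:: 0; 0; 0]; [:: 0; 0; 0]; [:: 0; 0; - (5 / 6)]].

Lemma P1_lead1 t : lb_lead (@P1 R) 1 t = Om1.
Proof.
apply/matrixP => a b; rewrite lb_leadE mxE /P1; move: a b.
by ord3_cases.
Qed.

Lemma P1_lead3 t : lb_lead (@P1 R) 3 t = S12.
Proof.
apply/matrixP => a b; rewrite lb_leadE mxE /P1; move: a b.
by ord3_cases.
Qed.

(** The coefficients of a polynomial in s of known shape are recovered from its values at 0, 1, 2. *)
Lemma P2_part2 a b j J : lb_part (@P2 R) 2 a b j J = 0.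
Proof.
rewrite /lb_part; case: j => [|[|[|j]]] //.
- pose g (s : CR) := P2 a b 0%N (fun k => s ^+ k *: J k).
  pose c3 := (g 2 - 2 * g 1) / 6.
  rewrite (@hpart_poly _ _ _ _ ((g 1 - c3)%:P * 'X + c3%:P * 'X^3)).
    by rewrite coefD !coefCM coefX coefXn /= !mulr0 addr0.
  move=> s; rewrite !hornerE -/(g s) /c3 /g {c3 g} /P2; move: a b.
  by ord3_cases; rewrite /= ?mxE; field.
- pose g (s : CR) := P2 a b 1%N (fun k => s ^+ k *: J k).
  rewrite (@hpart_poly _ _ _ _ ((g 0)%:P + (g 1 - g 0)%:P * 'X^2)).
    by rewrite coefD coefC coefCM coefXn /= mulr0 addr0.
  move=> s; rewrite !hornerE -/(g s) /g {g} /P2; move: a b.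
  by ord3_cases; rewrite /= ?mxE ?expr0n /=; field.
- rewrite /hpart derive1n0 fact0 invr1 mul1r /P2; move: a b.
  by ord3_cases; rewrite /= ?mxE ?expr0n /=; ring.
Qed.

Lemma P1_part2 a b j J : lb_part (@P1 R) 2 a b j J = 0.
Proof.
have H d : hpart d (@P1 R a b j) J = (@P1 R a b j J)%:P`_d.
  by apply: hpart_poly => s; rewrite hornerC.
rewrite /lb_part H; case: j {H} => [|[|[|j]]] //; rewrite coefC //= /P1; move: a b.
by ord3_cases.
Qed.

End Leading.

(** * Polynomial functions *)

Section PolyFun.
Variables (R : realType) (n : nat).
Local Notation CR := (CC R).

(** Polynomials in n variables as syntax: partial derivatives are computed by [pdif]. *)
Inductive pexp := PC (c : CR) | PV (i : 'I_n) | PA (a b : pexp) | PM (a b : pexp).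

Fixpoint pev (e : pexp) (t : 'rV[CR]_n) : CR :=
  match e with
  | PC c => c
  | PV i => t 0 i
  | PA a b => pev a t + pev b t
  | PM a b => pev a t * pev b t
  end.

Fixpoint pdif (i : 'I_n) (e : pexp) : pexp :=
  match e with
  | PC _ => PC 0
  | PV j => PC (i == j)%:R
  | PA a b => PA (pdif i a) (pdif i b)
  | PM a b => PA (PM (pdif i a) b) (PM a (pdif i b))
  end.

Lemma pev_differentiable e t : differentiable (pev e) t.
Proof.
elim: e => [c|i|a Ha b Hb|a Ha b Hb]; [exact: differentiable_cst|exact: differentiable_coord| |].
- exact: differentiableD.
- exact: differentiableM.
Qed.

Lemma pd_pev i e t : pd i (pev e) t = pev (pdif i e) t.
Proof.
have H : is_derive t (delta_mx 0 i) (pev e) (pev (pdif i e) t); last by case: H.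
elim: e => [c|j|a Ha b Hb|a Ha b Hb] /=.
- exact: is_derive_cst.
- apply: DeriveDef; first exact/diff_derivable/differentiable_coord.
  by apply: derive_affine => h; rewrite !mxE eqxx /= addrK eq_sym.
- exact: is_deriveD.
- apply: is_derive_eq (is_deriveM Ha Hb) _; rewrite /GRing.scale /= addrC; congr (_ + _).
  by rewrite mulrC.
Qed.

Lemma pd_near i (f g : 'rV[CR]_n -> CR) t : {near t, f =1 g} -> pd i f t = pd i g t.
Proof. by move=> fg; exact: near_eq_derive. Qed.

End PolyFun.

(** * Flatness of a contravariant metric *)

(** Levi-Civita connection of the metric G inverse to O with dO/dt_k = Gam_k + Gam_k^T, in
    matrix form. Here Gam_k has entries Gam^{ij}_k; S says that the connection
    - G Gam is torsion free. It is kept apart from the analysis, over an abstract field. *)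
Section MatrixAlgebra.
Variables (K : numFieldType) (n : nat) (O G : 'M[K]_n) (Gam : 'I_n -> 'M[K]_n).
Hypothesis GT : G^T = G.
Hypothesis OG : O *m G = 1%:M.
Hypothesis S : forall a b m, (G *m Gam a) m b = (G *m Gam m) a b.

Lemma chris_algebra i j k :
  2^-1 * \sum_l O k l * (- (G *m (Gam i + (Gam i)^T) *m G) l j
     + - (G *m (Gam j + (Gam j)^T) *m G) l i - - (G *m (Gam l + (Gam l)^T) *m G) i j)
  = - (G *m Gam i) j k.
Proof.
have sumO a (M : 'M[K]_n) b : \sum_l O a l * (G *m M) l b = M a b.
  by have := congr1 (fun M : 'M[K]_n => M a b) (mul1mx M); rewrite -OG -mulmxA mxE.
have key l : (G *m (Gam l + (Gam l)^T) *m G) i j =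
    (G *m (Gam i *m G)) l j + (G *m (Gam j *m G)) l i.
  rewrite mulmxDr mulmxDl mxE; congr (_ + _).
    by rewrite mulmxA mxE [RHS]mxE; apply: eq_bigr => m _; congr (_ * _); exact: S l m i.
  have -> : G *m (Gam l)^T *m G = (G *m Gam l *m G)^T.
    by rewrite !trmx_mul GT mulmxA.
  by rewrite mxE mulmxA mxE [RHS]mxE; apply: eq_bigr => m _; congr (_ * _); exact: S l m j.
have dist m l a : (G *m (Gam m + (Gam m)^T) *m G) l a =
    (G *m (Gam m *m G)) l a + (G *m ((Gam m)^T *m G)) l a.
  by rewrite mulmxDr mulmxDl mxE !mulmxA.
have TG m a b : ((Gam m)^T *m G) a b = (G *m Gam m) b a.
  by rewrite -{1}GT -trmx_mul mxE.
transitivity (2^-1 * - (((Gam i)^T *m G) k j + ((Gam j)^T *m G) k i)).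
  congr (_ * _); rewrite -(sumO k _ j) -(sumO k _ i) -big_split /= -sumrN; apply: eq_bigr => l _.
  rewrite (key l) (dist i l j) (dist j l i).
  move: ((G *m (Gam i *m G)) l j) ((G *m (Gam j *m G)) l i) ((G *m ((Gam i)^T *m G)) l j) ((G *m ((Gam j)^T *m G)) l i) (O k l) => x1 x2 x3 x4 o.
  by ring.
rewrite (TG i k j) (TG j k i) (S i k j); move: ((G *m Gam i) j k) => x; by field.
Qed.

(** The quadratic terms of the curvature combine with the derivative of G in G Gam. *)
Lemma riemann_algebra (D : 'I_n -> 'I_n -> 'M[K]_n) i j k l :
  (forall a b, ((Gam i)^T *m G *m Gam j - (Gam j)^T *m G *m Gam i) a b = (D i j - D j i) a b) ->
  (G *m (Gam i + (Gam i)^T) *m G *m Gam j - G *m D i j) k l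
  - (G *m (Gam j + (Gam j)^T) *m G *m Gam i - G *m D j i) k l
  + ((G *m Gam j *m (G *m Gam i)) k l - (G *m Gam i *m (G *m Gam j)) k l) = 0.
Proof.
move=> /matrixP C; have {C} := congr1 (fun M => (G *m M) k l) C.
have AE (A B : 'M[K]_n) : (A + B) k l = A k l + B k l by rewrite mxE.
have NE (A : 'M[K]_n) : (- A) k l = - A k l by rewrite mxE.
rewrite !mulmxBr !mulmxA !(mulmxDr, mulmxDl) !AE !NE.
move: (_ k l) (_ k l) (_ k l) (_ k l) => x1 x2 x3 x4 /eqP.
rewrite -subr_eq0 => /eqP {}C; apply: etrans C; ring.
Qed.

(** Multiplying by O and using S turns the curvature condition with inverse matrices into one
    that is polynomial in O and Gam. *)
Lemma curv_algebra (D : 'I_n -> 'I_n -> 'M[K]_n) :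
  (forall p j a b, \sum_m (Gam m p a * Gam j m b - Gam m p b * Gam j m a)
     = \sum_i O p i * (D i j a b - D j i a b)) ->
  forall i j a b, ((Gam i)^T *m G *m Gam j - (Gam j)^T *m G *m Gam i) a b
     = D i j a b - D j i a b.
Proof.
move=> H i j a b.
have GO : G *m O = 1%:M by exact: mulmx1C.
have OGam p m c : \sum_k O p k * (G *m Gam m) k c = Gam m p c.
  by have := congr1 (fun M : 'M[K]_n => M p c) (mul1mx (Gam m)); rewrite -OG -mulmxA mxE.
have half k l c d : ((Gam k)^T *m G *m Gam l) c d = \sum_m (G *m Gam m) k c * Gam l m d.
  rewrite mxE; apply: eq_bigr => m _; congr (_ * _).
  by rewrite -{1}GT -trmx_mul mxE S.
pose x i : K := ((Gam i)^T *m G *m Gam j - (Gam j)^T *m G *m Gam i) a b.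
have xE p : \sum_k O p k * x k = \sum_k O p k * (D k j a b - D j k a b).
  rewrite -H sumrB.
  rewrite (eq_bigr (fun k => \sum_m O p k * (G *m Gam m) k a * Gam j m b
      - \sum_m O p k * (G *m Gam m) k b * Gam j m a)); last first.
    move=> k _; rewrite /x mxE [X in _ * (_ + X)]mxE (half k j a b).
    have -> : ((Gam j)^T *m G *m Gam k) a b = \sum_m (G *m Gam m) k b * Gam j m a.
      have tr : ((Gam k)^T *m G *m Gam j)^T = (Gam j)^T *m G *m Gam k.
        by rewrite !trmx_mul trmxK GT mulmxA.
      by rewrite -(half k j b a) -tr mxE.
    by rewrite mulrBr !mulr_sumr; congr (_ - _); apply: eq_bigr => m _; rewrite mulrA.
  rewrite sumrB; congr (_ - _); rewrite exchange_big; apply: eq_bigr => m _;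
    by rewrite -mulr_suml OGam.
have X f g : (forall p, \sum_k O p k * f k = \sum_k O p k * g k) -> f i = g i :> K.
  move=> fg; have E : O *m (\col_k f k) = O *m (\col_k g k).
    apply/colP => p; rewrite !mxE.
    under eq_bigr do rewrite mxE; under [RHS]eq_bigr do rewrite mxE; exact: fg.
  have := congr1 (fun M => (G *m M) i 0) E.
  by rewrite !mulmxA GO !mul1mx !mxE.
exact: (X x (fun k => D k j a b - D j k a b)).
Qed.
End MatrixAlgebra.

(** For fixed l the matrix N of entries Gam^(al)_m satisfies N O = O N^T; multiplied by G on both
    sides, this says that G N is symmetric. *)
Lemma sym_algebra (K : numFieldType) n (O G : 'M[K]_n) (Gam : 'I_n -> 'M[K]_n) :
  G^T = G -> O *m G = 1%:M ->
  (forall l a b, \sum_m Gam m a l * O m b = \sum_m O a m * Gam m b l) ->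
  forall a b m, (G *m Gam a) m b = (G *m Gam m) a b.
Proof.
move=> GT OG H a b m.
pose N := \matrix_(p, j) Gam j p b.
have GN p q : (G *m Gam p) q b = (G *m N) q p.
  by rewrite !mxE; apply: eq_bigr => k _; rewrite mxE.
have GO : G *m O = 1%:M by exact: mulmx1C.
have NO : N *m O = O *m N^T.
  apply/matrixP => p q; rewrite !mxE.
  by under eq_bigr do rewrite mxE; rewrite H; apply: eq_bigr => k _; rewrite !mxE.
have NT : (G *m N)^T = G *m N.
  rewrite trmx_mul GT -[LHS]mul1mx -GO -!mulmxA (mulmxA O) -NO -!mulmxA OG mulmx1 //.
by rewrite !GN -{1}NT mxE.
Qed.

Section Flat.
Variables (R : realType) (n : nat).
Local Notation CR := (CC R).
Local Notation V := 'rV[CR]_n.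

Lemma differentiable_prod (I : Type) (r : seq I) (F : I -> V -> CR) t :
  (forall i, differentiable (F i) t) -> differentiable (fun s => \prod_(i <- r) F i s) t.
Proof.
move=> HF; elim: r => [|i r IH].
  by under eq_fun do rewrite big_nil; exact: differentiable_cst.
by under eq_fun do rewrite big_cons; exact: differentiableM.
Qed.

Lemma differentiable_bsum (I : Type) (r : seq I) (F : I -> V -> CR) t :
  (forall i, differentiable (F i) t) -> differentiable (fun s => \sum_(i <- r) F i s) t.
Proof.
move=> HF; elim: r => [|i r IH].
  by under eq_fun do rewrite big_nil; exact: differentiable_cst.
by under eq_fun do rewrite big_cons; exact: differentiableD.
Qed.

Lemma differentiable_det m (A : V -> 'M[CR]_m) t :
  (forall i j, differentiable (fun s => A s i j) t) -> differentiable (fun s => \det (A s)) t.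
Proof.
move=> HA; rewrite /determinant; apply: differentiable_bsum => p.
apply: differentiableM; first exact: differentiable_cst.
exact: differentiable_prod.
Qed.

(** Dubrovin's form of the flatness equations. If Gam^{ij}_k satisfies the metric condition [pdOm],
    the symmetry [symGam] and the curvature condition [curvGam], all polynomial when Om and Gam are,
    then it is the contravariant Levi-Civita connection of Om and the curvature vanishes wherever
    Om is invertible. *)
Section Crit.
Variables (Om : tensor2 R n) (Gam : 'I_n -> tensor2 R n).
Hypothesis OmT : forall t, (Om t)^T = Om t.
Hypothesis dOm : forall i j t, differentiable (fun s => Om s i j) t.
Hypothesis dGam : forall k i j t, differentiable (fun s => Gam k s i j) t.
Hypothesis pdOm : forall k i j t, pd k (fun s => Om s i j) t = Gam k t i j + Gam k t j i.
Hypothesis symGam : forall t l a b,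
  \sum_m Gam m t a l * Om t m b = \sum_m Om t a m * Gam m t b l.
Hypothesis curvGam : forall t p j a b,
  \sum_m (Gam m t p a * Gam j t m b - Gam m t p b * Gam j t m a)
  = \sum_i Om t p i * (pd i (fun s => Gam j s a b) t - pd j (fun s => Gam i s a b) t).

(** Cramer's formula for the inverse, which is differentiable by construction. *)
Let adj_inv (t : V) : 'M[CR]_n := (\det (Om t))^-1 *: \adj (Om t).

Lemma unit_near t : Om t \in unitmx -> \forall s \near t, Om s \in unitmx.
Proof.
rewrite unitmxE unitfE => d0.
have cd : {for t, continuous (fun s => \det (Om s))}.
  exact/differentiable_continuous/differentiable_det.
have : \forall x \near \det (Om t), x != 0.
  apply/nbhs_ballP; exists `|\det (Om t)| => /= [|x]; first by rewrite normr_gt0.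
  by rewrite /ball /= => h; apply/eqP => x0; move: h; rewrite x0 subr0 ltxx.
move=> /cd H; near=> s; rewrite unitmxE unitfE; near: s; exact: H.
Unshelve. all: by end_near.
Qed.

Lemma adj_invE t : Om t \in unitmx -> invmx (Om t) = adj_inv t.
Proof. by move=> u; rewrite /invmx u. Qed.

Lemma adj_inv_diff t i j : Om t \in unitmx -> differentiable (fun s => adj_inv s i j) t.
Proof.
move=> u; under eq_fun do rewrite mxE.
apply: differentiableM.
  apply: differentiableV; first exact: differentiable_det.
  by rewrite -unitfE -unitmxE.
under eq_fun do rewrite mxE /cofactor.
apply: differentiableM; first exact: differentiable_cst.
apply: differentiable_det => a b; under eq_fun do rewrite !mxE; exact: dOm.
Qed.

Lemma is_derive_of_diff (f : V -> CR) t i : differentiable f t ->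
  is_derive t (delta_mx 0 i) f (pd i f t).
Proof. by move=> H; apply: DeriveDef => //; exact: diff_derivable. Qed.

Lemma pd_sum (I : Type) (r : seq I) (F : I -> V -> CR) k t :
  (forall i, differentiable (F i) t) ->
  pd k (fun s => \sum_(i <- r) F i s) t = \sum_(i <- r) pd k (F i) t.
Proof.
move=> HF; elim: r => [|i r IH].
  rewrite big_nil /pd; under eq_fun do rewrite big_nil.
  exact: derive_cst.
rewrite big_cons -IH /pd; under eq_fun do rewrite big_cons.
by apply: deriveD; apply: diff_derivable => //; exact: differentiable_bsum.
Qed.

Lemma pdM (f g : V -> CR) k t : differentiable f t -> differentiable g t ->
  pd k (fun s => f s * g s) t = pd k f t * g t + f t * pd k g t.
Proof.
move=> Hf Hg; have [_ E] := is_deriveM (is_derive_of_diff k Hf) (is_derive_of_diff k Hg).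
by apply: etrans E _; rewrite /GRing.scale /= addrC; congr (_ + _); exact: mulrC.
Qed.

Definition dmat (A : V -> 'M[CR]_n) k t : 'M[CR]_n := \matrix_(i, j) pd k (fun s => A s i j) t.

Lemma dmatE A k t i j : dmat A k t i j = pd k (fun s => A s i j) t.
Proof. by rewrite mxE. Qed.

Lemma dmatM (A B : V -> 'M[CR]_n) k t :
  (forall i j, differentiable (fun s => A s i j) t) ->
  (forall i j, differentiable (fun s => B s i j) t) ->
  dmat (fun s => A s *m B s) k t = dmat A k t *m B t + A t *m dmat B k t.
Proof.
move=> HA HB; apply/matrixP => i j; rewrite dmatE.
rewrite (_ : (fun s => _) = (fun s => \sum_m A s i m * B s m j)); last first.
  by apply/funext => s; rewrite mxE.
rewrite pd_sum => [|m]; last exact: differentiableM.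
apply: etrans (eq_bigr _ (fun m _ => pdM k (HA i m) (HB m j))) _.
rewrite big_split /= mxE; congr (_ + _); rewrite [RHS]mxE; apply: eq_bigr => m _.
  by congr (_ * _); exact: esym (dmatE A k t i m).
by congr (_ * _); exact: esym (dmatE B k t m j).
Qed.

Lemma dmat_near (A B : V -> 'M[CR]_n) k t :
  (\forall s \near t, A s = B s) -> dmat A k t = dmat B k t.
Proof.
move=> AB; apply/matrixP => i j.
refine (etrans (dmatE A k t i j) (etrans (@pd_near R n k _ _ t _) (esym (dmatE B k t i j)))).
by near=> s; congr (fun_of_matrix _ i j); near: s.
Unshelve. all: by end_near.
Qed.

Lemma dmat_cst (A : 'M[CR]_n) k t : dmat (fun=> A) k t = 0.
Proof. by apply/matrixP => i j; rewrite !mxE; exact: derive_cst. Qed.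

Lemma dmat_inv k t : Om t \in unitmx ->
  dmat (fun s => invmx (Om s)) k t = - (invmx (Om t) *m (Gam k t + (Gam k t)^T) *m invmx (Om t)).
Proof.
move=> u; have un := unit_near u.
have -> : dmat (fun s => invmx (Om s)) k t = dmat adj_inv k t.
  by apply: dmat_near; apply: filterS un => s; exact: adj_invE.
have dO : dmat Om k t = Gam k t + (Gam k t)^T.
  by apply/matrixP => i j; rewrite !mxE pdOm.
have := @dmatM Om adj_inv k t (fun i j => dOm i j t) (fun i j => adj_inv_diff i j u).
rewrite (@dmat_near _ (fun=> 1%:M)); last first.
  by apply: filterS un => s us; rewrite -adj_invE // mulmxV.
rewrite dmat_cst dO -adj_invE // => /esym/eqP; rewrite addrC addr_eq0 => /eqP e.
rewrite -[LHS]mul1mx -(mulVmx u) -[LHS]mulmxA.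
by move: e => ->; rewrite mulmxN mulmxA.
Qed.

Lemma invT t : (invmx (Om t))^T = invmx (Om t).
Proof. by rewrite trmx_inv OmT. Qed.

Lemma symG t : Om t \in unitmx -> forall a b m,
  (invmx (Om t) *m Gam a t) m b = (invmx (Om t) *m Gam m t) a b.
Proof.
by move=> u; apply: (@sym_algebra CR n (Om t) _ (Gam^~ t)); [exact: invT|exact: mulmxV|exact: symGam].
Qed.

Lemma chrisE t : Om t \in unitmx -> forall k i j,
  chris Om k i j t = - (invmx (Om t) *m Gam i t) j k.
Proof.
move=> u k i j; rewrite /chris; set G := invmx (Om t).
have dG m a b : pd m (fun s => invmx (Om s) a b) t = - (G *m (Gam m t + (Gam m t)^T) *m G) a b.
  refine (etrans (esym (dmatE _ m t a b)) (etrans (congr1 (fun M : 'M[CR]_n => M a b) (dmat_inv m u)) _)).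
  by rewrite mxE.
under eq_bigr => l _ do rewrite (dG i l j) (dG j l i) (dG l i j).
apply: chris_algebra; [exact: invT|exact: mulmxV|].
exact: symG.
Qed.

Lemma contra_chrisE t : Om t \in unitmx -> forall i j k, contra_chris Om i j k t = Gam k t i j.
Proof.
move=> u i j k; rewrite /contra_chris -sumrN.
transitivity ((Om t *m (invmx (Om t) *m Gam k t)) i j); last by rewrite mulmxA mulmxV // mul1mx.
by rewrite mxE; apply: eq_bigr => m _; rewrite chrisE // mulrN opprK (symG u).
Qed.

Lemma riemann0 t : Om t \in unitmx -> forall l k i j, riemann Om l k i j t = 0.
Proof.
move=> u l k i j; set G := invmx (Om t).
have un := unit_near u.
have D a b c d : pd a (chris Om b c d) t =
    (G *m (Gam a t + (Gam a t)^T) *m G *m Gam c t - G *m dmat (Gam c) a t) d b.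
  rewrite (@pd_near _ _ _ _ (fun s => - (adj_inv s *m Gam c s) d b)); last first.
    by apply: filterS un => s us; rewrite chrisE // adj_invE.
  have dd : differentiable (fun s => (adj_inv s *m Gam c s) d b) t.
    under eq_fun do rewrite mxE.
    by apply: differentiable_bsum => m; apply: differentiableM => //; exact: adj_inv_diff.
  rewrite /pd deriveN; last exact: diff_derivable.
  have -> : 'D_(delta_mx 0 a) (fun s => (adj_inv s *m Gam c s) d b) t =
     dmat (fun s => adj_inv s *m Gam c s) a t d b by rewrite mxE.
  rewrite (@dmatM adj_inv (Gam c) a t (fun i j => adj_inv_diff i j u) (fun i j => dGam c i j t)).
  rewrite -(@dmat_near (fun s => invmx (Om s))); last first.
    by apply: filterS un => s; exact: adj_invE.
  rewrite dmat_inv // -adj_invE // -/G mulNmx !mxE; ring.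
have P a b : \sum_m (chris Om l a m t * chris Om m b k t) = (G *m Gam b t *m (G *m Gam a t)) k l.
  by rewrite [RHS]mxE; apply: eq_bigr => m _; rewrite !chrisE // mulrNN mulrC.
have Z := @riemann_algebra CR n G (Gam^~ t) (fun i j => dmat (Gam j) i t) i j k l.
pose sb (x y : CR) := x - y.
rewrite /riemann sumrB.
refine (etrans (f_equal2 +%R (f_equal2 sb (D i l j k) (D j l i k)) (f_equal2 sb (P i j) (P j i))) (Z _)).
move=> a b.
rewrite (@curv_algebra CR n (Om t) G (Gam^~ t) (invT t) (mulmxV u) (symG u)
  (fun i j => dmat (Gam j) i t)).
  by rewrite [RHS]mxE [X in _ = _ + X]mxE.
move=> p q c d; apply: etrans (curvGam t p q c d) _.
by apply: eq_bigr => m _; congr (_ * _); congr (_ - _); apply/esym; exact: dmatE.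
Qed.

End Crit.
End Flat.

(** * The flat pencil *)

Lemma det3 (K : comNzRingType) (A : 'M[K]_3) : \det A =
  A 0 0 * (A 1 1 * A 2 2 - A 1 2 * A 2 1)
  - A 0 1 * (A 1 0 * A 2 2 - A 1 2 * A 2 0)
  + A 0 2 * (A 1 0 * A 2 1 - A 1 1 * A 2 0).
Proof.
rewrite (expand_det_row _ 0) !big_ord_recl big_ord0 /cofactor.
do 3! rewrite (expand_det_row _ 0) !big_ord_recl big_ord0 /cofactor !det_mx11 /=.
rewrite !mxE.
pose f (a b : nat) := A (inord a) (inord b).
have E i j : A i j = f i j by rewrite /f !inord_val.
rewrite !E /= /bump /=; by ring.
Qed.

Section Dense.
Variables (R : realType) (n : nat).
Local Notation CR := (CC R).

(** A nonzero polynomial cannot vanish at more points eps/2, eps/3, ... than its degree allows. *)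
Lemma small_nonroot (p : {poly CR}) (eps : CR) : p != 0 -> 0 < eps ->
  exists2 s, `|s| < eps & p.[s] != 0.
Proof.
move=> p0 e0; apply: contrapT => H.
(* size p points exceed the degree *)
pose rs := [seq eps / k.+2%:R | k <- iota 0 (size p)].
have urs : uniq rs.
  rewrite map_inj_uniq ?iota_uniq // => k l /(mulfI (lt0r_neq0 e0)) /invr_inj /eqP.
  by rewrite eqr_nat => /eqP [].
have ars : all (root p) rs.
  apply/allP => s /mapP [k _ ->]; apply/negPn/negP => nr; apply: H; exists (eps / k.+2%:R) => //.
  rewrite ger0_norm ?divr_ge0 ?(ltW e0) // ltr_pdivrMr ?ltr0n // ltr_pMr // ltr1n //.
by have := max_poly_roots p0 ars urs; rewrite size_map size_iota ltnn.
Qed.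

(** Restriction of a polynomial to the line through t with direction v. *)
Fixpoint pline (t v : 'rV[CR]_n) (e : pexp R n) : {poly CR} :=
  match e with
  | PC c => c%:P
  | PV i => (t 0 i)%:P + v 0 i *: 'X
  | PA a b => pline t v a + pline t v b
  | PM a b => pline t v a * pline t v b
  end.

Lemma plineE t v e s : (pline t v e).[s] = pev e (t + s *: v).
Proof.
elim: e => [c|i|a Ha b Hb|a Ha b Hb] /=; rewrite ?hornerC ?hornerD ?hornerM ?Ha ?Hb //.
by rewrite hornerC hornerZ hornerX !mxE mulrC.
Qed.

Lemma open_neq0 (f : 'rV[CR]_n -> CR) : (forall t, {for t, continuous f}) ->
  open [set t | f t != 0].
Proof.
move=> dual_coord; rewrite openE => t /= f0.
have H : \forall x \near f t, x != 0.
  apply/nbhs_ballP; exists `|f t| => /= [|x]; first by rewrite normr_gt0.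
  by rewrite /ball /= => h; apply/eqP => x0; move: h; rewrite x0 subr0 ltxx.
have cH := dual_coord t _ H.
by near=> s; near: s; exact: cH.
Unshelve. all: by end_near. Qed.

Lemma open_pev e : open [set t : 'rV[CR]_n | pev e t != 0].
Proof. by apply: open_neq0 => t; exact/differentiable_continuous/pev_differentiable. Qed.

(** Restrict to a line through a point where the polynomial does not vanish. *)
Lemma dense_pev (e : pexp R n) (w : 'rV[CR]_n) : pev e w != 0 ->
  dense [set t : 'rV[CR]_n | pev e t != 0].
Proof.
move=> w0 O [t Ot] oO.
have p0 : pline t (w - t) e != 0.
  apply/eqP => p0; have := plineE t (w - t) e 1.
  by rewrite p0 horner0 scale1r addrC subrK => /esym/eqP; exact/negP.
have /nbhs_ballP [eps /= e0 He] := open_nbhs_nbhs (conj oO Ot).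
have N0 : 0 < `|w - t| + 1 :> CR by rewrite ltr_wpDl.
have [s se ps] := small_nonroot p0 (divr_gt0 e0 N0).
exists (t + s *: (w - t)); split; last by rewrite /= -plineE.
apply: He; rewrite -ball_normE /= opprD addNKr normrN normrZ.
apply: le_lt_trans (_ : `|s| * (`|w - t| + 1) < eps); last by rewrite -ltr_pdivlMr.
by rewrite ler_wpM2l // lerDl.
Qed.
End Dense.

Section Pencil.
Variable R : realType.
Local Notation CR := (CC R).

Let v0 : pexp R 3 := @PV R 3 0.
Let v1 : pexp R 3 := @PV R 3 1.
Let v2 : pexp R 3 := @PV R 3 2.
Let c (x : CR) : pexp R 3 := @PC R 3 x.

(** Entries of Omega_2 + lam Omega_1, that is of Omega_2 with t_1 replaced by t_1 + lam (d
    below). The Christoffel symbols are those of Omega_2 for every lam, because they do not depend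
    on t_1. *)
Definition Om_tab (lam : CR) : seq (seq (pexp R 3)) :=
  let d := PA v0 (c lam) in
  let m := PA (PM (c 2) d) (PM (c (-2)) (PM v1 v1)) in
  [:: [:: PM (c 2) d; v1; PM (c 3) v2];
      [:: v1; c (- (3 / 2)); m];
      [:: PM (c 3) v2; m; PM (c (-8)) (PM v1 v2)]].

(** The k-th block is the matrix of Gam^{ij}_k of Omega_2. *)
Definition Gam_tab : seq (seq (seq (pexp R 3))) :=
  let z := c 0 in
  [:: [:: [:: c 1; z; z]; [:: z; z; c 2]; [:: z; z; z]];
      [:: [:: z; z; z]; [:: c 1; z; PM (c (-4)) v1]; [:: z; z; PM (c (-4)) v2]];
      [:: [:: z; z; c 2]; [:: z; z; z]; [:: c 1; z; PM (c (-4)) v1]]].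

Definition Om_lam (lam : CR) (t : 'rV[CR]_3) : 'M[CR]_3 :=
  \matrix_(i, j) pev (nth (c 0) (nth [::] (Om_tab lam) i) j) t.
Definition Gam_lam (k : 'I_3) (t : 'rV[CR]_3) : 'M[CR]_3 :=
  \matrix_(i, j) pev (nth (c 0) (nth [::] (nth [::] Gam_tab k) i) j) t.

Lemma Om_lamE lam t : Om_lam lam t = Omega2 t + lam *: Om1 R.
Proof.
apply/matrixP => i j; rewrite !mxE.
by move: i j => [[|[|[|//]]] ?] [[|[|[|//]]] ?] /=; rewrite ?mxE /=; ring.
Qed.

Lemma Om_lamT lam t : (Om_lam lam t)^T = Om_lam lam t.
Proof.
apply/matrixP => i j; rewrite !mxE.
by move: i j => [[|[|[|//]]] ?] [[|[|[|//]]] ?].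
Qed.

Lemma Om_lam_diff lam i j t : differentiable (fun s => Om_lam lam s i j) t.
Proof. by under eq_fun do rewrite mxE; exact: pev_differentiable. Qed.

Lemma Gam_lam_diff k i j t : differentiable (fun s => Gam_lam k s i j) t.
Proof. by under eq_fun do rewrite mxE; exact: pev_differentiable. Qed.

Lemma Gam_lam_pd k l i j t : pd l (fun s => Gam_lam k s i j) t =
   pev (pdif l (nth (c 0) (nth [::] (nth [::] Gam_tab k) i) j)) t.
Proof. by rewrite -pd_pev; congr (pd _ _ _); apply/funext => s; rewrite mxE. Qed.

Lemma Om_lam_pd lam k i j t : pd k (fun s => Om_lam lam s i j) t = Gam_lam k t i j + Gam_lam k t j i.
Proof.
rewrite (_ : (fun s => _) = pev (nth (c 0) (nth [::] (Om_tab lam) i) j)); last first.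
  by apply/funext => s; rewrite mxE.
rewrite pd_pev !mxE.
by move: k i j => [[|[|[|//]]] ?] [[|[|[|//]]] ?] [[|[|[|//]]] ?] /=; ring.
Qed.

Lemma Om_lam_sym lam t l a b :
  \sum_m Gam_lam m t a l * Om_lam lam t m b = \sum_m Om_lam lam t a m * Gam_lam m t b l.
Proof.
rewrite !sum3 !mxE.
move: l a b => [[|[|[|//]]] ?] [[|[|[|//]]] ?] [[|[|[|//]]] ?] /=.
all: by field.
Qed.

Lemma Om_lam_curv lam t p j a b :
  \sum_m (Gam_lam m t p a * Gam_lam j t m b - Gam_lam m t p b * Gam_lam j t m a)
  = \sum_i Om_lam lam t p i * (pd i (fun s => Gam_lam j s a b) t - pd j (fun s => Gam_lam i s a b) t).
Proof.
under [RHS]eq_bigr do rewrite !Gam_lam_pd.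
rewrite !sum3 !mxE.
move: p j a b => [[|[|[|//]]] ?] [[|[|[|//]]] ?] [[|[|[|//]]] ?] [[|[|[|//]]] ?] /=.
all: by field.
Qed.

Lemma P2_lead1_lam t : lb_lead (@P2 R) 1 t = Om_lam 0 t.
Proof. by rewrite Om_lamE scale0r addr0 P2_lead1. Qed.

Lemma Om_lam_det lam : exists e : pexp R 3, forall t, \det (Om_lam lam t) = pev e t.
Proof.
pose d := PA v0 (c lam).
pose m := PA (PM (c 2) d) (PM (c (-2)) (PM v1 v1)).
pose n e := PM (c (-1)) e.
exists (PA (PM (PM (c 2) d) (PA (PM (c (- (3 / 2))) (PM (c (-8)) (PM v1 v2))) (n (PM m m))))
  (PA (n (PM v1 (PA (PM v1 (PM (c (-8)) (PM v1 v2))) (n (PM m (PM (c 3) v2))))))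
      (PM (PM (c 3) v2) (PA (PM v1 m) (n (PM (c (- (3 / 2))) (PM (c 3) v2))))))) => t.
rewrite det3 !mxE /=; by field.
Qed.

Lemma Om_lam_metric lam : contra_metric (Om_lam lam).
Proof.
split; [exact: Om_lamT|exact: Om_lam_diff|].
have [e He] := Om_lam_det lam.
exists [set t | pev e t != 0]; split; first exact: open_pev.
  apply: (@dense_pev _ _ _ (row3 (-lam) 0 1)).
  rewrite -He.
  have -> : \det (Om_lam lam (row3 (- lam) 0 1)) = 27 / 2 by rewrite det3 !mxE /= !mxE /=; field.
  by rewrite mulf_neq0 ?invr_eq0 ?pnatr_eq0.
by move=> t /=; rewrite -He unitmxE unitfE.
Qed.

Lemma Om_lam_flat lam : flat_metric (Om_lam lam).
Proof.
split; first exact: Om_lam_metric.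
exact: (riemann0 (Om_lamT lam) (Om_lam_diff lam) Gam_lam_diff (Om_lam_pd lam) (Om_lam_sym lam) (Om_lam_curv lam)).
Qed.

Lemma Om_lam_contra_chris lam t : Om_lam lam t \in unitmx ->
  forall i j k, contra_chris (Om_lam lam) i j k t = Gam_lam k t i j.
Proof.
exact: (contra_chrisE (Om_lamT lam) (Om_lam_diff lam) (Om_lam_pd lam) (Om_lam_sym lam)).
Qed.

Lemma Om1_unit : Om1 R \in unitmx.
Proof.
have d : \det (Om1 R) = - 8 by rewrite det3 !mxE /=; ring.
by rewrite unitmxE unitfE d oppr_eq0 pnatr_eq0.
Qed.

Lemma chris_cst k i j t : chris (fun=> Om1 R) k i j t = 0.
Proof.
rewrite /chris big1 ?mulr0 // => l _.
have Z a b m : pd a (fun=> invmx (Om1 R) b m) t = 0 by exact: derive_cst.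
by rewrite !Z addr0 subr0 mulr0.
Qed.

Lemma Om1_flat : flat_metric (fun=> Om1 R).
Proof.
split.
  split=> [t|i j t|].
  - by apply/matrixP => i j; rewrite !mxE; move: i j => [[|[|[|//]]] ?] [[|[|[|//]]] ?].
  - exact: differentiable_cst.
  - exists setT; split=> [| |t _]; [exact: openT| |exact: Om1_unit].
    by move=> O [t Ot] _; exists t.
move=> t _ l k i j; rewrite /riemann big1 ?addr0 => [|m _]; last first.
  by rewrite !chris_cst !mul0r subrr.
have Z a b m s : pd a (chris (fun=> Om1 R) l b m) s = 0.
  rewrite (_ : chris _ l b m = fun=> 0); last by apply/funext => x; exact: chris_cst.
  exact: derive_cst.
by rewrite !Z subrr.
Qed.

(** All metrics of the pencil satisfy the flatness equations with the same
    Christoffel symbols, and those of the constant metric Omega_1 are 0. *)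
Lemma flat_pencil_Omega : flat_pencil (Om_lam 0) (fun=> Om1 R).
Proof.
split; [exact: Om_lam_flat|exact: Om1_flat|exists [::] => lam _ /=].
have -> : (fun t => Om_lam 0 t + lam *: Om1 R) = Om_lam lam.
  by apply/funext => t; rewrite !Om_lamE scale0r addr0.
split; first exact: Om_lam_flat.
move=> t u2 u1; move=> ul i j k.
have ul' : Om_lam lam t \in unitmx by move: ul; rewrite !Om_lamE !scale0r addr0.
rewrite (Om_lam_contra_chris u2) (Om_lam_contra_chris ul').
rewrite /contra_chris big1 ?oppr0 ?mulr0 ?addr0 // => m _.
by rewrite chris_cst mulr0.
Qed.

End Pencil.

(** * Quasihomogeneity *)

Section LieFacts.
Variable R : realType.
Local Notation CR := (CC R).

Lemma app_vfE n (X : vfield R n) (e : pexp R n) t :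
  app_vf X (pev e) t = \sum_i X t 0 i * pev (pdif i e) t.
Proof. by apply: eq_bigr => i _; rewrite pd_pev. Qed.

(** Lie derivative when the field and the tensor have polynomial components. *)
Lemma lie2E n (X : vfield R n) (Om : tensor2 R n) (x : 'I_n -> pexp R n) (o : 'I_n -> 'I_n -> pexp R n) :
  (forall t i, X t 0 i = pev (x i) t) -> (forall t i j, Om t i j = pev (o i j) t) ->
  forall t, lie2 X Om t = \matrix_(i, j) (\sum_k pev (x k) t * pev (pdif k (o i j)) t
     - \sum_k pev (o k j) t * pev (pdif k (x i)) t
     - \sum_k pev (o i k) t * pev (pdif k (x j)) t).
Proof.
move=> HX HO t; apply/matrixP => i j; rewrite !mxE.
have fX k : (fun s => X s 0 k) = pev (x k) by apply/funext.
have fO k l : (fun s => Om s k l) = pev (o k l) by apply/funext.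
rewrite fO app_vfE; congr (_ - _ - _); apply: eq_bigr => k _.
- by rewrite HX.
- by rewrite HO fX pd_pev.
- by rewrite HO fX pd_pev.
Qed.

Let cst (c : CR) : pexp R 3 := @PC R 3 c.
Definition e_tab : 'I_3 -> pexp R 3 := fun i => nth (cst 0) [:: cst 1] i.
Definition E_tab : 'I_3 -> pexp R 3 := fun i =>
  nth (cst 0) [:: PV R 0; PM (cst (1 / 2)) (PV R 1); PM (cst (3 / 2)) (PV R 2)] i.
Definition O_tab (i j : 'I_3) : pexp R 3 := nth (cst 0) (nth [::] (Om_tab (0 : CR)) i) j.
Definition O1_tab (i j : 'I_3) : pexp R 3 := cst (Om1 R i j).

Definition unit_field : vfield R 3 := fun=> delta_mx 0 0.
Definition euler_field : vfield R 3 := fun t => (1 / 2) *: row 0 (Om_lam 0 t).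

Lemma unit_fieldE t i : unit_field t 0 i = pev (e_tab i) t.
Proof. by rewrite mxE eqxx /=; move: i => [[|[|[|//]]] ?]. Qed.

Lemma euler_fieldE t i : euler_field t 0 i = pev (E_tab i) t.
Proof. by rewrite !mxE; move: i => [[|[|[|//]]] ?] /=; field. Qed.

Lemma O_tabE t i j : Om_lam 0 t i j = pev (O_tab i j) t.
Proof. by rewrite mxE. Qed.

Lemma lie_e_O2 : lie2 unit_field (Om_lam 0) = fun=> Om1 R.
Proof.
apply/funext => t; rewrite (lie2E unit_fieldE O_tabE); apply/matrixP => i j.
rewrite mxE !sum3 [RHS]mxE.
by move: i j => [[|[|[|//]]] ?] [[|[|[|//]]] ?] /=; ring.
Qed.

Lemma lie_e_O1 : lie2 unit_field (fun=> Om1 R) = fun=> 0.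
Proof.
apply/funext => t; rewrite (@lie2E _ unit_field _ _ O1_tab unit_fieldE) //; apply/matrixP => i j.
rewrite mxE !sum3 [RHS]mxE.
by move: i j => [[|[|[|//]]] ?] [[|[|[|//]]] ?] /=; ring.
Qed.

Lemma lie_E_O2 : lie2 euler_field (Om_lam 0) = fun t => (0 - 1) *: Om_lam 0 t.
Proof.
apply/funext => t; rewrite (lie2E euler_fieldE O_tabE); apply/matrixP => i j.
rewrite mxE !sum3 [RHS]mxE O_tabE.
by move: i j => [[|[|[|//]]] ?] [[|[|[|//]]] ?] /=; field.
Qed.

Lemma bracket_e_E : vf_bracket unit_field euler_field = unit_field.
Proof.
apply/funext => t; apply/rowP => j; rewrite mxE.
have -> : (fun s => euler_field s 0 j) = pev (E_tab j) by apply/funext => s; exact: euler_fieldE.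
have -> : (fun s => unit_field s 0 j) = pev (e_tab j) by apply/funext => s; exact: unit_fieldE.
rewrite !app_vfE !sum3 !unit_fieldE.
by move: j => [[|[|[|//]]] ?] /=; field.
Qed.

(** The function tau is t_1 / 2. *)
Lemma quasihomogeneous_Omega : quasihomogeneous (Om_lam 0) (fun=> Om1 R) 0 unit_field euler_field.
Proof.
pose tau : pexp R 3 := PM (cst (1 / 2)) (PV R 0).
exists (pev tau); split; first by move=> t; exact: pev_differentiable.
split=> [t i|].
  by rewrite euler_fieldE sum3 !pd_pev !O_tabE; move: i => [[|[|[|//]]] ?] /=; field.
split=> [t i|].
  by rewrite unit_fieldE sum3 !pd_pev !mxE; move: i => [[|[|[|//]]] ?] /=; field.
split; first exact: bracket_e_E.
split; first exact: lie_E_O2.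
by split; [exact: lie_e_O2|exact: lie_e_O1].
Qed.

Lemma regularity_tensor_diag t :
  regularity_tensor (fun=> Om1 R) 0 euler_field t = diag_mx (row3 (1 / 2) 0 1).
Proof.
apply/matrixP => i j; rewrite mxE [X in _ + X]big1 => [|m _]; last by rewrite chris_cst mul0r.
have -> : (fun s => euler_field s 0 j) = pev (E_tab j) by apply/funext => s; exact: euler_fieldE.
rewrite pd_pev !mxE.
by move: i j => [[|[|[|//]]] ?] [[|[|[|//]]] ?] /=; rewrite ?mulr1n ?mulr0n; field.
Qed.

(** Leading term of the reduced bracket in the coordinates z. *)
Definition N_tab (i j : 'I_3) : pexp R 3 := nth (cst 0) (nth [::]
  [:: [:: PM (cst 2) (PV R 0); cst 0; PM (cst 3) (PV R 2)];
      [:: cst 0; cst 1; cst 0];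
      [:: PM (cst 3) (PV R 2); cst 0; PM (cst (8 / 3)) (PM (PV R 0) (PV R 0))]] i) j.

Lemma PN_lead1 (z : 'rV[CR]_3) i j : lb_lead (@PN R) 1 z i j = pev (N_tab i j) z.
Proof.
rewrite lb_leadE /PN /Wop.
have [z0 z1 z2 z3 z4] := inclN_E (cjet z) 0.
have [d0 d1 d2 d3 d4] := inclN_E (cjet z) 2.
move: i j => [[|[|[|//]]] ?] [[|[|[|//]]] ?]; rewrite /= ?z0 ?z1 ?z2 ?z3 ?z4 ?d0 /= ?mxE; by field.
Qed.

(** Only the two corner entries 3 z_3 depend on z_3, so the middle row of the derivative is 0. *)
Lemma lie_z3_degenerate (z : 'rV[CR]_3) :
  \det (lie2 (fun=> delta_mx 0 2) (lb_lead (@PN R) 1) z) = 0.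
Proof.
pose x (i : 'I_3) : pexp R 3 := nth (cst 0) [:: cst 0; cst 0; cst 1] i.
rewrite (@lie2E _ _ _ x N_tab _ PN_lead1); last first.
  by move=> t i; rewrite mxE eqxx /=; move: i => [[|[|[|//]]] ?].
by rewrite det3 !mxE !sum3 /=; field.
Qed.

Lemma derive_pev n (v t : 'rV[CR]_n) e : 'D_v (pev e) t = \sum_i v 0 i * pev (pdif i e) t.
Proof.
have d := pev_differentiable e t.
rewrite deriveE // {1}(row_sum_delta v) linear_sum; apply: eq_bigr => i _.
by rewrite linearZ -pd_pev /pd deriveE.
Qed.

Definition t_tab (i : 'I_3) : pexp R 3 :=
  let k := kap R in
  nth (cst 0) [:: PA (PV R 0) (PM (cst (1 / 2)) (PM (PV R 1) (PV R 1)));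
    PM (cst ('i * sqrtC (3 / 2))) (PV R 1);
    PA (PV R 2) (PA (PM (cst (- (4 / 3) * k)) (PM (PV R 1) (PM (PV R 1) (PV R 1))))
      (PM (cst (- 2 * k)) (PM (PV R 0) (PV R 1))))] i.

Lemma tcoord_tab (w : 'rV[CR]_3) i : tcoord w 0 i = pev (t_tab i) w.
Proof.
rewrite mxE; move: i => [[|[|[|//]]] ?] /=; rewrite /kap; by field.
Qed.

Lemma efield_tcoord (z : 'rV[CR]_3) i :
  'D_(efield z) (fun w => tcoord w 0 i) z = unit_field (tcoord z) 0 i.
Proof.
have -> : (fun w => tcoord w 0 i) = pev (t_tab i) by apply/funext => w; exact: tcoord_tab.
rewrite derive_pev unit_fieldE sum3 !mxE.
move: i => [[|[|[|//]]] ?] /=; rewrite /kap; by field.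
Qed.

End LieFacts.

(** * Derivative of the complex logarithm *)

Section LogDerivative.
Variable R : realType.
Local Notation CR := (CC R).

Lemma derive_err (f : R -> R) (l : R) : is_derive (0 : R) (1 : R) f l ->
  forall eps, 0 < eps -> exists2 d, 0 < d &
    forall x, `|x| < d -> `|f x - f 0 - x * l| <= eps * `|x|.
Proof.
move=> [df fE] eps e0.
have : h^-1 *: ((f \o shift 0) (h *: (1 : R)) - f 0) @[h --> 0^'] --> l.
  by rewrite -fE; exact: df.
move=> /cvgrPdist_le /(_ _ e0) /nbhs_ballP [d /= d0 Hd].
exists d => // x xd; have [->|x0] := eqVneq x 0.
  by rewrite mul0r !subrr normr0 mulr0.
have := Hd x; rewrite /ball /= sub0r normrN => /(_ xd x0).
rewrite addr0 /GRing.scale /= mulr1 => H.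
have -> : f x - f 0 - x * l = - (x * (l - x^-1 * (f x - f 0))).
  by rewrite mulrBr mulVKf // opprB.
by rewrite normrN normrM mulrC ler_wpM2r.
Qed.

(** The modulus as a real number: estimates are made over the reals, which are totally ordered. *)
Definition cmod (z : CR) : R := Num.sqrt (complex.Re z ^+ 2 + complex.Im z ^+ 2).

Lemma normE (z : CR) : `|z| = (cmod z)%:C%C.
Proof. exact: (normc_def z). Qed.

Lemma leCE (x y : R) : ((x%:C%C : CR) <= y%:C%C) = (x <= y).
Proof. exact: lecR. Qed.

Lemma ltCE (x y : R) : ((x%:C%C : CR) < y%:C%C) = (x < y).
Proof. exact: ltcR. Qed.

Lemma cmod_le z : cmod z <= `|complex.Re z| + `|complex.Im z|.
Proof.
rewrite /cmod; move: (complex.Re z) (complex.Im z) => x y.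
rewrite -[leRHS]ger0_norm ?addr_ge0 // -[X in _ <= X]sqrtr_sqr; apply: ler_wsqrtr; rewrite sqrrD !real_normK ?num_real //.
by rewrite addrAC lerDl mulrn_wge0 // mulr_ge0.
Qed.

Lemma cmod_ge_Re z : `|complex.Re z| <= cmod z.
Proof. by rewrite -sqrtr_sqr; apply: ler_wsqrtr; rewrite lerDl sqr_ge0. Qed.

Lemma cmod_ge_Im z : `|complex.Im z| <= cmod z.
Proof. by rewrite -sqrtr_sqr; apply: ler_wsqrtr; rewrite lerDr sqr_ge0. Qed.

(** The complex derivative of exp at 0 is 1, from the derivatives of exp, cos and sin on the
    real line: with h = x + i y, the error is e^x (cos y - 1) + (e^x - 1 - x) in the real part
    and e^x (sin y - y) + y (e^x - 1) in the imaginary part. *)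
Lemma cexp_err (eps : R) : 0 < eps -> exists2 d : R, 0 < d &
  forall h : CR, cmod h < d -> cmod (cexp h - 1 - h) <= eps * cmod h.
Proof.
move=> e0.
(* the error is at most 6 k |h| *)
pose k := Num.min 1 (eps / 6).
have k0 : 0 < k by rewrite lt_min ltr01 divr_gt0.
have k1 : k <= 1 by rewrite ge_min lexx.
have ke : 6 * k <= eps.
  rewrite mulrC -ler_pdivlMr //.
  by rewrite ge_min lexx orbT.
have De : is_derive (0 : R) 1 (@expR R) 1 by apply: is_derive_eq (is_derive_expR _) _; rewrite expR0.
have Dc : is_derive (0 : R) 1 (@cos R) 0.
  by apply: is_derive_eq (is_derive_cos _) _; rewrite sin0 oppr0.
have Ds : is_derive (0 : R) 1 (@sin R) 1.
  by apply: is_derive_eq (is_derive_sin _) _; rewrite cos0.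
have [d1 d10 H1] := derive_err De k0.
have [d2 d20 H2] := derive_err Dc k0.
have [d3 d30 H3] := derive_err Ds k0.
pose d := Num.min (Num.min d1 d2) (Num.min d3 (k / 2)).
have d0 : 0 < d by rewrite !lt_min d10 d20 d30 divr_gt0.
exists d => // h hd.
set x := complex.Re h; set y := complex.Im h.
have xh : `|x| <= cmod h := cmod_ge_Re h.
have yh : `|y| <= cmod h := cmod_ge_Im h.
have := le_lt_trans xh hd; rewrite !lt_min => /andP [/andP [x1 _] /andP [_ x4]].
have := le_lt_trans yh hd; rewrite !lt_min => /andP [/andP [_ y2] /andP [y3 _]].
have {H1} := H1 x x1; rewrite expR0 mulr1 => H1.
have {H2} := H2 y y2; rewrite cos0 mulr0 subr0 => H2.
have {H3} := H3 y y3; rewrite sin0 mulr1 subr0 => H3.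
have E1 : `|expR x - 1| <= k.
  rewrite -(subrK x (expR x - 1)); apply: le_trans (ler_normD _ _) _.
  apply: le_trans (lerD H1 (lexx _)) _.
  have : k * `|x| <= 1 * `|x| by rewrite ler_wpM2r.
  by move: x4; move: (`|x|) => u; lra.
have E2 : `|expR x| <= 2.
  rewrite -(subrK 1 (expR x)); apply: le_trans (ler_normD _ _) _.
  by rewrite normr1; move: E1; move: (`|_|) => u; lra.
apply: le_trans (cmod_le _) _.
have -> : complex.Re (cexp h - 1 - h) = expR x * (cos y - 1) + (expR x - 1 - x).
  rewrite /cexp /x /y; case: h {hd x y xh yh x1 x4 y2 y3 H1 H2 H3 E1 E2} => a b /=; ring.
have -> : complex.Im (cexp h - 1 - h) = expR x * (sin y - y) + y * (expR x - 1).
  rewrite /cexp /x /y; case: h {hd x y xh yh x1 x4 y2 y3 H1 H2 H3 E1 E2} => a b /=; ring.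
have A1 : `|expR x * (cos y - 1)| <= 2 * (k * `|y|) by rewrite normrM ler_pM.
have A2 : `|expR x * (sin y - y)| <= 2 * (k * `|y|) by rewrite normrM ler_pM.
have A3 : `|y * (expR x - 1)| <= `|y| * k by rewrite normrM ler_wpM2l.
have B1 := le_trans (ler_normD (expR x * (cos y - 1)) (expR x - 1 - x)) (lerD A1 H1).
have B2 := le_trans (ler_normD (expR x * (sin y - y)) (y * (expR x - 1))) (lerD A2 A3).
apply: le_trans (lerD B1 B2) _.
have kx : k * `|x| <= k * cmod h by rewrite ler_wpM2l // ltW.
have ky : k * `|y| <= k * cmod h by rewrite ler_wpM2l // ltW.
have kn : (6 * k) * cmod h <= eps * cmod h by rewrite ler_wpM2r // sqrtr_ge0.
rewrite (mulrC `|y|); move: kx ky kn; rewrite -mulrA.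
by move: (k * _) (k * _) (k * _) (eps * _) => u v w z; lra.
Qed.

Lemma cexpD (z w : CR) : cexp (z + w) = cexp z * cexp w.
Proof.
case: z w => [a b] [c d]; rewrite /cexp /= expRD cosD sinD.
by congr (_ +i* _)%C; ring.
Qed.

Lemma cmodM z w : cmod (z * w) = cmod z * cmod w.
Proof.
apply: (@complexI R); rewrite rmorphM.
by have := normrM z w; rewrite !normE.
Qed.

Lemma cmodV z : cmod z^-1 = (cmod z)^-1.
Proof. by apply: (@complexI R); rewrite fmorphV; have := normfV z; rewrite !normE. Qed.

Lemma cmodN z : cmod (- z) = cmod z.
Proof. by apply: (@complexI R); have := normrN z; rewrite !normE. Qed.

Lemma cmodD z w : cmod (z + w) <= cmod z + cmod w.
Proof. by rewrite -leCE rmorphD /=; have := ler_normD z w; rewrite !normE. Qed.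

Lemma cmod_gt0 z : z != 0 -> 0 < cmod z.
Proof. by move=> z0; rewrite -ltCE -normE normr_gt0. Qed.

Lemma cexp0 : cexp (0 : CR) = 1.
Proof. by rewrite /cexp /= expR0 cos0 sin0 mulr1 mulr0. Qed.

Variables (U : set CR) (ell : CR -> CR).
Hypothesis Hlog : log_branch U ell.

(** The exponential has an inverse, hence no zero. *)
Lemma log_neq0 w : U w -> w != 0.
Proof.
move=> Uw; case: Hlog => _ _ /(_ w Uw) H; apply/eqP => w0; move: H; rewrite w0 => H.
have := cexpD (ell w) (- ell w); rewrite subrr cexp0 w0 H mul0r => /eqP.
by rewrite oner_eq0.
Qed.

Lemma log_cvg w : U w -> ell x @[x --> w] --> ell w.
Proof.
case: Hlog => oU cU _ Uw.
by move: cU; rewrite continuous_open_subspace // => /(_ w); apply; rewrite inE.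
Qed.

(** With dl the increment of the branch for the increment h, cexp (ell w + dl) = w + h
    gives h = w (cexp dl - 1). Continuity makes dl small, so dl = h / w up to an error that
    [cexp_err] bounds by a small multiple of dl, hence of h. *)
Lemma log_is_derive w : U w -> is_derive w (1 : CR) ell w^-1.
Proof.
move=> Uw; have w0 := log_neq0 Uw.
suff H : h^-1 *: ((ell \o shift w) (h *: (1 : CR)) - ell w) @[h --> 0^'] --> w^-1.
  by apply: DeriveDef; [apply/cvg_ex; exists w^-1|exact: cvg_lim H].
apply/cvgrPdist_le => e e0.
have eE : e = (complex.Re e)%:C%C by rewrite RRe_real // gtr0_real.
have {}e0 : 0 < complex.Re e by rewrite -ltCE -eE.
set eps := complex.Re e in e0 eE.
have r0 := cmod_gt0 w0; set r := cmod w in r0.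
(* k <= 1/2 bounds |dl| by 2 |h| / r, and 2 k <= eps r then gives the estimate *)
pose k := Num.min (1 / 2) (eps * r / 2).
have k0 : 0 < k by rewrite lt_min !divr_gt0 // mulr_gt0.
have k1 : k <= 1 / 2 by rewrite ge_min lexx.
have k2 : 2 * k <= eps * r.
  by rewrite mulrC -ler_pdivlMr // ge_min lexx orbT.
have [d d0 Hd] := cexp_err k0.
case: Hlog => oU cU lU.
have n1 : \forall h \near (0 : CR), U (h + w).
  have : \forall x \near w, U x by exact: open_nbhs_nbhs.
  by rewrite (near_shift 0 w) /= subr0.
have n2 : \forall h \near (0 : CR), cmod (ell (h + w) - ell w) < d.
  have dC : 0 < (d%:C%C : CR) by rewrite ltCE.
  have /cvgrPdist_lt /(_ _ dC) H := log_cvg Uw.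
  have {}H : \forall x \near w, cmod (ell x - ell w) < d.
    near=> x; rewrite -ltCE -normE distrC; near: x; exact: H.
  by move: H; rewrite (near_shift 0 w) /= subr0.
near=> h.
have h0 : h != 0 by near: h; exact: nbhs_dnbhs_neq.
have Uh : U (h + w) by near: h; exact: nbhs_dnbhs.
have hd : cmod (ell (h + w) - ell w) < d by near: h; exact: nbhs_dnbhs.
rewrite /= /GRing.scale /= mulr1 eE normE leCE.
set dl := ell (h + w) - ell w in hd *.
have hE : h = w * (cexp dl - 1).
  have := lU _ Uh; rewrite -(subrK (ell w) (ell (h + w))) -/dl cexpD (lU _ Uw) => E.
  by rewrite mulrBr mulr1 mulrC E addrK.
have N1 := Hd _ hd; set N := cmod dl in N1.
have h1 := cmod_gt0 h0.
have -> : w^-1 - h^-1 * dl = (cexp dl - 1 - dl) * h^-1.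
  rewrite mulrBl (mulrC dl); congr (_ - _).
  by rewrite {1}hE invfM mulrCA mulfV ?mulr1 //; apply: contraNneq h0 => E; rewrite hE E mulr0.
rewrite cmodM cmodV ler_pdivrMr //.
have N2 : N <= cmod h / r + k * N.
  have NE : N = cmod (h / w - (cexp dl - 1 - dl)).
    by rewrite {1}hE mulrAC mulfV // mul1r opprB addrC subrK.
  rewrite [X in X <= _]NE; apply: le_trans (cmodD _ _) _; by rewrite cmodN cmodM cmodV lerD2l.
have N0 : 0 <= N by exact: sqrtr_ge0.
have N3 : N * r <= 2 * cmod h.
  have N4 : N <= cmod h / r + 1 / 2 * N.
    by apply: le_trans N2 _; rewrite lerD2l ler_wpM2r.
  rewrite -ler_pdivlMr // -mulrA.
  by move: N4; move: (cmod h / r) => u; lra.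
apply: le_trans N1 _.
rewrite -(ler_pM2r r0) -mulrA.
apply: le_trans (ler_wpM2l (ltW k0) N3) _.
rewrite mulrA (mulrC k) (mulrAC eps); apply: ler_wpM2r; [exact: ltW|exact: k2].
Unshelve. all: by end_near. Qed.

End LogDerivative.

(** * The potential *)

Section Potential.
Variable R : realType.
Local Notation CR := (CC R).
Variables (U : set CR) (ell : CR -> CR).
Hypothesis Hlog : log_branch U ell.

Definition Mlog : set 'rV[CR]_3 := [set t : 'rV[CR]_3 | U (t 0 2)].

Lemma Mlog_open : open Mlog.
Proof.
case: Hlog => oU _ _; apply: (@open_comp _ _ (fun t : 'rV[CR]_3 => t 0 2)) => // t _.
exact/differentiable_continuous/differentiable_coord.
Qed.

(** Functions p + q log t_3 with polynomials p and q: their partial derivatives have the same form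
    as long as t_3 divides q. *)
Definition logpoly (p q : pexp R 3) (t : 'rV[CR]_3) : CR := pev p t + pev q t * ell (t 0 2).

Lemma ell_differentiable t : Mlog t -> differentiable (fun s : 'rV[CR]_3 => ell (s 0 2)) t.
Proof.
move=> Mt; apply: (@differentiable_comp _ _ _ _ (fun s : 'rV[CR]_3 => s 0 2) ell).
  exact: differentiable_coord.
by apply/derivable1_diffP; case: (log_is_derive Hlog Mt).
Qed.

Lemma logpoly_differentiable p q t : Mlog t -> differentiable (logpoly p q) t.
Proof.
move=> Mt; apply: differentiableD; first exact: pev_differentiable.
by apply: differentiableM; [exact: pev_differentiable|exact: ell_differentiable].
Qed.

Lemma pd_ell i t : Mlog t -> pd i (fun s => ell (s 0 2)) t = (i == 2)%:R * (t 0 2)^-1.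
Proof.
move=> Mt.
have dc : differentiable (fun s : 'rV[CR]_3 => s 0 2) t by exact: differentiable_coord.
have [dl lE] := log_is_derive Hlog Mt.
have de : differentiable ell (t 0 2) by exact/derivable1_diffP.
have cE : 'd (fun s : 'rV[CR]_3 => s 0 2) t (delta_mx 0 i) = (i == 2)%:R.
  rewrite -(deriveE _ dc); exact: (pd_pev i (PV R 2) t).
have := @diff_comp _ _ _ _ (fun s : 'rV[CR]_3 => s 0 2) ell t dc de.
rewrite /pd (deriveE _ (ell_differentiable Mt)) => E.
have -> : 'd (fun s : 'rV[CR]_3 => ell (s 0 2)) t (delta_mx 0 i) =
   'd ell (t 0 2) ('d (fun s : 'rV[CR]_3 => s 0 2) t (delta_mx 0 i)).
  exact: (congr1 (fun f => f (delta_mx 0 i)) E).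
by rewrite cE (diff1E de) derive1E lE.
Qed.

Lemma pd_logpoly i p q t : Mlog t -> pd i (logpoly p q) t =
  pev (pdif i p) t + pev (pdif i q) t * ell (t 0 2) + pev q t * ((i == 2)%:R / t 0 2).
Proof.
move=> Mt; have dp := pev_differentiable p t; have dq := pev_differentiable q t.
have de := ell_differentiable Mt.
have H : is_derive t (delta_mx 0 i) (logpoly p q)
   (pd i (pev p) t + pd i (fun s => pev q s * ell (s 0 2)) t).
  by apply: is_deriveD; apply: is_derive_of_diff => //; exact: differentiableM.
case: H => _ H; apply: etrans H _.
by rewrite (pdM i dq de) !pd_pev (pd_ell i Mt) addrA.
Qed.

Let cst (c : CR) : pexp R 3 := @PC R 3 c.
Let v0 : pexp R 3 := PV R 0.
Let v1 : pexp R 3 := PV R 1.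
Let v2 : pexp R 3 := PV R 2.
Local Notation F := (potential ell).

(** The potential and its first and second derivatives in the form p + q log t_3. *)
Definition F0p : pexp R 3 :=
  PA (PM (cst (1 / 12)) (PM v0 (PM v0 v0)))
    (PA (PM (cst (1 / 2)) (PM v0 (PM v1 v2))) (PM (cst (- (1 / 6))) (PM v1 (PM v1 (PM v1 v2))))).
Definition F0q : pexp R 3 := PM (cst (- (1 / 8))) (PM v2 v2).
Definition F1p (k : 'I_3) : pexp R 3 := nth (cst 0)
  [:: PA (PM (cst (1 / 4)) (PM v0 v0)) (PM (cst (1 / 2)) (PM v1 v2));
      PA (PM (cst (1 / 2)) (PM v0 v2)) (PM (cst (- (1 / 2))) (PM v1 (PM v1 v2)));
      PA (PA (PM (cst (1 / 2)) (PM v0 v1)) (PM (cst (- (1 / 6))) (PM v1 (PM v1 v1))))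
         (PM (cst (- (1 / 8))) v2)] k.
Definition F1q (k : 'I_3) : pexp R 3 := nth (cst 0) [:: cst 0; cst 0; PM (cst (- (1 / 4))) v2] k.
Definition F2p (j k : 'I_3) : pexp R 3 :=
  let a := PA (PM (cst (1 / 2)) v0) (PM (cst (- (1 / 2))) (PM v1 v1)) in
  nth (cst 0) (nth [::]
  [:: [:: PM (cst (1 / 2)) v0; PM (cst (1 / 2)) v2; PM (cst (1 / 2)) v1];
      [:: PM (cst (1 / 2)) v2; PM (cst (-1)) (PM v1 v2); a];
      [:: PM (cst (1 / 2)) v1; a; cst (- (3 / 8))]] j) k.
Definition F2q (j k : 'I_3) : pexp R 3 := nth (cst 0) (nth [::]
  [:: [::]; [::]; [:: cst 0; cst 0; cst (- (1 / 4))]] j) k.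

(** The third derivatives are rational: the logarithm drops out. *)
Definition third_tab (t1 t2 : CR) : seq (seq (seq CR)) :=
  [:: [:: [:: 1 / 2; 0; 0]; [:: 0; 0; 1 / 2]; [:: 0; 1 / 2; 0]];
      [:: [:: 0; 0; 1 / 2]; [:: 0; - t2; - t1]; [:: 1 / 2; - t1; 0]];
      [:: [:: 0; 1 / 2; 0]; [:: 1 / 2; - t1; 0]; [:: 0; 0; - (1 / (4 * t2))]]].
Definition third_val (i j k : nat) (t : 'rV[CR]_3) : CR :=
  (nth [::] (nth [::] (third_tab (t 0 1) (t 0 2)) i) j)`_k.

Lemma FE : F = logpoly F0p F0q.
Proof. by apply/funext => t; rewrite /potential /logpoly /=; field. Qed.

Lemma Mneq0 t : Mlog t -> t 0 2 != 0.
Proof. exact: (log_neq0 Hlog). Qed.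

Lemma F1E k t : Mlog t -> pd k F t = logpoly (F1p k) (F1q k) t.
Proof.
move=> Mt; have t0 := Mneq0 Mt; rewrite FE pd_logpoly // /logpoly.
move: (ell _) => l.
by move: k => [[|[|[|//]]] ?] /=; field.
Qed.

Lemma near_M t : Mlog t -> \forall s \near t, Mlog s.
Proof. by move=> Mt; apply: open_nbhs_nbhs; split => //; exact: Mlog_open. Qed.

Lemma F2E j k t : Mlog t -> pd j (pd k F) t = logpoly (F2p j k) (F2q j k) t.
Proof.
move=> Mt; have t0 := Mneq0 Mt.
have -> : pd j (pd k F) t = pd j (logpoly (F1p k) (F1q k)) t.
  by apply: pd_near; near=> s; apply: F1E; near: s; exact: near_M.
rewrite pd_logpoly // /logpoly; move: (ell _) => l.
by move: j k => [[|[|[|//]]] ?] [[|[|[|//]]] ?] /=; field.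
Unshelve. all: by end_near. Qed.

Lemma thirdE i j k t : Mlog t -> third F i j k t = third_val i j k t.
Proof.
move=> Mt; have t0 := Mneq0 Mt.
have -> : third F i j k t = pd i (logpoly (F2p j k) (F2q j k)) t.
  by apply: pd_near; near=> s; apply: F2E; near: s; exact: near_M.
rewrite pd_logpoly // /logpoly; move: (ell _) => l.
by move: i j k => [[|[|[|//]]] ?] [[|[|[|//]]] ?] [[|[|[|//]]] ?]; rewrite /third_val /=; field.
Unshelve. all: by end_near. Qed.

Lemma euler_F t : Mlog t -> app_vf (@euler_field R) F t = 3 * F t - 3 / 16 * t 0 2 ^+ 2.
Proof.
move=> Mt; have t0 := Mneq0 Mt; rewrite /app_vf sum3 !F1E // !euler_fieldE FE /logpoly.
by move: (ell _) => l /=; field.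
Qed.

Lemma intersection_F t : Mlog t -> intersection_form (Om1 R) F (@euler_field R) t = Om_lam 0 t.
Proof.
move=> Mt; have t0 := Mneq0 Mt; apply/matrixP => i j; rewrite mxE O_tabE.
under eq_bigr => p _ do under eq_bigr => k _ do under eq_bigr => m _ do
  rewrite euler_fieldE thirdE //.
rewrite !sum3 !mxE /third_val.
by move: i j => [[|[|[|//]]] ?] [[|[|[|//]]] ?] /=; field.
Qed.

Lemma pot_metric_F t : Mlog t -> pot_metric 0 F t = invmx (Om1 R).
Proof.
move=> Mt; apply: (can_inj (mulmxK (Om1_unit R))); rewrite mulVmx ?Om1_unit //.
apply/matrixP => i j; rewrite !mxE.
under eq_bigr => k _ do rewrite mxE thirdE //.
rewrite sum3 !mxE /third_val.
by move: i j => [[|[|[|//]]] ?] [[|[|[|//]]] ?] /=; field.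
Qed.

Lemma pot_mult_F t i j k : Mlog t -> pot_mult (Om1 R) F t i j 0 k =
  2 * third_val (nth 0%N [:: 0; 2; 1]%N k) i j t.
Proof.
move=> Mt; rewrite mxE; under eq_bigr => p _ do rewrite thirdE //.
rewrite sum3 !mxE /third_val.
by move: k => [[|[|[|//]]] ?] /=; ring.
Qed.

(** The structure constants are rational functions of t_2 and t_3, and associativity is checked
    on them. *)
Lemma wdvv_F t : Mlog t -> forall i j k l : 'I_3,
  \sum_m pot_mult (Om1 R) F t i j 0 m * pot_mult (Om1 R) F t m k 0 l
  = \sum_m pot_mult (Om1 R) F t j k 0 m * pot_mult (Om1 R) F t i m 0 l.
Proof.
move=> Mt i j k l; have t0 := Mneq0 Mt.
suff H (c : 'I_3 -> 'I_3 -> 'I_3 -> CR) :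
    (forall i j k, c i j k = 2 * third_val (nth 0%N [:: 0; 2; 1]%N k) i j t) ->
    \sum_m c i j m * c m k l = \sum_m c j k m * c i m l.
  by apply: (H (fun i j k => pot_mult (Om1 R) F t i j 0 k)) => p q r; exact: pot_mult_F.
move=> cE; rewrite !sum3 !cE /third_val; move: (t 0 1) (t 0 2) t0 => x y y0.
by move: i j k l => [[|[|[|//]]] ?] [[|[|[|//]]] ?] [[|[|[|//]]] ?] [[|[|[|//]]] ?] /=; field.
Qed.

Lemma DF_potential_F : DF_potential Mlog 0 F (Om1 R) (@euler_field R) 0.
Proof.
split.
- split; first exact: Mlog_open.
  by move=> t Mt; rewrite FE; exact: logpoly_differentiable.
- by split; [exact: Om1_unit|exact: pot_metric_F].
- exact: wdvv_F.
- exists (diag_mx (row3 1 (1 / 2) (3 / 2))), 0 => t _.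
  apply/rowP => i; rewrite euler_fieldE addr0 mxE sum3 !mxE.
  by move: i => [[|[|[|//]]] ?] /=; rewrite ?mulr1n ?mulr0n; field.
- exists (- (3 / 16) *: delta_mx 2 2), 0, 0 => t Mt; rewrite euler_F // mulmx0.
  rewrite !mxE sum3 !mxE !sum3 !mxE /=; by field.
Qed.

End Potential.

(** * Residues *)

Section Residue.
Variable R : realType.
Local Notation CR := (CC R).

Lemma horner_continuous (P : {poly CR}) (x : CR) : {for x, continuous (horner P)}.
Proof. by apply/differentiable_continuous/derivable1_diffP; case: (is_derive_horner P x). Qed.

(** Let p tend to p0: the constant term vanishes, and one power of p - p0 can be removed from
    both sides. *)
Lemma poly_vanishing (p0 : CR) (G : CR -> CR) : {for p0, continuous G} ->
  forall M (P : {poly CR}), (size P <= M)%N ->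
  (\forall p \near p0^', P.[p - p0] = (p - p0) ^+ M * G p) -> P = 0.
Proof.
move=> cG; elim=> [|M IH] P sP HP; first by apply/eqP; rewrite -size_poly_eq0 -leqn0.
have P0 : P.[0] = 0.
  have c1 : P.[p - p0] @[p --> p0^'] --> P.[0].
    apply: cvg_within_filter.
    have -> : (fun p => P.[p - p0]) = horner (P \Po ('X - p0%:P)).
      by apply/funext => p; rewrite horner_comp hornerXsubC.
    have -> : P.[0] = (P \Po ('X - p0%:P)).[p0] by rewrite horner_comp hornerXsubC subrr.
    exact: horner_continuous.
  pose Q := ('X - p0%:P) ^+ M.+1 : {poly CR}.
  have cQ := cvgM (horner_continuous (P := Q) (x := p0)) cG.
  have c2 : Q.[p] * G p @[p --> p0^'] --> Q.[p0] * G p0 by apply: cvg_within_filter; exact: cQ.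
  have c3 : P.[p - p0] @[p --> p0^'] --> Q.[p0] * G p0.
    refine (cvg_trans (near_eq_cvg _) c2).
    near=> p; rewrite /= /Q horner_exp hornerXsubC; apply/esym; near: p; exact: HP.
  by rewrite (cvg_unique (@norm_hausdorff _ _) c1 c3) /Q horner_exp hornerXsubC subrr expr0n mul0r.
have /factor_theorem [P1 E] : root P 0 by rewrite /root P0.
rewrite subr0 in E.
rewrite E (IH P1) ?mul0r //.
  have [->|n0] := eqVneq P1 0; first by rewrite size_poly0.
  by move: sP; rewrite E size_mulX.
near=> p.
have p1 : p != p0 by near: p; exact: nbhs_dnbhs_neq.
have : P.[p - p0] = (p - p0) ^+ M.+1 * G p by near: p; exact: HP.
rewrite E hornerM hornerX exprS mulrC -mulrA => /mulfI; apply.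
by rewrite subr_eq0.
Unshelve. all: by end_near. Qed.

(** The difference of two principal parts is continuous at p0; multiplied by a power
    of p - p0 it is a polynomial to which [poly_vanishing] applies. *)
Lemma residue_unique (f : CR -> CR) p0 r r' :
  is_residue f p0 r -> is_residue f p0 r' -> r = r'.
Proof.
move=> [m [a [g [dg fE ->]]]] [m' [a' [g' [dg' fE' ->]]]].
(* an exponent larger than both orders of pole *)
pose M := (m + m').+1.
pose P : {poly CR} := \sum_(k < m.+1) (a k)%:P * 'X^(M - k.+1)
  - \sum_(k < m'.+1) (a' k)%:P * 'X^(M - k.+1).
have cg : {for p0, continuous g}.
  by apply/differentiable_continuous/derivable1_diffP; exact: (nbhs_singleton dg).
have cg' : {for p0, continuous g'}.
  by apply/differentiable_continuous/derivable1_diffP; exact: (nbhs_singleton dg').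
have part n (c : 'I_n.+1 -> CR) (p : CR) : (n < M)%N -> p != 0 ->
    (\sum_(k < n.+1) (c k)%:P * 'X^(M - k.+1)).[p] = p ^+ M * \sum_(k < n.+1) c k * p ^- k.+1.
  move=> nM p1; rewrite horner_sum mulr_sumr; apply: eq_bigr => k _.
  rewrite hornerM hornerC hornerXn mulrCA; congr (_ * _).
  by rewrite expfB_cond // (negbTE p1) /= (leq_trans (ltn_ord k)).
have szP n (c : 'I_n.+1 -> CR) : (size (\sum_(k < n.+1) (c k)%:P * 'X^(M - k.+1))%R <= M)%N.
  apply: leq_trans (size_sum _ _ _) _; apply/bigmax_leqP => k _.
  rewrite mul_polyC; apply: leq_trans (size_scale_leq _ _) _.
  by rewrite size_polyXn ltn_subrL.
have P0 : P = 0.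
  apply: (@poly_vanishing p0 (fun p => g' p - g p) _ M).
  - exact: (cvgB cg' cg).
  - by apply: leq_trans (size_polyD _ _) _; rewrite size_polyN geq_max !szP.
  near=> p.
  have p1 : p - p0 != 0 by rewrite subr_eq0; near: p; exact: nbhs_dnbhs_neq.
  rewrite hornerD hornerN !part // ?ltnS ?leq_addr ?leq_addl // -mulrBr; congr (_ * _).
  have E : f p = \sum_(k < m.+1) a k * (p - p0) ^- k.+1 + g p by near: p.
  have E' : f p = \sum_(k < m'.+1) a' k * (p - p0) ^- k.+1 + g' p by near: p.
  by apply/eqP; rewrite subr_eq addrAC -subr_eq opprK -E addrC -E'.
have top n (c : 'I_n.+1 -> CR) : (n < M)%N ->
   (\sum_(k < n.+1) (c k)%:P * 'X^(M - k.+1))`_M.-1 = c ord0.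
  move=> nM; rewrite coef_sum big_ord_recl big1 ?addr0 => [|k _]; rewrite coefCM coefXn.
    by rewrite subn1 eqxx mulr1.
  rewrite (_ : (M.-1 == M - (fintype.lift ord0 k).+1)%N = false) ?mulr0 //.
  have kn : (k < n)%N := ltn_ord k.
  by rewrite lift0; move: nM kn; rewrite /M; move: (nat_of_ord k) => u; lia.
have := congr1 (fun Q : {poly CR} => Q`_M.-1) P0.
by rewrite coef0 coefB !top ?ltnS ?leq_addr ?leq_addl // => /eqP; rewrite subr_eq0 => /eqP.
Unshelve. all: by end_near. Qed.

(** Poles of order at most 3 suffice here, since the denominators are cubic. *)
Lemma residueE (f : CR -> CR) (p0 : CR) (a : seq CR) (g : CR -> CR) :
  (\forall p \near p0, derivable g p 1) ->
  (\forall p \near p0^', f p = a`_0 / (p - p0) + a`_1 / (p - p0) ^+ 2 + a`_2 / (p - p0) ^+ 3 + g p) ->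
  residue f p0 = a`_0.
Proof.
move=> dg fE.
have H : is_residue f p0 a`_0.
  exists 2%N, (fun k : 'I_3 => a`_k), g; split=> //.
  by near=> p; rewrite !big_ord_recl big_ord0 addr0 expr1 addrA /=; near: p.
rewrite /residue; have /= := xgetPex 0 (ex_intro _ _ H).
by move=> /residue_unique /(_ H).
Unshelve. all: by end_near. Qed.

End Residue.

Section ResidueSum.
Variable R : realType.
Local Notation CR := (CC R).

Lemma near_neq (r c : CR) : r != c -> \forall p \near r, p != c.
Proof.
move=> rc; apply/nbhs_ballP; exists `|r - c| => /= [|p].
  by rewrite normr_gt0 subr_eq0.
by rewrite /ball /= => h; apply/eqP => pc; move: h; rewrite pc ltxx.
Qed.

Lemma derivable_inv (r p : CR) : p != r -> derivable (fun x => (x - r)^-1) p 1.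
Proof.
move=> pr; apply: derivableV; first by rewrite subr_eq0.
by apply: derivableB; [exact: derivable_id|exact: derivable_cst].
Qed.

Lemma derivable_lin (a b p : CR) : derivable (fun x => a + b * x) p 1.
Proof.
apply: derivableD; first exact: derivable_cst.
by apply: derivableM; [exact: derivable_cst|exact: derivable_id].
Qed.

Variables (c : CR) (g0 : CR -> CR) (n0 n1 n2 : CR) (f : CR -> CR).
Hypothesis dg0 : forall p, p != c -> derivable g0 p 1.
Local Notation nn p := (n0 + n1 * p + n2 * p ^+ 2).

(** f is a quadratic polynomial over a monic cubic with roots r1, r2, r3, up to a function that is
    regular outside c. *)
Definition has_pf (r1 r2 r3 : CR) := forall p, p != c -> p != r1 -> p != r2 -> p != r3 ->
  f p = nn p / ((p - r1) * (p - r2) * (p - r3)) + g0 p.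

Lemma res_simple r1 r2 r3 : r1 != c -> r1 != r2 -> r1 != r3 -> has_pf r1 r2 r3 ->
  residue f r1 = nn r1 / ((r1 - r2) * (r1 - r3)).
Proof.
move=> r1c r12 r13 Hf.
have d2 : r1 - r2 != 0 by rewrite subr_eq0.
have d3 : r1 - r3 != 0 by rewrite subr_eq0.
pose q := (r1 - r2) * (r1 - r3).
pose A := (n1 + n2 * r1) - nn r1 * (r1 - r2 - r3) / q.
pose B := n2 - nn r1 / q.
apply: (@residueE R f r1 [:: nn r1 / q] (fun p => g0 p + (A + B * p) * ((p - r2)^-1 * (p - r3)^-1))).
  near=> p; have pc : p != c by near: p; exact: near_neq.
  have p2 : p != r2 by near: p; exact: near_neq.
  have p3 : p != r3 by near: p; exact: near_neq.
  apply: derivableD; first exact: dg0.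
  apply: derivableM; first exact: derivable_lin.
  by apply: derivableM; exact: derivable_inv.
near=> p; have p1 : p != r1 by near: p; exact: nbhs_dnbhs_neq.
have pc : p != c by near: p; apply: nbhs_dnbhs; exact: near_neq.
have p2 : p != r2 by near: p; apply: nbhs_dnbhs; exact: near_neq.
have p3 : p != r3 by near: p; apply: nbhs_dnbhs; exact: near_neq.
rewrite Hf // /= /A /B /q; move: p1 p2 p3; rewrite -!(subr_eq0 p) => p1 p2 p3.
by field; rewrite p1 p2 p3 d2 d3.
Unshelve. all: by end_near. Qed.

Lemma res_double r r3 : r != c -> r != r3 -> has_pf r r r3 ->
  residue f r = n2 - nn r3 / (r3 - r) ^+ 2.
Proof.
move=> rc r13 Hf; have d3 : r3 - r != 0 by rewrite subr_eq0 eq_sym.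
pose ga := nn r3 / (r3 - r) ^+ 2.
apply: (@residueE R f r [:: n2 - ga; - nn r / (r3 - r)] (fun p => g0 p + (ga + 0 * p) * (p - r3)^-1)).
  near=> p; have pc : p != c by near: p; exact: near_neq.
  have p3 : p != r3 by near: p; exact: near_neq.
  apply: derivableD; first exact: dg0.
  by apply: derivableM; [exact: derivable_lin|exact: derivable_inv].
near=> p; have p1 : p != r by near: p; exact: nbhs_dnbhs_neq.
have pc : p != c by near: p; apply: nbhs_dnbhs; exact: near_neq.
have p3 : p != r3 by near: p; apply: nbhs_dnbhs; exact: near_neq.
rewrite Hf // /= /ga; move: p1 p3; rewrite -!(subr_eq0 p) => p1 p3.
by field; rewrite p1 p3 d3.
Unshelve. all: by end_near. Qed.

Lemma res_triple r : r != c -> has_pf r r r -> residue f r = n2.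
Proof.
move=> rc Hf; apply: (@residueE R f r [:: n2; n1 + 2 * n2 * r; nn r] g0).
  by near=> p; apply: dg0; near: p; exact: near_neq.
near=> p; have p1 : p != r by near: p; exact: nbhs_dnbhs_neq.
have pc : p != c by near: p; apply: nbhs_dnbhs; exact: near_neq.
rewrite Hf // /=; move: p1; rewrite -!(subr_eq0 p) => p1.
by field; rewrite p1.
Unshelve. all: by end_near. Qed.

Lemma has_pf12 r1 r2 r3 : has_pf r1 r2 r3 -> has_pf r2 r1 r3.
Proof. by move=> H p pc p1 p2 p3; rewrite H // (mulrC (p - r1)). Qed.

Lemma has_pf23 r1 r2 r3 : has_pf r1 r2 r3 -> has_pf r1 r3 r2.
Proof. by move=> H p pc p1 p2 p3; rewrite H // (mulrAC (p - r1)). Qed.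

Lemma residue_sum_double (C : set CR) r r3 :
  (forall p, C p <-> [\/ p = r, p = r | p = r3]) ->
  r != c -> r3 != c -> r != r3 -> has_pf r r r3 -> \sum_(p0 \in C) residue f p0 = n2.
Proof.
move=> HC rc r3c rr Hf.
have -> : C = [set` [:: r; r3]].
  apply/seteqP; split=> p /=; rewrite !inE.
    by move=> /HC [->|->|->]; rewrite eqxx ?orbT.
  by move=> /orP [/eqP ->|/eqP ->]; apply/HC; [apply: Or31|apply: Or33].
rewrite -fsbig_seq; last by rewrite /= inE rr.
rewrite !big_cons big_nil.
have E1 := res_double rc rr Hf.
have E3 : residue f r3 = nn r3 / ((r3 - r) * (r3 - r)).
  by apply: res_simple => //; [rewrite eq_sym|rewrite eq_sym|apply: has_pf12; exact: has_pf23].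
rewrite E1 E3 /= addr0 -expr2; exact: subrK.
Qed.

(** The sum of the residues of a quadratic over a monic cubic is the leading coefficient, whatever the
    multiplicities of the roots: a residue at infinity, obtained from the explicit partial fractions.
    The function may have further poles at c, which are not counted. *)
Lemma residue_sum (C : set CR) r1 r2 r3 :
  (forall p, C p <-> [\/ p = r1, p = r2 | p = r3]) ->
  r1 != c -> r2 != c -> r3 != c -> has_pf r1 r2 r3 -> \sum_(p0 \in C) residue f p0 = n2.
Proof.
move=> HC r1c r2c r3c Hf.
have [e12|n12] := eqVneq r1 r2.
  subst r2; have [e13|n13] := eqVneq r1 r3.
    subst r3; have -> : C = [set` [:: r1]].
      apply/seteqP; split=> p /=; rewrite !inE.
        by move=> /HC [->|->|->]; rewrite eqxx.
      by move=> /eqP ->; apply/HC; apply: Or31.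
    by rewrite -fsbig_seq // big_cons big_nil /= addr0 (res_triple r1c Hf).
  exact: residue_sum_double HC _ _ _ Hf.
have [e13|n13] := eqVneq r1 r3.
  subst r3; apply: (@residue_sum_double C r1 r2) => //; last exact: has_pf23.
  by move=> p; rewrite HC; split=> -[]; do ?[by constructor 1|by constructor 2|by constructor 3].
have [e23|n23] := eqVneq r2 r3.
  subst r3; apply: (@residue_sum_double C r2 r1) => //; rewrite 1?eq_sym //.
    by move=> p; rewrite HC; split=> -[]; do ?[by constructor 1|by constructor 2|by constructor 3].
  by apply: has_pf23; exact: has_pf12.
have -> : C = [set` [:: r1; r2; r3]].
  apply/seteqP; split=> p /=; rewrite !inE.
    by move=> /HC [->|->|->]; rewrite eqxx ?orbT.
  by move=> /or3P [/eqP ->|/eqP ->|/eqP ->]; apply/HC; [apply: Or31|apply: Or32|apply: Or33].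
rewrite -fsbig_seq; last by rewrite /= !inE negb_or n12 n13 n23.
rewrite !big_cons big_nil.
have E1 := res_simple r1c n12 n13 Hf.
have E2 : residue f r2 = nn r2 / ((r2 - r1) * (r2 - r3)).
  by apply: res_simple => //; [rewrite eq_sym|exact: has_pf12].
have E3 : residue f r3 = nn r3 / ((r3 - r1) * (r3 - r2)).
  by apply: res_simple => //; [rewrite eq_sym|rewrite eq_sym|apply: has_pf12; exact: has_pf23].
rewrite E1 E2 E3 /= addr0.
move: n12 n13 n23; rewrite -(subr_eq0 r1) -(subr_eq0 r1) -(subr_eq0 r2) => n12 n13 n23.
field; rewrite n12 n13 n23 /=.
by rewrite -(opprB r1 r2) -(opprB r1 r3) -(opprB r2 r3) !oppr_eq0 n12 n13 n23.
Qed.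

End ResidueSum.

(** * The Hurwitz space *)

Lemma transportE (K : comNzRingType) n (D : 'rV[K]_n) (D' : 'I_n -> 'I_n -> 'rV[K]_n) (A : 'M[K]_n) i j :
  (forall k, \sum_m D 0 m * A m k = \sum_p \sum_q A i p * A j q * D' p q 0 k) ->
  D *m A = \sum_p \sum_q (A i p * A j q) *: D' p q.
Proof.
move=> H; apply/rowP => k; rewrite mxE H summxE; apply: eq_bigr => p _.
by rewrite summxE; apply: eq_bigr => q _; rewrite mxE.
Qed.

Section Hurwitz.
Variable R : realType.
Local Notation CR := (CC R).

Lemma is_derive_inv (V : normedModType CR) (f : V -> CR) (x v : V) (df : CR) :
  f x != 0 -> is_derive x v f df -> is_derive x v (fun y => (f y)^-1) (- (f x) ^- 2 * df).
Proof.
move=> f0 [fd fE]; apply: DeriveDef; first exact: derivableV.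
by rewrite deriveV // fE.
Qed.

Section Point.
Variable s : 'rV[CR]_3.
Let a := s 0 0.
Let b := s 0 1.
Let c := s 0 2.
Hypothesis b0 : b != 0.

Lemma hlam_derive p : p != c -> derive1 (hlam s) p = p - b / (p - c) ^+ 2.
Proof.
move=> pc; have pc0 : p - c != 0 by rewrite subr_eq0.
have d1 : is_derive p (1 : CR) (fun x : CR => x - c) 1.
  by apply: is_derive_eq (is_deriveB (is_derive_id _ _) (is_derive_cst _ _ _)) _; rewrite subr0.
have d2 : is_derive p (1 : CR) (fun x : CR => (x - c)^-1) (- (p - c) ^- 2).
  by apply: is_derive_eq (@is_derive_inv _ (fun x : CR => x - c) p 1 1 pc0 d1) _; rewrite mulr1.
have d3 : is_derive p (1 : CR) (horner ((1 / 2)%:P * 'X * 'X + a%:P)) p.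
  apply: is_derive_eq (is_derive_horner _ _) _.
  by rewrite !(poly.derivD, poly.derivM, derivC, derivX) !(hornerD, hornerM, hornerC, hornerX); field.
have E : hlam s = (fun x => ((1 / 2)%:P * 'X * 'X + a%:P).[x] + b * (x - c)^-1).
  by apply/funext => x; rewrite /hlam !(hornerD, hornerM, hornerC, hornerX); congr (_ + _ + _); ring.
have d4 : is_derive p (1 : CR) (fun x : CR => b * (x - c)^-1) (b * - (p - c) ^- 2).
  by apply: is_derive_eq (is_deriveM (is_derive_cst b _ _) d2) _; rewrite /GRing.scale /= mulr0 addr0.
rewrite E derive1E; have [_ H] := is_deriveD d3 d4.
by apply: etrans H _; rewrite mulrN.
Qed.

(** The derivative of lambda along the i-th parameter is hw i / (p - c)^i. *)
Definition hw (i : 'I_3) : CR := nth 0 [:: 1; 1; b] i.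

Lemma hpdE i p : p != c -> hpd i s p = hw i * (p - c) ^- i.
Proof.
move=> pc; have pc0 : p - c != 0 by rewrite subr_eq0.
rewrite /hpd /hw; move: i => [[|[|[|//]]] ?] /=.
- rewrite expr0 invr1 mulr1; apply: derive_affine => h.
  by rewrite /hlam !mxE /= !mulr0 !add0r; ring.
- rewrite mul1r expr1; apply: derive_affine => h.
  rewrite /hlam !mxE /= !mulr0 !add0r -/c; move: (_^-1) => u; by ring.
set i := Ordinal _.
have d1 : is_derive s (delta_mx 0 i : 'rV[CR]_3) (pev (PA (PC 3 p) (PM (PC 3 (-1)) (PV R 2)))) (-1).
  apply: is_derive_eq (is_derive_of_diff i (pev_differentiable _ s)) _.
  by rewrite pd_pev /=; ring.
have e1 : pev (PA (PC 3 p) (PM (PC 3 (-1)) (PV R 2))) s = p - c by rewrite /= mulN1r.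
have d2 := @is_derive_inv _ _ s (delta_mx 0 i) (-1) _ d1; rewrite e1 in d2; have {}d2 := d2 pc0.
have d3 : is_derive s (delta_mx 0 i : 'rV[CR]_3)
    (pev (PA (PC 3 (1 / 2 * p ^+ 2)) (PV R 0))) 0.
  apply: is_derive_eq (is_derive_of_diff i (pev_differentiable _ s)) _.
  by rewrite pd_pev /=; ring.
have d4 : is_derive s (delta_mx 0 i : 'rV[CR]_3) (pev (PV R 1)) 0.
  apply: is_derive_eq (is_derive_of_diff i (pev_differentiable _ s)) _.
  by rewrite pd_pev.
have [_ H] := is_deriveD d3 (is_deriveM d4 d2).
rewrite /pd; have -> : (fun s' : 'rV[CR]_3 => hlam s' p) =
  pev (PA (PC 3 (1 / 2 * p ^+ 2)) (PV R 0)) +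
  pev (PV R 1) * (fun y => (pev (PA (PC 3 p) (PM (PC 3 (-1)) (PV R 2))) y)^-1).
  apply/funext => x.
  transitivity (1 / 2 * p ^+ 2 + x 0 0 + x 0 1 * (p + -1 * x 0 2)^-1); last by [].
  by rewrite /hlam mulN1r.
apply: etrans H _; rewrite e1 /GRing.scale /= -/b mulr0 addr0 add0r mulrN1 opprK.
by [].
Qed.

(** Roots with multiplicities over an algebraically closed field. *)
Lemma cubic_roots : exists r1 r2 r3 : CR,
  forall p, p * (p - c) ^+ 2 - b = (p - r1) * (p - r2) * (p - r3).
Proof.
pose A : {poly CR} := 'X * ('X - c%:P) ^+ 2.
have mA : A \is monic by rewrite monicMl ?monicX // monic_exp // monicXsubC.
have sA : size A = 4.
  by rewrite /A mulrC size_mulX ?expf_neq0 ?polyXsubC_eq0 // size_exp_XsubC.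
have sb : (size (- b%:P : {poly CR})%R < size A)%N.
  by rewrite size_polyN sA; apply: leq_ltn_trans (size_polyC_leq1 _) _.
have [r rE] := closed_field_poly_normal (A - b%:P).
have lP : lead_coef (A - b%:P) = 1 by rewrite lead_coefDl //; exact/eqP.
have := congr1 (fun P : {poly CR} => size P) rE.
rewrite /= lP scale1r size_prod_XsubC size_polyDl // sA => -[].
move: rE; rewrite lP scale1r.
case: r => [|r1 [|r2 [|r3 [|? ?]]]] // rE _.
exists r1, r2, r3 => p; have := congr1 (horner^~ p) rE.
rewrite !big_cons big_nil mulr1 !(hornerD, hornerN, hornerM, horner_exp, hornerC, hornerX). 
by move=> H; rewrite expr2 H mulrA.
Qed.

(** Sum over the zeros of p (p - c)^2 - b of the residues of (p - c)^(2 - m) divided by this cubic. *)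
Definition rsum (m : nat) : CR := nth 0 [:: 1; 0; 0; b^-1; 0; c / b ^+ 2; b ^- 2] m.

(** For m > 2 the pole at c is removed with 1 / (p - c) = p (p - c) / b modulo the cubic: the integrand
    is a quadratic polynomial with coefficients [nums m] over the cubic plus a combination of
    negative powers of p - c with coefficients [tails m]. *)
Let nums (m : nat) : seq CR := nth [::]
  [:: [:: c ^+ 2; -2 * c; 1]; [:: - c; 1; 0]; [:: 1; 0; 0]; [:: 0; - c / b; b^-1];
      [:: 0; b^-1; 0]; [:: b^-1; - c ^+ 2 / b ^+ 2; c / b ^+ 2]; [:: 0; 0; b ^- 2]] m.
Let tails (m : nat) : seq CR := nth [::]
  [:: [::]; [::]; [::]; [:: - b^-1]; [:: 0; - b^-1]; [:: - c / b ^+ 2; 0; - b^-1];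
      [:: - b ^- 2; - c / b ^+ 2; 0; - b^-1]] m.

(** The critical points of lambda are the roots of the cubic, all different from c since b is not 0. *)
Lemma residue_rsum m w (f : CR -> CR) : (m < 7)%N ->
  (forall p, p != c -> f p = w * (p - c) ^- m / (p - b / (p - c) ^+ 2)) ->
  \sum_(p0 \in hcrit s) residue f p0 = w * rsum m.
Proof.
move=> m7 fE; have [r1 [r2 [r3 Q]]] := cubic_roots.
have rc r : r * (r - c) ^+ 2 - b = 0 -> r != c.
  move=> H; apply/eqP => rE; move: H; rewrite rE subrr expr0n mulr0 sub0r => /eqP.
  by rewrite oppr_eq0 (negbTE b0).
have q1 : r1 != c by apply: rc; rewrite Q subrr !mul0r.
have q2 : r2 != c by apply: rc; rewrite Q subrr mulr0 mul0r.
have q3 : r3 != c by apply: rc; rewrite Q subrr mulr0.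
have -> : rsum m = (nums m)`_2.
  by move: m m7 {fE} => [|[|[|[|[|[|[|]]]]]]].
pose g (p : CR) := (w%:P * Poly (0 :: tails m)).[(p - c)^-1].
have dg p : p != c -> derivable g p 1.
  move=> pc; apply/derivable1_diffP.
  apply: (@differentiable_comp _ _ _ _ (fun p : CR => (p - c)^-1) (horner _)).
    by apply/derivable1_diffP; exact: derivable_inv.
  by apply/derivable1_diffP; case: (is_derive_horner (w%:P * Poly (0 :: tails m)) (p - c)^-1).
have HC p : hcrit s p <-> [\/ p = r1, p = r2 | p = r3].
  rewrite /hcrit /=; split.
    move=> [pc]; rewrite hlam_derive // => H.
    have : p * (p - c) ^+ 2 - b = 0.
      have pc0 : p - c != 0 by rewrite subr_eq0.
      transitivity ((p - b / (p - c) ^+ 2) * (p - c) ^+ 2); last by rewrite H mul0r.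
      by rewrite mulrBl divfK // expf_neq0.
    rewrite Q => /eqP; rewrite !mulf_eq0 !subr_eq0 => /orP [/orP [|]|] /eqP ->;
      by [constructor 1|constructor 2|constructor 3].
  move=> Hp; have H : p * (p - c) ^+ 2 - b = 0.
    by rewrite Q; case: Hp => ->; rewrite subrr ?mulr0 ?mul0r.
  have pc := rc _ H; split=> //; rewrite hlam_derive //.
  have pc0 : p - c != 0 by rewrite subr_eq0.
  by apply: (mulIf (expf_neq0 2 pc0)); rewrite mulrBl mul0r divfK ?expf_neq0.
have Hpf : has_pf c g (w * (nums m)`_0) (w * (nums m)`_1) (w * (nums m)`_2) f r1 r2 r3.
  move=> p pc p1 p2 p3; rewrite fE // -Q.
  have pc0 : p - c != 0 by rewrite subr_eq0.
  have Q0 : p * (p - c) ^+ 2 - b != 0 by rewrite Q !mulf_neq0 // subr_eq0.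
  have -> : p - b / (p - c) ^+ 2 = (p * (p - c) ^+ 2 - b) / (p - c) ^+ 2.
    by rewrite mulrBl mulfK // expf_neq0.
  rewrite /g hornerM hornerC horner_Poly /=; move: m m7 {fE HC dg g} => [|[|[|[|[|[|[|]]]]]]] // _;
    rewrite /nums /tails [nth _ _ _]/=; cbn [horner_rec nth];
    move: b0 pc0 Q0; move: (b) (c) => b' c' b0' pc0 Q0;
    by field; rewrite ?b0' ?pc0 ?Q0.
exact: (residue_sum dg HC q1 q2 q3 Hpf).
Qed.

Lemma hmetricE i j : hmetric s i j = hw i * hw j * rsum (i + j).
Proof.
rewrite mxE; apply: residue_rsum; first by case: i j => [[|[|[|//]]] ?] [[|[|[|//]]] ?].
move=> p pc; rewrite hlam_derive // !hpdE // (exprD (p - c) i j) (invfM ((p - c) ^+ i) ((p - c) ^+ j)); congr (_ / _).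
move: (hw i) (hw j) ((p - c) ^- i) ((p - c) ^- j) => x y u v; by ring.
Qed.

Lemma hcubicE i j k : hcubic s i j k = hw i * hw j * hw k * rsum (i + j + k).
Proof.
apply: residue_rsum; first by case: i j k => [[|[|[|//]]] ?] [[|[|[|//]]] ?] [[|[|[|//]]] ?].
move=> p pc; rewrite hlam_derive // !hpdE // (exprD (p - c) (i + j) k) (exprD (p - c) i j) (invfM _ ((p - c) ^+ k)) (invfM ((p - c) ^+ i) ((p - c) ^+ j)); congr (_ / _).
move: (hw i) (hw j) (hw k) ((p - c) ^- i) ((p - c) ^- j) ((p - c) ^- k) => x y z u v w; by ring.
Qed.

Definition heta : 'M[CR]_3 := mx_of 3 3 [:: [:: 1; 0; 0]; [:: 0; 0; 1]; [:: 0; 1; 0]].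

Lemma hmetric_eta : hmetric s = heta.
Proof.
apply/matrixP => i j; rewrite hmetricE mxE /hw /rsum.
by move: i j => [[|[|[|//]]] ?] [[|[|[|//]]] ?] /=; field; rewrite ?b0.
Qed.

Lemma heta_inv : invmx heta = heta.
Proof.
have E : heta *m heta = 1%:M.
  apply/matrixP => i j; rewrite mxE sum3 !mxE.
  by move: i j => [[|[|[|//]]] ?] [[|[|[|//]]] ?] /=; ring.
by rewrite -[LHS]mulmx1 -E mulmxA mulVmx ?mul1mx //; case/mulmx1_unit: E.
Qed.

Lemma hmultE i j k : df_mult (hurwitz R) s i j 0 k =
  hw i * hw j * nth 0 [:: rsum (i + j); b * rsum (i + j + 2); rsum (i + j + 1)] k.
Proof.
rewrite /= hmetric_eta heta_inv mxE sum3 !mxE !hcubicE /hw.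
by move: k => [[|[|[|//]]] ?] /=; rewrite ?addn0; ring.
Qed.

End Point.

Variables (U : set CR) (ell : CR -> CR).
Hypothesis Hlog : log_branch U ell.
Local Notation F := (potential ell).
Local Notation M := (Mlog U).

(** The change of coordinates a = t_1, b = - ga t_3 / 2, c = ga t_2, with ga^2 = -2,
    matches the metrics up to the factor 1/2. *)
Lemma hurwitz_equivalent :
  DF_equivalent (DF_of_potential M 0 F (Om1 R) (@euler_field R)) (hurwitz R).
Proof.
pose ga : CR := 'i * sqrtC 2.
have ga2 : ga ^+ 2 = -2 by rewrite exprMn sqrCi sqrtCK mulN1r.
have ga0 : ga != 0.
  by apply/eqP => g; move: ga2; rewrite g expr0n => /eqP; rewrite eq_sym oppr_eq0 pnatr_eq0.
(* - ga / 2 is the inverse of ga *)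
pose A : 'M[CR]_3 := mx_of 3 3 [:: [:: 1; 0; 0]; [:: 0; 0; ga]; [:: 0; - ga / 2; 0]].
exists A, 0, (1 / 2); split.
- have d : \det A = -1.
    rewrite det3 !mxE /=; transitivity (ga ^+ 2 / 2); first by field.
    by rewrite ga2; field.
  by rewrite unitmxE d unitrN1.
- by rewrite mulf_neq0 ?oner_neq0 ?invr_eq0 ?pnatr_eq0.
move=> t Mt; have t0 := Mneq0 Hlog Mt; cbv zeta; rewrite addr0.
set s := t *m A.
have s0 : s 0 0 = t 0 0 by rewrite mxE sum3 !mxE /=; ring.
have s1 : s 0 1 = - ga / 2 * t 0 2 by rewrite mxE sum3 !mxE /=; ring.
have s2 : s 0 2 = ga * t 0 1 by rewrite mxE sum3 !mxE /=; ring.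
have b0 : s 0 1 != 0 by rewrite s1 !mulf_neq0 ?oppr_eq0 ?invr_eq0 ?pnatr_eq0.
split.
- exact: b0.
- rewrite [LHS]/= [df_metric _ _]/= hmetric_eta //; apply/matrixP => i j.
  rewrite mxE (thirdE Hlog) // /third_val mxE [X in _ * X]mxE sum3 ![(_ *m _) _ _]mxE !sum3 !mxE.
  by move: i j => [[|[|[|//]]] ?] [[|[|[|//]]] ?] /=; field: ga2.
- move=> i j.
  have DE k : df_mult (DF_of_potential M 0 F (Om1 R) (@euler_field R)) t i j 0 k =
    2 * third_val (nth 0%N [:: 0; 2; 1]%N k) i j t by exact: (pot_mult_F Hlog).
  have DE' := hmultE b0.
  move: (df_mult (DF_of_potential M 0 F (Om1 R) (@euler_field R)) t i j) DE => D DE.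
  move: (df_mult (hurwitz R) s) DE' => D' DE'.
  apply: transportE => k; rewrite !sum3 !DE !DE' /hw /rsum s1 s2 /third_val !mxE.
  move: (t 0 1) (t 0 2) t0 {Mt s s0 s1 s2 b0 D DE D' DE'} => x y y0.
  by move: i j k => [[|[|[|//]]] ?] [[|[|[|//]]] ?] [[|[|[|//]]] ?] /=; field: ga2; rewrite ?ga0 ?y0.
- by apply/rowP => k; rewrite mxE sum3 !mxE; move: k => [[|[|[|//]]] ?] /=; ring.
- apply/rowP => k; rewrite mxE sum3 !euler_fieldE [RHS]mxE s0 s1 s2 !mxE.
  by move: k => [[|[|[|//]]] ?] /=; field.
Qed.

End Hurwitz.

(** * Central invariants *)

Section CentralInvariants.
Variable R : realType.
Local Notation CR := (CC R).

(** Determinant of Omega_2 - lam Omega_1 at a point with coordinates (x + lam, y, z). *)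
Definition char_det (x y z : CR) : CR :=
  36 * x * y * z - 8 * x * y ^+ 4 + 16 * x ^+ 2 * y ^+ 2 - 8 * x ^+ 3 - 4 * y ^+ 3 * z + 27 / 2 * z ^+ 2.

Lemma charpolE lam (t : 'rV[CR]_3) :
  charpol (@Omega2 R) (fun=> Om1 R) lam t = char_det (t 0 0 - lam) (t 0 1) (t 0 2).
Proof. by rewrite /charpol det3 !mxE /= /char_det; field. Qed.

Definition char_det_tab (lam : CR) : pexp R 3 :=
  let c k := @PC R 3 k in
  let d := PA (PV R 0) (c (- lam)) in let y := PV R 1 in let z := PV R 2 in
  PA (PM (c 36) (PM d (PM y z))) (PA (PM (c (-8)) (PM d (PM (PM y y) (PM y y))))
  (PA (PM (c 16) (PM (PM d d) (PM y y))) (PA (PM (c (-8)) (PM d (PM d d)))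
  (PA (PM (c (-4)) (PM (PM y (PM y y)) z)) (PM (c (27 / 2)) (PM z z)))))).

Lemma charpol_tab lam (t : 'rV[CR]_3) :
  charpol (@Omega2 R) (fun=> Om1 R) lam t = pev (char_det_tab lam) t.
Proof. by rewrite charpolE /char_det /=; field. Qed.

Definition char_det_d (k : nat) (x y z : CR) : CR := nth 0
  [:: 36 * y * z - 8 * y ^+ 4 + 32 * x * y ^+ 2 - 24 * x ^+ 2;
      36 * x * z - 32 * x * y ^+ 3 + 32 * x ^+ 2 * y - 12 * y ^+ 2 * z;
      36 * x * y - 4 * y ^+ 3 + 27 * z] k.

Lemma charpol_pd (k : 'I_3) lam t :
  pd k (charpol (@Omega2 R) (fun=> Om1 R) lam) t = char_det_d k (t 0 0 - lam) (t 0 1) (t 0 2).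
Proof.
have -> : charpol (@Omega2 R) (fun=> Om1 R) lam = pev (char_det_tab lam).
  by apply/funext => s; exact: charpol_tab.
by rewrite pd_pev /char_det_d; move: k => [[|[|[|//]]] ?] /=; field.
Qed.

Lemma charpol_dlam lam t :
  derive1 (fun l => charpol (@Omega2 R) (fun=> Om1 R) l t) lam
  = - char_det_d 0 (t 0 0 - lam) (t 0 1) (t 0 2).
Proof.
rewrite /char_det_d /=; under eq_fun do rewrite charpolE.
move: (t 0 0) (t 0 1) (t 0 2) => x y z.
pose d : {poly CR} := x%:P - 'X.
pose P : {poly CR} := (36 * y * z - 8 * y ^+ 4)%:P * d + (16 * y ^+ 2)%:P * d * d
  + (-8)%:P * d * d * d + (- 4 * y ^+ 3 * z + 27 / 2 * z ^+ 2)%:P.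
rewrite (@derive1_horner _ _ P) => [|l]; last first.
  rewrite /P /d /char_det !(hornerD, hornerN, hornerM, hornerC, hornerX); by field.
rewrite /P /d.
rewrite !(poly.derivD, poly.derivN, poly.derivM, derivC, derivX).
rewrite !(hornerD, hornerN, hornerM, hornerC, hornerX); by field.
Qed.

(** The roots in x are uniformised by a cubic equation: if r (r - y)^2 = z / 4 then
    x = 3 r^2 - 2 r y is a root. The three solutions r have elementary symmetric functions 2 y, y^2
    and z / 4. *)
Lemma char_det_factor y z : exists r1 r2 r3 : CR,
  [/\ r1 + r2 + r3 = 2 * y, r1 * r2 + r1 * r3 + r2 * r3 = y ^+ 2, 4 * r1 * r2 * r3 = z &
   forall x, char_det x y z = -8 * (x - (3 * r1 ^+ 2 - 2 * r1 * y))
     * (x - (3 * r2 ^+ 2 - 2 * r2 * y)) * (x - (3 * r3 ^+ 2 - 2 * r3 * y))].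
Proof.
have [r1 [r2 [r3 H]]] := cubic_roots (row3 0 (z / 4) y).
have H0 := H 0; have H1 := H 1; have H2 := H (-1).
rewrite !mxE /= in H0 H1 H2.
have e3 : 4 * r1 * r2 * r3 = z.
  transitivity (-4 * ((0 - r1) * (0 - r2) * (0 - r3))); first by ring.
  by rewrite -H0; field.
have e1 : r1 + r2 + r3 = 2 * y.
  transitivity (- (((1 - r1) * (1 - r2) * (1 - r3) + (-1 - r1) * (-1 - r2) * (-1 - r3)) / 2
     - (0 - r1) * (0 - r2) * (0 - r3))); first by field.
  by rewrite -H0 -H1 -H2; field.
have e2 : r1 * r2 + r1 * r3 + r2 * r3 = y ^+ 2.
  transitivity (((1 - r1) * (1 - r2) * (1 - r3) - (-1 - r1) * (-1 - r2) * (-1 - r3)) / 2 - 1).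
    by field.
  by rewrite -H1 -H2; field.
exists r1, r2, r3; split=> // x.
have E1 : r1 = 2 * y - r2 - r3 by rewrite -e1; ring.
(* eliminate r1 and then r2^2, the normal form modulo the symmetric relations *)
have E2 : r2 ^+ 2 = - r3 ^+ 2 - r2 * r3 + 2 * y * (r2 + r3) - y ^+ 2.
  by rewrite -e2 E1; ring.
rewrite /char_det -e3 E1; by field: E2.
Qed.

(** On the uniformised discriminant the gradient factors. *)
Lemma char_det_d_root (r y : CR) (x := 3 * r ^+ 2 - 2 * r * y) (z := 4 * r * (r - y) ^+ 2) :
  [/\ char_det_d 0 x y z = -8 * (3 * r - y) ^+ 3 * (r - y),
      char_det_d 1 x y z = 16 * r * (r - y) * (3 * r - y) ^+ 3
    & char_det_d 2 x y z = 4 * (3 * r - y) ^+ 3].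
Proof. by split; rewrite /char_det_d /x /z /=; ring. Qed.

(** At a root the gradient is given by [char_det_d_root]; in terms of u = 3 r - y and w = r - y the
    denominator is the square of 128 u^7 w, and the quotient is constant. Neither factor vanishes when
    z and 27 z - 16 y^3 are not 0. *)
Lemma central_invariant_const lam (t : 'rV[CR]_3) :
  t 0 2 != 0 -> 27 * t 0 2 - 16 * t 0 1 ^+ 3 != 0 ->
  charpol (@Omega2 R) (fun=> Om1 R) lam t = 0 ->
  central_invariant (@Omega2 R) (fun=> Om1 R) (@S22 R) (fun=> S12 R) lam t = - (1 / 96).
Proof.
move=> z0 dz; rewrite charpolE => H.
have [r1 [r2 [r3 [e1 e2 e3 F]]]] := char_det_factor (t 0 1) (t 0 2).
set y := t 0 1 in dz e1 e2 F H *; set z := t 0 2 in z0 dz e3 F H *.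
have HQ r : (r - r1) * (r - r2) * (r - r3) = r * (r - y) ^+ 2 - z / 4.
  transitivity (r ^+ 3 - (r1 + r2 + r3) * r ^+ 2 + (r1 * r2 + r1 * r3 + r2 * r3) * r - 4 * r1 * r2 * r3 / 4).
    by field.
  by rewrite e1 e2 e3; field.
have [r [xE zE]] : exists r, t 0 0 - lam = 3 * r ^+ 2 - 2 * r * y /\ z = 4 * r * (r - y) ^+ 2.
  have zr r : (r - r1) * (r - r2) * (r - r3) = 0 -> z = 4 * r * (r - y) ^+ 2.
    move=> E; apply/eqP; rewrite -subr_eq0 -oppr_eq0.
    have -> : - (z - 4 * r * (r - y) ^+ 2) = 4 * ((r - r1) * (r - r2) * (r - r3)).
      by rewrite HQ; field.
    by rewrite E mulr0.
  move: H; rewrite F => /eqP; rewrite !mulf_eq0 oppr_eq0 pnatr_eq0 /= !subr_eq0.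
  move=> /orP [/orP [|]|] /eqP xE; [exists r1|exists r2|exists r3]; split=> //; apply: zr;
    by rewrite subrr ?mulr0 ?mul0r.
have ry : r - y != 0 by apply: contra_neq z0 => E; rewrite zE E expr0n mulr0.
have r3y : 3 * r - y != 0.
  apply: contra_neq dz => E; have yE : y = 3 * r by rewrite -[RHS](subrK y) E add0r.
  by rewrite zE yE; ring.
have [d0 d1 d2] := char_det_d_root r y; rewrite -xE -zE in d0 d1 d2.
rewrite /central_invariant charpol_dlam !sum3 !charpol_pd -/y -/z.
have d2' : char_det_d (nat_of_ord (2%R : 'I_3)) (t 0 0 - lam) y z = 4 * (3 * r - y) ^+ 3 by exact: d2.
rewrite !d0 !d1 !d2' !mxE /= -/y.
have -> : t 0 0 = lam + (3 * r ^+ 2 - 2 * r * y) by rewrite -xE; ring.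
move: ry r3y; set w := r - y; set u := 3 * r - y => w0 u0.
have -> : r = (u - w) / 2 by rewrite /u /w; field.
have -> : y = (u - 3 * w) / 2 by rewrite /u /w; field.
move: u w u0 w0 {xE zE d0 d1 d2 d2'} => u w u0 w0.
set q := (X in _ / X ^+ 2).
have -> : q = 128 * u ^+ 7 * w by rewrite /q; field.
by field; rewrite u0 w0.
Qed.

(** Two roots x collide only if two solutions r collide or 3 r = 4 y for the third one. *)
Lemma charpol_roots (t : 'rV[CR]_3) :
  t 0 2 != 0 -> 27 * t 0 2 - 16 * t 0 1 ^+ 3 != 0 ->
  exists u : 'I_3 -> CR, injective u /\
    forall i, charpol (@Omega2 R) (fun=> Om1 R) (u i) t = 0.
Proof.
move=> z0 dz; have [r1 [r2 [r3 [e1 e2 e3 F]]]] := char_det_factor (t 0 1) (t 0 2).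
move: z0 dz e1 e2 e3 F; move: (t 0 1) (t 0 2) (charpolE^~ t) => y z cE z0 dz e1 e2 e3 F.
(* two solutions of p (p - y)^2 = z / 4 coincide only at p = y or p = y / 3 *)
have ne (p q r : CR) : p + q + r = 2 * y -> p * q + p * r + q * r = y ^+ 2 ->
    4 * p * q * r = z -> p != q /\ 4 * y - 3 * r != 0.
  move=> s1 s2 s3; have rE : r = 2 * y - p - q by rewrite -s1; ring.
  split.
    apply: contra_neq dz => pq; move: s1 s2 s3 rE; rewrite -pq => s1 s2 s3 rE.
    have : (p - y) * (3 * p - y) = 0.
      transitivity (y ^+ 2 - (p * p + p * r + p * r)); first by rewrite rE; ring.
      by rewrite s2 subrr.
    move=> /eqP; rewrite mulf_eq0 => /orP [/eqP E|/eqP E].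
      have r0 : r = 0 by rewrite rE; move/eqP: E; rewrite subr_eq0 => /eqP ->; ring.
      by move: z0; rewrite -s3 r0 mulr0 eqxx.
    have yE : y = 3 * p by rewrite -[RHS](subrK y) E add0r.
    by rewrite -s3 rE yE; ring.
  apply: contra_neq dz => E.
  have yE : y = 3 / 4 * r by rewrite -[LHS](@mulKf _ 4) ?pnatr_eq0 // -(subrK (3 * r) (4 * y)) E add0r; field.
  have pq : p * q = (y - r) ^+ 2.
    transitivity ((p * q + p * r + q * r) - r * (p + q + r) + r ^+ 2); first by ring.
    by rewrite s1 s2; ring.
  transitivity (27 * (4 * (p * q) * r) - 16 * y ^+ 3); first by rewrite -s3; ring.
  by rewrite pq yE; field.
have [n12 m3] := ne r1 r2 r3 e1 e2 e3.
have [n13 m2] : r1 != r3 /\ 4 * y - 3 * r2 != 0.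
  by apply: ne; [rewrite -e1|rewrite -e2|rewrite -e3]; ring.
have [n23 m1] : r2 != r3 /\ 4 * y - 3 * r1 != 0.
  by apply: ne; [rewrite -e1|rewrite -e2|rewrite -e3]; ring.
pose x r := 3 * r ^+ 2 - 2 * r * y.
have nx p q r : p + q + r = 2 * y -> p != q -> 4 * y - 3 * r != 0 -> x p != x q.
  move=> s pq rr; rewrite -subr_eq0.
  have -> : x p - x q = (p - q) * (4 * y - 3 * r).
    have -> : r = 2 * y - p - q by rewrite -s; ring.
    by rewrite /x; ring.
  by rewrite mulf_neq0 // subr_eq0.
have x12 := nx _ _ _ e1 n12 m3.
have x13 : x r1 != x r3 by apply: (nx _ _ r2) => //; rewrite -e1; ring.
have x23 : x r2 != x r3 by apply: (nx _ _ r1) => //; rewrite -e1; ring.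
exists (fun i : 'I_3 => t 0 0 - nth 0 [:: x r1; x r2; x r3] i); split.
  move=> i j /addrI /oppr_inj E; apply/val_inj; move: i j E.
  by move=> [[|[|[|//]]] ?] [[|[|[|//]]] ?] //= E; move: x12 x13 x23; rewrite ?E ?eqxx.
move=> i; rewrite cE F subKr.
by move: i => [[|[|[|//]]] ?] /=; rewrite /x subrr ?mulr0 ?mul0r.
Qed.

(** The open dense set is the complement of z (27 z - 16 y^3) = 0. *)
Lemma central_invariants_P2_P1 : central_invariants_eq (@P2 R) (@P1 R) (- (1 / 96)).
Proof.
split; first by move=> a b j J; rewrite P2_part2 P1_part2.
have l1 : lb_lead (@P2 R) 1 = @Omega2 R by apply/funext => t; exact: P2_lead1.
have l2 : lb_lead (@P1 R) 1 = fun=> Om1 R by apply/funext => t; exact: P1_lead1.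
have l3 : lb_lead (@P2 R) 3 = @S22 R by apply/funext => t; exact: P2_lead3.
have l4 : lb_lead (@P1 R) 3 = fun=> S12 R by apply/funext => t; exact: P1_lead3.
rewrite l1 l2 l3 l4.
pose y := PV R (1 : 'I_3); pose z := PV R (2 : 'I_3).
pose e := PM z (PA (PM (PC 3 27) z) (PM (PC 3 (-16)) (PM y (PM y y)))).
have eE t : pev e t = t 0 2 * (27 * t 0 2 - 16 * t 0 1 ^+ 3) by rewrite /=; ring.
exists [set t | pev e t != 0]; split; first exact: open_pev.
  apply: (@dense_pev _ _ _ (row3 0 0 1)); rewrite eE !mxE /= expr0n mulr0 subr0 mulr1 mul1r.
  by rewrite pnatr_eq0.
move=> t Ut; have : pev e t != 0 by exact: Ut.
rewrite eE mulf_eq0 negb_or => /andP [z0 dz].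
by split=> [|lam]; [exact: charpol_roots|exact: central_invariant_const].
Qed.

End CentralInvariants.

(** * The theorem *)

Theorem mainTheorem2 (R : realType) :
  (* the setting: sl2-triple in sl_4, coordinates on the Slodowy slice,
     existence and uniqueness of the lifts *)
  [/\ sl4 (L1 R) /\ sl4 (hmx R) /\ sl4 (fmx R),
      lie_br (hmx R) (L1 R) = L1 R /\ lie_br (hmx R) (fmx R) = - fmx R /\
      lie_br (L1 R) (fmx R) = 2 *: hmx R,
      (forall z : 'rV[CC R]_5, slodowy (qmx z)) /\
      (forall A : 'M[CC R]_4, slodowy A -> exists! z : 'rV[CC R]_5, A = qmx z)
    & forall q xi : R -> 'rV[CC R]_5, mxloop q -> mxloop xi ->
        exists! A : R -> 'M[CC R]_4, is_lift q xi A] /\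
  (* PQ, PN : local forms of B_2 on the loop space of Q and of its Dirac
     reduction, in the coordinates z; P2 : the latter in the coordinates t *)
  exists (PQ : lbracket R 5) (PN P2 : lbracket R 3),
    let P1 := lb_lie 0 P2 in
    let O2 : tensor2 R 3 := lb_lead P2 1 in
    let e : vfield R 3 := fun=> delta_mx 0 0 in
    let O1 : tensor2 R 3 := lie2 e O2 in
    let E : vfield R 3 := fun t => (1 / 2) *: row 0 (O2 t) in
    [/\ is_W_local_form PQ, is_dirac_reduction PQ PN,
        bijective (@tcoord R) /\ is_local P2 /\ lb_in_coordinates (@tcoord R) PN P2
      & forall z, \det (lie2 (fun=> delta_mx 0 2) (lb_lead PN 1) z) = 0] /\
    (* (1) *)
    [/\ forall z i, 'D_(efield z) (fun w => tcoord w 0 i) z = e (tcoord z) 0 i,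
        dispersionless_limit P2,
        forall t, lb_lead P2 2 t = 0,
        forall t, O2 t = Omega2 t
      & forall t, lb_lead P2 3 t = S22 t] /\
    (* (2) *)
    [/\ forall t, lie2 e O1 t = 0,
        forall t, O1 t \in unitmx,
        lb_lie 0 P1 = (fun _ _ _ _ => 0),
        bihamiltonian P2 P1
      & dispersionless_limit P1 /\ exact_pencil 0 P2 P1] /\
    (* (3) *)
    [/\ flat_pencil O2 O1,
        quasihomogeneous O2 O1 0 e E,
        (* the tensor R is degenerate: see regularity_tensor_degenerate *)
        forall t, regularity_tensor O1 0 E t = diag_mx (row3 (1 / 2) 0 1),
        forall t, O1 t = O1 0
      & forall (U : set (CC R)) (ell : CC R -> CC R), log_branch U ell ->
          let M : set 'rV[CC R]_3 := [set t : 'rV[CC R]_3 | U (t 0 2)] in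
          let F := potential ell in
          [/\ DF_potential M 0 F (O1 0) E 0,
              forall t, M t -> intersection_form (O1 0) F E t = O2 t,
              forall t, M t -> app_vf E F t = 3 * F t - 3 / 16 * t 0 2 ^+ 2
            & DF_equivalent (DF_of_potential M 0 F (O1 0) E) (hurwitz R)]] /\
    (* (4) *)
    central_invariants_eq P2 P1 (- (1 / 96)) /\ topological_type P2 P1.
Proof.
have l2 : lb_lead (@P2 R) 1 = Om_lam 0 by apply/funext => t; exact: P2_lead1_lam.
have E1 : lie2 (fun=> delta_mx 0 0) (Om_lam (0 : CC R)) = fun=> Om1 R := lie_e_O2 R.
split.
  split; [exact: triple_sl4|exact: triple_rel| |exact: lift_exists].
  by split; [exact: slodowy_qmx|exact: slodowy_coord].
exists (@Wop R), (@PN R), (@P2 R); cbv zeta.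
rewrite lie_P2 l2 E1.
split; last split; last split; last split; last split.
- split; [exact: W_local_form|exact: PN_dirac| |exact: lie_z3_degenerate].
  by split; [exact: tcoord_bij|split; [exact: P2_local|exact: P2_coordinates]].
- split; [exact: efield_tcoord|exact: P2_displess|exact: P2_lead2| |exact: P2_lead3].
  by move=> t; rewrite Om_lamE scale0r addr0.
- split.
  + by move=> t; rewrite (lie_e_O1 R).
  + by move=> t; exact: Om1_unit.
  + exact: lie_P1.
  + exact: bihamiltonian_P2_P1.
  + split; first exact: P1_displess.
    by split; [exact: bihamiltonian_P2_P1|exact: lie_P2|exact: lie_P1].
- split; [exact: flat_pencil_Omega|exact: quasihomogeneous_Omega|exact: regularity_tensor_diag| |].
    by [].
  move=> U ell Hlog; split.
  + exact: DF_potential_F Hlog.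
  + exact: intersection_F Hlog.
  + exact: euler_F Hlog.
  + exact: hurwitz_equivalent Hlog.
- exact: central_invariants_P2_P1.
- by split; [exact: bihamiltonian_P2_P1|exists (- (1 / 96)); exact: central_invariants_P2_P1].
Qed.
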